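(* Let $k>0$, let $\alpha,\mu,\omega,\gamma\in\mathbb{C}$ with $\operatorname{Re}(\alpha)>0$, $\operatorname{Re}(\mu)>0$, and let $m=[\operatorname{Re}(\mu)/k]+1$. Let $f\in AC^{m}[0,b]$ for every $b>0$ be such that the Laplace transforms of $f$ and of the regularized $k$-Prabhakar derivative ${}_{k}^{C}D_{\alpha,\mu,\omega}^{\gamma}f$ exist, and let $F(u)=\mathcal{L}[f](u)$. Then, for $u$ with $\left|\omega k(ku)^{-\alpha/k}\right|<1$, $$\mathcal{L}\big({}_{k}^{C}D_{\alpha,\mu,\omega}^{\gamma}f(t)\big)(u)=(ku)^{\frac{\mu}{k}}\Big(1-\omega k(ku)^{-\frac{\alpha}{k}}\Big)^{\frac{\gamma}{k}}F(u)-\sum_{n=0}^{m-1}k^{n+1}(ku)^{\frac{-(n+1)k+\mu}{k}}\Big(1-\omega k(ku)^{-\frac{\alpha}{k}}\Big)^{\frac{\gamma}{k}}f^{(n)}(0^{+}).$$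
   Context: The Laplace transform is $\mathcal{L}[f](u)=\int_0^\infty e^{-ut}f(t)\,dt$ (when the integral exists; $\operatorname{Re}u>0$). Complex powers are principal branches; $[\cdot]$ in the definition of $m$ is the integer part. $AC^{n}[a,b]$ is the set of $f:[a,b]\to\mathbb{R}$ with $\frac{d^{n-1}}{dt^{n-1}}f$ absolutely continuous on $[a,b]$. The $k$-gamma function is $\Gamma_k(z)=\int_0^\infty e^{-t^k/k}t^{z-1}\,dt$ for $\operatorname{Re}z>0$, and the $k$-Pochhammer symbol is $(\gamma)_{n,k}=\gamma(\gamma+k)\cdots(\gamma+(n-1)k)$, $(\gamma)_{0,k}=1$. The $k$-Mittag-Leffler function is $E_{k,\alpha,\mu}^{\gamma}(z)=\sum_{n=0}^\infty \frac{(\gamma)_{n,k}}{\Gamma_k(\alpha n+\mu)}\frac{z^n}{n!}$. The $k$-Prabhakar integral (for $\operatorname{Re}\alpha,\operatorname{Re}\mu>0$) is $$\big({}_{k}P_{\alpha,\mu,\omega}^{\gamma}f\big)(x)=\int_0^x\frac{(x-t)^{\frac{\mu}{k}-1}}{k}E_{k,\alpha,\mu}^{\gamma}\big[\omega(x-t)^{\frac{\alpha}{k}}\big]f(t)\,dt .$$ The regularized $k$-Prabhakar fractional derivative of order $\mu$, with $m=[\operatorname{Re}(\mu)/k]+1$, is $${}_{k}^{C}D_{\alpha,\mu,\omega}^{\gamma}f(t)=k^{m}\,{}_{k}P_{\alpha,mk-\mu,\omega}^{-\gamma}\Big(\frac{d}{dt}\Big)^{m}f(t).$$ *)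

(* Defs.v *)
From HB Require Import structures.
From mathcomp Require Import all_boot all_order all_algebra.
From mathcomp Require Import complex.
From mathcomp Require Import all_classical all_reals all_analysis.

Set Implicit Arguments.
Unset Strict Implicit.
Unset Printing Implicit Defensive.

Import Order.TTheory GRing.Theory Num.Theory.
Import numFieldNormedType.Exports.

Local Open Scope classical_set_scope.
Local Open Scope ring_scope.
Local Open Scope complex_scope.

Section ComplexFunctions.
Context {R : realType}.
Implicit Types z w : R[i].

Definition cexp z : R[i] :=
  (expR (complex.Re z) * cos (complex.Im z))
  +i* (expR (complex.Re z) * sin (complex.Im z)).

Definition cmod z : R := complex.Re `|z|.

(* Principal argument, with values in ]-pi, pi] when z != 0. *)
Definition carg z : R :=
  if 0 <= complex.Im z then acos (complex.Re z / cmod z)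
  else - acos (complex.Re z / cmod z).

Definition clog z : R[i] := ln (cmod z) +i* carg z.

(* Principal branch of z ^ w, with 0 ^ 0 = 1 and 0 ^ w = 0 for w != 0. *)
Definition cpow z w : R[i] :=
  if z == 0 then (w == 0)%:R else cexp (w * clog z).

(* Limits and Lebesgue integrals of complex-valued functions are taken
   componentwise. *)
Definition ccvg {T : Type} (F : set_system T) (g : T -> R[i]) : Prop :=
  cvg (complex.Re (g x) @[x --> F]) /\ cvg (complex.Im (g x) @[x --> F]).

Definition clim {T : Type} (F : set_system T) (g : T -> R[i]) : R[i] :=
  lim (complex.Re (g x) @[x --> F]) +i* lim (complex.Im (g x) @[x --> F]).

Definition cintegrable (D : set R) (g : R -> R[i]) : Prop :=
  lebesgue_measure.-integrable D (fun t => (complex.Re (g t))%:E) /\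
  lebesgue_measure.-integrable D (fun t => (complex.Im (g t))%:E).

Definition cintegral (D : set R) (g : R -> R[i]) : R[i] :=
  Rintegral lebesgue_measure D (fun t => complex.Re (g t))
  +i* Rintegral lebesgue_measure D (fun t => complex.Im (g t)).

End ComplexFunctions.

Section Laplace.
Context {R : realType}.
Implicit Types (g : R -> R[i]) (u : R[i]).

(* The integral over [0, +oo[ is the limit of the Lebesgue integrals over
   [0, T]; it need not converge absolutely. *)
Definition laplace_partial g u (T : R) : R[i] :=
  cintegral `[0, T] (fun t => cexp (- (u * t%:C)) * g t).

Definition laplace_exists g u : Prop :=
  (forall T : R, 0 < T ->
     cintegrable `[0, T] (fun t => cexp (- (u * t%:C)) * g t)) /\
  ccvg +oo%R (laplace_partial g u).

Definition laplace g u : R[i] := clim +oo%R (laplace_partial g u).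

End Laplace.

Section AbsoluteContinuity.
Context {R : realType}.
Implicit Types (a b : R) (f g : R -> R).

Definition abs_continuous_on a b f : Prop :=
  forall e : R, 0 < e -> exists2 d : R, 0 < d &
    forall (n : nat) (s t : 'I_n -> R),
      (forall i, [/\ a <= s i, s i <= t i & t i <= b]) ->
      trivIset [set: 'I_n] (fun i => `]s i, t i[%classic) ->
      \sum_(i < n) (t i - s i) < d ->
      \sum_(i < n) `|f (t i) - f (s i)| < e.

(* The derivative is one-sided at the endpoints, so that the values of f
   outside [a, b] are irrelevant. *)
Definition has_derivative_on a b f g : Prop :=
  forall x, x \in `[a, b] ->
    (f y - f x) / (y - x) @[y --> within `[a, b] x^'] --> g x.

(* The witness h lists the successive derivatives of f on [a, b]; only used
   with n >= 1. *)
Definition AC_on (n : nat) a b f : Prop :=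
  exists h : nat -> R -> R,
    [/\ (forall x, x \in `[a, b] -> h 0%N x = f x),
        (forall i, (i < n.-1)%N -> has_derivative_on a b (h i) (h i.+1)) &
        abs_continuous_on a b (h n.-1)].

End AbsoluteContinuity.

Section KPrabhakar.
Context {R : realType}.
Implicit Types (k : R) (alpha mu omega gamma z : R[i]).

Definition kGamma k z : R[i] :=
  cintegral `]0, +oo[
    (fun t => cexp (- ((t `^ k) / k)%:C) * cpow t%:C (z - 1)).

Definition kPochhammer k gamma (n : nat) : R[i] :=
  \prod_(i < n) (gamma + i%:R * k%:C).

Definition kMittagLeffler k alpha mu gamma z : R[i] :=
  clim \oo (fun N : nat => \sum_(0 <= n < N)
    (kPochhammer k gamma n / kGamma k (alpha * n%:R + mu)
     * (z ^+ n / n`!%:R))).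

Definition kPrabhakar k alpha mu omega gamma (g : R -> R[i]) (x : R) : R[i] :=
  cintegral `[0, x] (fun t =>
    cpow (x - t)%:C (mu / k%:C - 1) / k%:C
    * kMittagLeffler k alpha mu gamma
        (omega * cpow (x - t)%:C (alpha / k%:C))
    * g t).

Definition kPrabhakar_order k mu : nat := (Num.truncn (complex.Re mu / k)).+1.

(* The m-th derivative of f need only exist almost everywhere; derive1n takes
   a default value elsewhere, which does not affect the integral. *)
Definition kPrabhakar_deriv k alpha mu omega gamma (f : R -> R) (t : R) :
    R[i] :=
  let m := kPrabhakar_order k mu in
  k%:C ^+ m *
  kPrabhakar k alpha (m%:R * k%:C - mu) omega (- gamma)
    (fun s => (derive1n m f s)%:C) t.

End KPrabhakar.

(* Main.v *)
From HB Require Import structures.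
From mathcomp Require Import all_boot all_order all_algebra.
From mathcomp Require Import complex.
From mathcomp Require Import all_classical all_reals all_analysis measurable_realfun.
From mathcomp Require Import ring lra zify.
Require Import Defs.

Set Implicit Arguments.
Unset Strict Implicit.
Unset Printing Implicit Defensive.

Import Order.TTheory GRing.Theory Num.Theory.
Import numFieldNormedType.Exports.

(** Write [L] for the absolutely convergent Laplace transform, [I] for the
primitive from 0, [K] for the kernel of the integral in the definition of the
derivative, [h] for the regularized derivative of [f] and [nu = m k - mu].
Formally [h = k^m K * f^(m)], the transform of [K] is
[(k v)^(-nu/k) (1 - om k (k v)^(-al/k))^(gamma/k)], and that of [f^(m)] is
[v^m F(v) - sum_n f^(n)(0) v^(m-1-n)]; the formula is the product of the two.
Three things prevent this computation from being a proof: [f^(m)] exists only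
almost everywhere and has no transform of its own, the transforms of [f] and
[h] converge only conditionally at [u], and the transform of [K] converges
only for large [Re v], not at [u].

For the first point everything is integrated [m+1] times.  An absolutely
continuous function is the integral of an integrable density
([abs_continuous_on_density]: split [F] as a difference of two monotone
absolutely continuous functions, whose Stieltjes measures are dominated by
Lebesgue measure, and apply Radon-Nikodym), which gives a Taylor formula with
integral remainder ([ac_taylor]) and hence the Volterra equation
[I^(m+1) h = k^m K * (I f - sum_n f^(n)(0) I^(n+1) 1)]
([kderiv_volterra]), in which all functions are locally integrable.

For the second point, if the Laplace integral of [phi] converges at [u], its
partial integrals [P] are bounded and
[v L(I phi)(v) = (v - u) L(P)(v - u)] for [Re v > Re u].  So [I phi] has an
absolutely convergent transform to the right of [u], and
[v L(I phi)(v)] tends to the improper Laplace integral as [v = r u] and [r]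
decreases to 1 ([laplace_continuation], by the Abelian theorem
[abelian_theorem]).

For the third point, the transform of [K] is computed termwise for large
[Re v] ([kern0_Lap]).  The exchange of sum and integral needs a lower bound on
the modulus of the gamma function at the exponents [(al n + nu)/k]
([cGamma_ge_ratio]); the resulting series is the binomial series.  The
transformed Volterra equation thus holds at [v = r u] for large [r].  Both of
its sides are real analytic in [r > 1], because the condition
[|om k (k r u)^(-al/k)| < 1] at [r = 1] persists for [r > 1]; by the identity
theorem [analytic_eq0] they agree for all [r > 1] ([ray_identity]), and [r]
tends to 1. *)

Local Open Scope classical_set_scope.
Local Open Scope ring_scope.
Local Open Scope complex_scope.

(** * Complex exponential, logarithm and principal powers *)

Section complex_basics.
Context {R : realType}.
Implicit Types (z w : R[i]) (r t x y : R).
Local Notation Re := complex.Re.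
Local Notation Im := complex.Im.

Lemma cReD z w : Re (z + w) = Re z + Re w. Proof. by case: z w => [? ?] [? ?]. Qed.
Lemma cImD z w : Im (z + w) = Im z + Im w. Proof. by case: z w => [? ?] [? ?]. Qed.
Lemma cReN z : Re (- z) = - Re z. Proof. by case: z. Qed.
Lemma cImN z : Im (- z) = - Im z. Proof. by case: z. Qed.
Lemma cReB z w : Re (z - w) = Re z - Re w. Proof. by rewrite cReD cReN. Qed.
Lemma cImB z w : Im (z - w) = Im z - Im w. Proof. by rewrite cImD cImN. Qed.
Lemma cReM z w : Re (z * w) = Re z * Re w - Im z * Im w.
Proof. by case: z w => [? ?] [? ?]. Qed.
Lemma cImM z w : Im (z * w) = Re z * Im w + Im z * Re w.
Proof. by case: z w => [? ?] [? ?]. Qed.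
Lemma cReC r : Re r%:C = r. Proof. by []. Qed.
Lemma cImC r : Im r%:C = 0. Proof. by []. Qed.
Lemma cRe1 : Re (1 : R[i]) = 1. Proof. by []. Qed.
Lemma cIm1 : Im (1 : R[i]) = 0. Proof. by []. Qed.
Lemma cRe0 : Re (0 : R[i]) = 0. Proof. by []. Qed.
Lemma cIm0 : Im (0 : R[i]) = 0. Proof. by []. Qed.
Lemma natC n : n%:R%:C = n%:R :> R[i]. Proof. by rewrite rmorph_nat. Qed.
Lemma cRe_nat n : Re (n%:R : R[i]) = n%:R. Proof. by rewrite -natC. Qed.
Lemma cIm_nat n : Im (n%:R : R[i]) = 0. Proof. by rewrite -natC. Qed.

(** [rewrite !cReImE] computes the real and imaginary parts of ring
expressions; complex identities are checked componentwise this way. *)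
Definition cReImE := (cReD, cImD, cReN, cImN, cReM, cImM, cReC, cImC, cRe1, cIm1, cRe0, cIm0,
  cRe_nat, cIm_nat).

Lemma cRe_sum (I : Type) (s : seq I) (P : pred I) (F : I -> R[i]) :
  Re (\sum_(i <- s | P i) F i) = \sum_(i <- s | P i) Re (F i).
Proof. by apply: (big_morph _ cReD). Qed.
Lemma cIm_sum (I : Type) (s : seq I) (P : pred I) (F : I -> R[i]) :
  Im (\sum_(i <- s | P i) F i) = \sum_(i <- s | P i) Im (F i).
Proof. by apply: (big_morph _ cImD). Qed.

Lemma ceqP z w : Re z = Re w -> Im z = Im w -> z = w.
Proof. by case: z w => [? ?] [? ?] /= -> ->. Qed.

Lemma cmodE z : cmod z = Num.sqrt (Re z ^+ 2 + Im z ^+ 2).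
Proof. by rewrite /cmod normc_def. Qed.

Lemma normcE z : `|z| = (cmod z)%:C.
Proof. by rewrite /cmod normc_def. Qed.

Lemma cmod_ge0 z : 0 <= cmod z. Proof. by rewrite cmodE sqrtr_ge0. Qed.
Lemma cmodM z w : cmod (z * w) = cmod z * cmod w.
Proof. by rewrite /cmod normrM !normcE -rmorphM. Qed.
Lemma cmodD z w : cmod (z + w) <= cmod z + cmod w.
Proof. by have := ler_normD z w; rewrite !normcE -rmorphD lecR. Qed.
Lemma cmodN z : cmod (- z) = cmod z. Proof. by rewrite /cmod normrN. Qed.
Lemma cmodB z w : cmod (z - w) <= cmod z + cmod w.
Proof. by rewrite -(cmodN w) cmodD. Qed.
Lemma cmodV z : cmod z^-1 = (cmod z)^-1.
Proof.
by rewrite /cmod normfV normcE -fmorphV.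
Qed.
Lemma cmodX z n : cmod (z ^+ n) = cmod z ^+ n.
Proof. by rewrite /cmod normrX normcE -rmorphXn. Qed.
Lemma cmod0 : cmod (0 : R[i]) = 0. Proof. by rewrite /cmod normr0. Qed.
Lemma cmod1 : cmod (1 : R[i]) = 1. Proof. by rewrite /cmod normr1. Qed.
Lemma cmodC r : cmod r%:C = `|r|.
Proof. by rewrite cmodE cReC cImC expr0n/= addr0 sqrtr_sqr. Qed.
Lemma cmod_nat n : cmod (n%:R : R[i]) = n%:R.
Proof. by rewrite -natC cmodC normr_nat. Qed.
Lemma cmod_eq0 z : (cmod z == 0) = (z == 0).
Proof.
apply/eqP/eqP => [z0|->]; last exact: cmod0.
by apply/eqP; rewrite -normr_eq0 normcE z0.
Qed.
Lemma cmod_gt0 z : (0 < cmod z) = (z != 0).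
Proof. by rewrite lt_def cmod_ge0 andbT cmod_eq0. Qed.
Lemma cmod_sum (I : Type) (s : seq I) (P : pred I) (F : I -> R[i]) :
  cmod (\sum_(i <- s | P i) F i) <= \sum_(i <- s | P i) cmod (F i).
Proof.
elim/big_rec2 : _ => [|i r z _ h]; first by rewrite cmod0.
by rewrite (le_trans (cmodD _ _))// lerD2l.
Qed.
Lemma cmod_prod (I : Type) (s : seq I) (P : pred I) (F : I -> R[i]) :
  cmod (\prod_(i <- s | P i) F i) = \prod_(i <- s | P i) cmod (F i).
Proof. by apply: (big_morph _ cmodM cmod1). Qed.

Lemma Re_le_cmod z : `|Re z| <= cmod z.
Proof. by have := normc_ge_Re z; rewrite normcE lecR. Qed.
Lemma Im_le_cmod z : `|Im z| <= cmod z.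
Proof.
by rewrite cmodE -sqrtr_sqr ler_sqrt ?addr_ge0 ?sqr_ge0// lerDr sqr_ge0.
Qed.
Lemma cmod_le_ReIm z : cmod z <= `|Re z| + `|Im z|.
Proof.
rewrite {1}(_ : z = (Re z)%:C + (0 +i* 1) * (Im z)%:C); last first.
  by apply: ceqP; rewrite !cReImE/= ?mul0r ?mul1r ?add0r ?addr0 ?subr0.
apply: le_trans (cmodD _ _) _; rewrite cmodM !cmodC.
by rewrite (cmodE (0 +i* 1))/= expr0n/= add0r expr1n sqrtr1 mul1r.
Qed.

Lemma cexpD z w : cexp (z + w) = cexp z * cexp w.
Proof.
rewrite /cexp cReD cImD expRD cosD sinD.
by apply: ceqP; rewrite ?cReM ?cImM [in LHS]/= [in RHS]/=; ring.
Qed.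
Lemma cexpC r : cexp r%:C = (expR r)%:C.
Proof. by rewrite /cexp/= cos0 sin0 mulr1 mulr0. Qed.
Lemma cexp0 : cexp (0 : R[i]) = 1.
Proof. by rewrite -[0]/(0%:C) cexpC expR0. Qed.
Lemma cmod_cexp z : cmod (cexp z) = expR (Re z).
Proof.
rewrite cmodE /cexp/= !exprMn -mulrDr cos2Dsin2 mulr1 sqrtr_sqr.
by rewrite ger0_norm ?expR_ge0.
Qed.
Lemma cexp_neq0 z : cexp z != 0.
Proof. by rewrite -cmod_gt0 cmod_cexp expR_gt0. Qed.
Lemma cexpN z : cexp (- z) = (cexp z)^-1.
Proof.
apply: (mulIf (cexp_neq0 z)); rewrite -cexpD addNr cexp0.
by rewrite mulVf ?cexp_neq0.
Qed.
Lemma cexpMn z n : cexp (n%:R * z) = cexp z ^+ n.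
Proof.
elim: n => [|n IH]; first by rewrite mul0r cexp0.
by rewrite -natr1 mulrDl mul1r cexpD IH exprSr.
Qed.

Lemma carg_cexp z : - pi < Im z <= pi -> carg (cexp z) = Im z.
Proof.
move=> /andP[h1 h2]; rewrite /carg cmod_cexp /cexp/=.
have -> : expR (Re z) * cos (Im z) / expR (Re z) = cos (Im z).
  by rewrite mulrAC divff ?mul1r// gt_eqF ?expR_gt0.
rewrite pmulr_rge0 ?expR_gt0//.
have [i0|i0] := leP 0 (Im z).
  by rewrite sin_ge0_pi ?i0// cosK// in_itv/= i0.
rewrite leNgt -oppr_gt0 -sinN sin_gt0_pi ?oppr_gt0 ?i0 1?ltrNl//=.
by rewrite cosKN ?opprK// (ltW h1) ltW.
Qed.

Lemma clog_cexp z : - pi < Im z <= pi -> clog (cexp z) = z.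
Proof.
move=> h; apply: ceqP; rewrite /clog/=; last exact: carg_cexp.
by rewrite cmod_cexp expRK.
Qed.

Lemma clogK z : z != 0 -> cexp (clog z) = z.
Proof.
move=> z0; have cz : 0 < cmod z by rewrite cmod_gt0.
have zE : cmod z ^+ 2 = Re z ^+ 2 + Im z ^+ 2.
  by rewrite cmodE sqr_sqrtr// addr_ge0 ?sqr_ge0.
have rz1 : -1 <= Re z / cmod z <= 1.
  rewrite -ler_norml normf_div (gtr0_norm cz) ler_pdivrMr// mul1r.
  exact: Re_le_cmod.
have sE : Num.sqrt (1 - (Re z / cmod z) ^+ 2) = `|Im z| / cmod z.
  rewrite (_ : 1 - _ = (Im z / cmod z) ^+ 2); last first.
    have -> : 1 = (Re z ^+ 2 + Im z ^+ 2) / cmod z ^+ 2.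
      by rewrite -zE divff// expf_neq0// gt_eqF.
    by field; rewrite gt_eqF.
  by rewrite sqrtr_sqr normf_div (gtr0_norm cz).
apply: ceqP; rewrite /clog /cexp/= lnK ?posrE// /carg; case: ifPn => i0;
  rewrite ?cosN ?sinN ?acosK ?in_itv// ?sin_acos// ?sE.
- by rewrite mulrC divfK// gt_eqF.
- by rewrite mulrC divfK// gt_eqF.
- by rewrite ger0_norm// mulrC divfK// gt_eqF.
- rewrite ltr0_norm ?ltNge// mulNr opprK mulrC divfK// gt_eqF//.
Qed.

Lemma cargZ r z : 0 < r -> carg (r%:C * z) = carg z.
Proof.
move=> r0; rewrite /carg cmodM cmodC gtr0_norm// !cReImE/= !mul0r addr0 subr0.
rewrite pmulr_rge0//.
have -> // : r * Re z / (r * cmod z) = Re z / cmod z.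
by rewrite -mulf_div divff ?mul1r// gt_eqF.
Qed.

(** Scaling by a positive real keeps the argument, so no multiple of
[2 pi] appears; hence [cpowZ], which is false for general complex factors. *)
Lemma clogZ r z : 0 < r -> z != 0 -> clog (r%:C * z) = (ln r)%:C + clog z.
Proof.
move=> r0 z0; rewrite /clog cargZ// cmodM cmodC gtr0_norm// lnM ?posrE ?cmod_gt0//.
by apply: ceqP; rewrite !cReImE [LHS]/= ?add0r.
Qed.

Lemma clogC r : 0 < r -> clog r%:C = (ln r)%:C.
Proof.
move=> r0; rewrite -[r%:C]mulr1 clogZ ?oner_neq0//.
rewrite (_ : clog 1 = 0) ?addr0// -[1]cexp0 clog_cexp//=.
by rewrite oppr_lt0 pi_gt0 pi_ge0.
Qed.

Lemma RCneq0 r : 0 < r -> r%:C != 0 :> R[i].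
Proof. by move=> r0; rewrite -cmod_gt0 cmodC normr_gt0 gt_eqF. Qed.

Lemma Re_gt0_neq0 z : 0 < Re z -> z != 0.
Proof. by move=> h; apply/eqP => z0; move: h; rewrite z0 ltxx. Qed.

Lemma cpowE z w : z != 0 -> cpow z w = cexp (w * clog z).
Proof. by rewrite /cpow => /negbTE ->. Qed.
Lemma cpowC r w : 0 < r -> cpow r%:C w = cexp (w * (ln r)%:C).
Proof. by move=> r0; rewrite cpowE ?RCneq0// clogC. Qed.
Lemma cpow_neq0 z w : z != 0 -> cpow z w != 0.
Proof. by move=> z0; rewrite cpowE// cexp_neq0. Qed.
Lemma cpowD z w1 w2 : z != 0 -> cpow z (w1 + w2) = cpow z w1 * cpow z w2.
Proof. by move=> z0; rewrite !cpowE// mulrDl cexpD. Qed.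
Lemma cpowN z w : z != 0 -> cpow z (- w) = (cpow z w)^-1.
Proof. by move=> z0; rewrite !cpowE// mulNr cexpN. Qed.
Lemma cpow_nat z n : z != 0 -> cpow z n%:R = z ^+ n.
Proof. by move=> z0; rewrite cpowE// cexpMn clogK. Qed.
Lemma cpow1 z : z != 0 -> cpow z 1 = z.
Proof. by move=> z0; rewrite -[1]/(1%:R) cpow_nat. Qed.
Lemma cpowMn z w n : z != 0 -> cpow z (w * n%:R) = cpow z w ^+ n.
Proof. by move=> z0; rewrite !cpowE// mulrAC mulrC cexpMn. Qed.
Lemma cpowZ r z w : 0 < r -> z != 0 ->
  cpow (r%:C * z) w = cpow r%:C w * cpow z w.
Proof.
move=> r0 z0; rewrite !cpowE ?mulf_neq0 ?RCneq0// clogZ// mulrDr cexpD.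
by rewrite clogC.
Qed.
Lemma cmod_cpowC r w : 0 < r -> cmod (cpow r%:C w) = r `^ Re w.
Proof.
move=> r0; rewrite cpowC// cmod_cexp !cReImE mulr0 subr0.
by rewrite /powR gt_eqF.
Qed.

(** On the right half-plane the principal logarithm is differentiable
in this form; the general definition through [acos] is not convenient. *)
Lemma clog_Re_gt0 z : 0 < Re z ->
  clog z = (ln (Re z ^+ 2 + Im z ^+ 2) / 2) +i* atan (Im z / Re z).
Proof.
move=> z0; set l := (X in _ = X).
have s0 : 0 < Re z ^+ 2 + Im z ^+ 2 by rewrite ltr_pwDl ?exprn_gt0 ?sqr_ge0.
suff <- : cexp l = z.
  rewrite clog_cexp//= (lt_trans _ (atan_gtNpi2 _)) ?(le_trans (ltW (atan_ltpi2 _)))//.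
    by have := @pi_gt0 R; lra.
  by have := @pi_gt0 R; lra.
have e1 : expR (ln (Re z ^+ 2 + Im z ^+ 2) / 2) = cmod z.
  rewrite cmodE -powR12_sqrt ?ltW// /powR gt_eqF//; congr expR; ring.
have ca : cos (atan (Im z / Re z)) = Re z / cmod z.
  rewrite cos_atan (_ : 1 + _ = (Re z ^+ 2 + Im z ^+ 2) / Re z ^+ 2); last first.
    by field; rewrite gt_eqF.
  by rewrite sqrtrM ?ltW// sqrtrV ?sqr_ge0// sqrtr_sqr gtr0_norm// -cmodE invf_div.
have cn : cmod z != 0 by rewrite cmod_eq0 Re_gt0_neq0.
apply: ceqP; rewrite /cexp/= e1.
  by rewrite ca mulrC divfK.
have := atanK (Im z / Re z); rewrite /tan => /(canRL (divfK _)) ->.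
  by rewrite ca; field; rewrite cn gt_eqF.
by rewrite ca mulf_neq0// ?invr_eq0// gt_eqF.
Qed.

End complex_basics.

(** * Measurability, limits and integrals of complex-valued functions *)

Section measurability.
Context {R : realType} {d : measure_display} {T : measurableType d}.
Implicit Types (D : set T) (g h : T -> R[i]) (c : R[i]).
Local Notation Re := complex.Re.
Local Notation Im := complex.Im.

Definition cmeas D g := measurable_fun D (fun t => Re (g t)) /\
  measurable_fun D (fun t => Im (g t)).

Lemma eq_cmeas D g h : {in D, g =1 h} -> cmeas D g -> cmeas D h.
Proof.
move=> gh [m1 m2]; split.
  by apply: eq_measurable_fun m1 => x xD; rewrite gh.
by apply: eq_measurable_fun m2 => x xD; rewrite gh.
Qed.

Lemma cmeas_cst D c : cmeas D (fun=> c).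
Proof. by split; exact: measurable_cst. Qed.

Lemma cmeasD D g h : cmeas D g -> cmeas D h -> cmeas D (fun x => g x + h x).
Proof.
move=> [g1 g2] [h1 h2]; split.
  by under eq_fun do rewrite cReD; exact: measurable_funD.
by under eq_fun do rewrite cImD; exact: measurable_funD.
Qed.

Lemma cmeasN D g : cmeas D g -> cmeas D (fun x => - g x).
Proof.
move=> [g1 g2]; split.
  by under eq_fun do rewrite cReN; exact: measurableT_comp.
by under eq_fun do rewrite cImN; exact: measurableT_comp.
Qed.

Lemma cmeasB D g h : cmeas D g -> cmeas D h -> cmeas D (fun x => g x - h x).
Proof. by move=> mg mh; apply: cmeasD => //; exact: cmeasN. Qed.

Lemma cmeasM D g h : cmeas D g -> cmeas D h -> cmeas D (fun x => g x * h x).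
Proof.
move=> [g1 g2] [h1 h2]; split.
  under eq_fun do rewrite cReM; apply: measurable_funB; exact: measurable_funM.
under eq_fun do rewrite cImM; apply: measurable_funD; exact: measurable_funM.
Qed.

Lemma cmeasX D g n : cmeas D g -> cmeas D (fun x => g x ^+ n).
Proof.
move=> mg; elim: n => [|n IH]; first exact: cmeas_cst.
by apply: eq_cmeas (cmeasM mg IH) => x _; rewrite exprS.
Qed.

Lemma cmeas_sum (I : Type) (s : seq I) D (g : I -> T -> R[i]) :
  (forall i, cmeas D (g i)) -> cmeas D (fun x => \sum_(i <- s) g i x).
Proof.
move=> mg; elim: s => [|i s IH].
  by apply: eq_cmeas (cmeas_cst D 0) => x _; rewrite big_nil.
by apply: eq_cmeas (cmeasD (mg i) IH) => x _; rewrite big_cons.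
Qed.

Lemma cmeasC D (f : T -> R) : measurable_fun D f -> cmeas D (fun x => (f x)%:C).
Proof. by move=> mf; split => //=; exact: measurable_cst. Qed.

Lemma cmeas_cexp D g : cmeas D g -> cmeas D (fun x => cexp (g x)).
Proof.
move=> [g1 g2]; split => /=; apply: measurable_funM.
- exact: (measurableT_comp (@measurable_expR R)).
- apply: measurableT_comp => //; apply: continuous_measurable_fun.
  exact: continuous_cos.
- exact: (measurableT_comp (@measurable_expR R)).
- apply: measurableT_comp => //; apply: continuous_measurable_fun.
  exact: continuous_sin.
Qed.

Lemma cmeas_cmod D g : cmeas D g -> measurable_fun D (fun x => cmod (g x)).
Proof.
move=> [g1 g2]; under eq_fun do rewrite cmodE.
apply: (measurableT_comp (continuous_measurable_fun (@sqrt_continuous R))).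
by apply: measurable_funD; exact: measurable_funX.
Qed.

Lemma cmeasS D E g : measurable E -> D `<=` E -> cmeas E g -> cmeas D g.
Proof. by move=> mE DE [g1 g2]; split; apply: measurable_funS (DE) _. Qed.

(** Extension by zero, so that integrals over different sets become
integrals over the whole line. *)
Definition cmask D g : T -> R[i] := fun x => if x \in D then g x else 0.

Lemma cmeas_mask D g : measurable D -> cmeas D g -> cmeas setT (cmask D g).
Proof.
move=> mD [g1 g2]; split.
  rewrite (_ : (fun _ => _) = (fun t => Re (g t)) \_ D).
    by apply/(measurable_restrictT _ mD).1.
  by apply/funext => x; rewrite /cmask /patch; case: ifP.
rewrite (_ : (fun _ => _) = (fun t => Im (g t)) \_ D).
  by apply/(measurable_restrictT _ mD).1.
by apply/funext => x; rewrite /cmask /patch; case: ifP.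
Qed.

End measurability.

Section ccv.
Context {R : realType} {T : Type} (F : set_system T).
Implicit Types (g h : T -> R[i]) (l c : R[i]).
Local Notation Re := complex.Re.
Local Notation Im := complex.Im.

(** Convergence of both components; the limit operator [clim] is total and
says nothing about convergence. *)
Definition ccv g l := Re (g x) @[x --> F] --> Re l /\ Im (g x) @[x --> F] --> Im l.

Context {FF : Filter F}.

Lemma ccv_cst c : ccv (fun=> c) c.
Proof. by split; exact: cvg_cst. Qed.

Lemma eq_ccv g h l : g =1 h -> ccv g l -> ccv h l.
Proof. by move=> /funext ->. Qed.

Lemma near_ccv g h l : (\forall x \near F, g x = h x) -> ccv g l -> ccv h l.
Proof.
move=> gh [g1 g2]; split.
  by apply: cvg_trans g1; apply: near_eq_cvg; apply: filterS gh => x ->.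
by apply: cvg_trans g2; apply: near_eq_cvg; apply: filterS gh => x ->.
Qed.

Lemma ccvD g h l1 l2 : ccv g l1 -> ccv h l2 -> ccv (fun x => g x + h x) (l1 + l2).
Proof.
move=> [g1 g2] [h1 h2]; split.
  by under eq_fun do rewrite cReD; rewrite cReD; exact: cvgD.
by under eq_fun do rewrite cImD; rewrite cImD; exact: cvgD.
Qed.

Lemma ccvN g l : ccv g l -> ccv (fun x => - g x) (- l).
Proof.
move=> [g1 g2]; split.
  by under eq_fun do rewrite cReN; rewrite cReN; exact: cvgN.
by under eq_fun do rewrite cImN; rewrite cImN; exact: cvgN.
Qed.

Lemma ccvB g h l1 l2 : ccv g l1 -> ccv h l2 -> ccv (fun x => g x - h x) (l1 - l2).
Proof. by move=> gl hl; apply: ccvD => //; exact: ccvN. Qed.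

Lemma ccvM g h l1 l2 : ccv g l1 -> ccv h l2 -> ccv (fun x => g x * h x) (l1 * l2).
Proof.
move=> [g1 g2] [h1 h2]; split.
  by under eq_fun do rewrite cReM; rewrite cReM; apply: cvgB; exact: cvgM.
by under eq_fun do rewrite cImM; rewrite cImM; apply: cvgD; exact: cvgM.
Qed.

Lemma ccvC (f : T -> R) (l : R) : f x @[x --> F] --> l ->
  ccv (fun x => (f x)%:C) l%:C.
Proof. by move=> fl; split => //=; exact: cvg_cst. Qed.

Lemma ccvP g l : ccv g l <-> cmod (g x - l) @[x --> F] --> 0.
Proof.
split=> [[g1 g2]|gl].
  apply: (@squeeze_cvgr _ _ _ _ (cst 0) (fun x => `|Re (g x) - Re l| + `|Im (g x) - Im l|)).
  - near=> x; rewrite cmod_ge0/=; have := cmod_le_ReIm (g x - l).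
    by rewrite cReB cImB.
  - exact: cvg_cst.
  rewrite -[0]addr0; apply: cvgD; rewrite -(normr0 R); apply: cvg_norm.
    by rewrite -(subrr (Re l)); apply: cvgB => //; exact: cvg_cst.
  by rewrite -(subrr (Im l)); apply: cvgB => //; exact: cvg_cst.
split; apply/cvgrPdist_lt => e e0; move/cvgrPdist_lt : gl => /(_ _ e0);
  apply: filterS => x; rewrite sub0r normrN (ger0_norm (cmod_ge0 _)).
  by apply: le_lt_trans; rewrite distrC -cReB Re_le_cmod.
by apply: le_lt_trans; rewrite distrC -cImB Im_le_cmod.
Unshelve. all: by end_near. Qed.

Lemma ccv_squeeze g l (f : T -> R) : (\forall x \near F, cmod (g x - l) <= f x) ->
  f x @[x --> F] --> 0 -> ccv g l.
Proof.
move=> gf f0; apply/ccvP; apply: squeeze_cvgr (f0); last exact: cvg_cst.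
by apply: filterS gf => x ->; rewrite cmod_ge0.
Qed.

End ccv.

Section ccv_proper.
Context {R : realType} {T : Type} (F : set_system T) {FF : ProperFilter F}.
Implicit Types (g h : T -> R[i]) (l c : R[i]).

Lemma ccv_clim g l : ccv F g l -> clim F g = l.
Proof.
move=> [g1 g2]; apply: ceqP => /=.
  by apply: cvg_lim.
by apply: cvg_lim.
Qed.

Lemma ccvg_ccv g : ccvg F g -> ccv F g (clim F g).
Proof. by move=> [g1 g2]; split. Qed.

Lemma ccv_unique g l1 l2 : ccv F g l1 -> ccv F g l2 -> l1 = l2.
Proof. by move=> /ccv_clim <- /ccv_clim <-. Qed.

Lemma ccv_cmod g l : ccv F g l -> cmod (g x) @[x --> F] --> cmod l.
Proof.
move=> gl; apply/cvgrPdist_lt => e e0.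
move/ccvP : gl => /cvgrPdist_lt/(_ _ e0); apply: filterS => x.
rewrite sub0r normrN (ger0_norm (cmod_ge0 _)); apply: le_lt_trans.
rewrite distrC ler_norml; apply/andP; split.
  have := cmodB (g x) (g x - l); rewrite opprB addrC subrK; lra.
by have := cmodD (g x - l) l; rewrite subrK; lra.
Qed.

End ccv_proper.
Arguments ccv {R T} F g l.

Section cintegral.
Context {R : realType}.
Local Notation lam := (@lebesgue_measure R).
Implicit Types (D : set R) (g h : R -> R[i]) (c : R[i]) (B : R -> R).
Local Notation Re := complex.Re.
Local Notation Im := complex.Im.

Lemma eq_Rintegrable D (f g : R -> R) : measurable D -> (forall x, D x -> f x = g x) ->
  lam.-integrable D (EFin \o f) -> lam.-integrable D (EFin \o g).
Proof.
move=> mD fg; apply: eq_integrable => // x /set_mem Dx; by rewrite /= fg.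
Qed.

Lemma RintegrableD D (f g : R -> R) : measurable D ->
  lam.-integrable D (EFin \o f) -> lam.-integrable D (EFin \o g) ->
  lam.-integrable D (EFin \o (fun x => f x + g x)).
Proof.
move=> mD fi gi; rewrite (_ : EFin \o _ = (EFin \o f) \+ (EFin \o g))%E//.
exact: integrableD.
Qed.

Lemma RintegrableZ D (r : R) (f : R -> R) : measurable D ->
  lam.-integrable D (EFin \o f) -> lam.-integrable D (EFin \o (fun x => r * f x)).
Proof.
move=> mD fi; rewrite (_ : EFin \o _ = (fun x => r%:E * (EFin \o f) x)%E)//.
exact: integrableZl.
Qed.

Lemma cintegrable_dom D g B : measurable D -> cmeas D g ->
  lam.-integrable D (EFin \o B) -> (forall x, D x -> cmod (g x) <= B x) ->
  cintegrable D g.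
Proof.
move=> mD [g1 g2] iB gB; split; apply: le_integrable (iB) => //.
- exact/measurable_EFinP.
- move=> x Dx /=; rewrite lee_fin (le_trans (Re_le_cmod _))//.
  by rewrite (le_trans (gB _ Dx))// ler_norm.
- exact/measurable_EFinP.
- move=> x Dx /=; rewrite lee_fin (le_trans (Im_le_cmod _))//.
  by rewrite (le_trans (gB _ Dx))// ler_norm.
Qed.

Lemma cintegrable_meas D g : cintegrable D g -> cmeas D g.
Proof. by move=> [g1 g2]; split; apply/measurable_EFinP; [exact: measurable_int g1|exact: measurable_int g2]. Qed.

Lemma cintegrable_cmod D g : measurable D -> cintegrable D g ->
  lam.-integrable D (EFin \o (fun x => cmod (g x))).
Proof.
move=> mD ig; have [g1 g2] := ig.
have := RintegrableD mD (integrable_norm g1) (integrable_norm g2).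
apply: le_integrable => //.
  by apply/measurable_EFinP/cmeas_cmod; exact: cintegrable_meas.
move=> x Dx /=; rewrite lee_fin (ger0_norm (cmod_ge0 _)).
exact: le_trans (cmod_le_ReIm _) (ler_norm _).
Qed.

Lemma cintegrableP D g : measurable D -> cmeas D g ->
  lam.-integrable D (EFin \o (fun x => cmod (g x))) -> cintegrable D g.
Proof. by move=> mD mg ig; apply: cintegrable_dom ig _. Qed.

Lemma eq_cintegrable D g h : measurable D -> {in D, g =1 h} -> cintegrable D g -> cintegrable D h.
Proof.
move=> mD gh [g1 g2]; split.
  by apply: eq_integrable g1 => // x xD; rewrite gh.
by apply: eq_integrable g2 => // x xD; rewrite gh.
Qed.

Lemma cintegrable0 D : measurable D -> cintegrable D (fun=> 0).
Proof. by move=> mD; split; exact: integrable0. Qed.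

Lemma cintegrableD D g h : measurable D -> cintegrable D g -> cintegrable D h ->
  cintegrable D (fun x => g x + h x).
Proof.
move=> mD [g1 g2] [h1 h2]; split.
  by apply: eq_Rintegrable (RintegrableD mD g1 h1) => // x _; rewrite cReD.
by apply: eq_Rintegrable (RintegrableD mD g2 h2) => // x _; rewrite cImD.
Qed.

Lemma cintegrableZ D c g : measurable D -> cintegrable D g ->
  cintegrable D (fun x => c * g x).
Proof.
move=> mD ig; apply: (@cintegrable_dom _ _ (fun x => cmod c * cmod (g x))) => //.
- by apply: cmeasM; [exact: cmeas_cst|exact: cintegrable_meas].
- exact: RintegrableZ (cintegrable_cmod mD ig).
- by move=> x _; rewrite cmodM.
Qed.

Lemma cintegrableN D g : measurable D -> cintegrable D g ->
  cintegrable D (fun x => - g x).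
Proof.
move=> mD ig; apply: eq_cintegrable (cintegrableZ (-1) mD ig) => // x _.
by rewrite mulN1r.
Qed.

Lemma cintegrableB D g h : measurable D -> cintegrable D g -> cintegrable D h ->
  cintegrable D (fun x => g x - h x).
Proof. by move=> mD ig ih; apply: cintegrableD => //; exact: cintegrableN. Qed.

Lemma cintegrableS D E g : measurable D -> measurable E -> D `<=` E ->
  cintegrable E g -> cintegrable D g.
Proof. by move=> mD mE DE [g1 g2]; split; [exact: integrableS g1|exact: integrableS g2]. Qed.

Lemma cintegrable_mask D g : measurable D ->
  cintegrable D g <-> cintegrable setT (cmask D g).
Proof.
move=> mD; split=> [[/integrable_mkcond h1 /integrable_mkcond h2]|[h1 h2]].
  split; [apply: eq_integrable (h1 mD)|apply: eq_integrable (h2 mD)] => // x _;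
  by rewrite /patch /cmask; case: ifP.
split; apply/integrable_mkcond => //;
  [apply: eq_integrable h1|apply: eq_integrable h2] => // x _;
  by rewrite /patch /cmask; case: ifP.
Qed.

Lemma eq_cintegral D g h : {in D, g =1 h} -> cintegral D g = cintegral D h.
Proof.
move=> gh; rewrite /cintegral.
by congr (_ +i* _); apply: eq_Rintegral => x xD; rewrite gh.
Qed.

Lemma cintegral_mask D g : cintegral D g = cintegral setT (cmask D g).
Proof.
rewrite /cintegral Rintegral_mkcond [in X in _ +i* X]Rintegral_mkcond.
by congr (_ +i* _); apply: eq_Rintegral => x _; rewrite /patch /cmask; case: ifP.
Qed.

Lemma cintegral0 D : cintegral D (fun=> 0) = 0.
Proof.
apply: ceqP => /=; rewrite /Rintegral.
  by rewrite integral0.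
by rewrite integral0.
Qed.

Lemma cintegralD D g h : measurable D -> cintegrable D g -> cintegrable D h ->
  cintegral D (fun x => g x + h x) = cintegral D g + cintegral D h.
Proof.
move=> mD [g1 g2] [h1 h2]; apply: ceqP; rewrite ?cReD ?cImD /=.
  by under eq_Rintegral do rewrite cReD; rewrite RintegralD.
by under eq_Rintegral do rewrite cImD; rewrite RintegralD.
Qed.

Lemma cintegralZ D c g : measurable D -> cintegrable D g ->
  cintegral D (fun x => c * g x) = c * cintegral D g.
Proof.
move=> mD [g1 g2]; have Zi r f := @RintegrableZ D r f mD.
apply: ceqP; rewrite ?cReM ?cImM /=.
  under eq_Rintegral do rewrite cReM.
  by rewrite RintegralB ?RintegralZl//; exact: Zi.
under eq_Rintegral do rewrite cImM.
by rewrite RintegralD ?RintegralZl//; exact: Zi.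
Qed.

Lemma cintegralN D g : measurable D -> cintegrable D g ->
  cintegral D (fun x => - g x) = - cintegral D g.
Proof.
move=> mD ig; rewrite -mulN1r -cintegralZ//.
by apply: eq_cintegral => x _; rewrite mulN1r.
Qed.

Lemma cintegralB D g h : measurable D -> cintegrable D g -> cintegrable D h ->
  cintegral D (fun x => g x - h x) = cintegral D g - cintegral D h.
Proof.
by move=> mD ig ih; rewrite cintegralD ?cintegralN//; exact: cintegrableN.
Qed.

Lemma cintegrable_sum (n : nat) D (g : nat -> R -> R[i]) :
  measurable D -> (forall i, cintegrable D (g i)) ->
  cintegrable D (fun x => \sum_(i < n) g i x) /\
  cintegral D (fun x => \sum_(i < n) g i x) = \sum_(i < n) cintegral D (g i).
Proof.
move=> mD ig; elim: n => [|n [IH1 IH2]].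
  split; last first.
    by rewrite big_ord0 -[RHS](cintegral0 D); apply: eq_cintegral => x _; rewrite big_ord0.
  by apply: eq_cintegrable (cintegrable0 mD) => // x _; rewrite big_ord0.
split.
  apply: eq_cintegrable (cintegrableD mD IH1 (ig n)) => // x _.
  by rewrite big_ord_recr.
rewrite big_ord_recr/= -IH2 -cintegralD//.
by apply: eq_cintegral => x _; rewrite big_ord_recr.
Qed.

Lemma cmod_cintegral D g : measurable D -> cintegrable D g ->
  cmod (cintegral D g) <= Rintegral lam D (fun x => cmod (g x)).
Proof.
move=> mD ig; set z := cintegral D g.
have [z0|z0] := eqVneq z 0.
  by rewrite z0 cmod0; apply: Rintegral_ge0 => x _; exact: cmod_ge0.
pose c := (cmod z)%:C / z.
have c1 : cmod c = 1.
  by rewrite cmodM cmodV cmodC ger0_norm ?cmod_ge0// divff// cmod_eq0.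
have -> : cmod z = Re (cintegral D (fun x => c * g x)).
  by rewrite cintegralZ// -/z /c divfK.
rewrite /=; apply: le_Rintegral => //.
- exact: (cintegrableZ c mD ig).1.
- exact: cintegrable_cmod.
- move=> x Dx; apply: le_trans (ler_norm _) _; apply: le_trans (Re_le_cmod _) _.
  by rewrite cmodM c1 mul1r.
Qed.

Lemma cmod_cintegral_le D g B : measurable D -> cmeas D g ->
  lam.-integrable D (EFin \o B) -> (forall x, D x -> cmod (g x) <= B x) ->
  cmod (cintegral D g) <= Rintegral lam D B.
Proof.
move=> mD mg iB gB; have ig := cintegrable_dom mD mg iB gB.
apply: le_trans (cmod_cintegral mD ig) _; apply: le_Rintegral => //.
exact: cintegrable_cmod.
Qed.

Lemma cintegral_dct D (g_ : nat -> R -> R[i]) g B : measurable D ->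
  (forall n, cmeas D (g_ n)) -> lam.-integrable D (EFin \o B) ->
  (forall n x, D x -> cmod (g_ n x) <= B x) ->
  (forall x, D x -> ccv \oo (g_ ^~ x) (g x)) ->
  cintegrable D g /\ ccv \oo (fun n => cintegral D (g_ n)) (cintegral D g).
Proof.
move=> mD mg iB gB gg.
have dct (f_ : nat -> R -> R) (f : R -> R) : (forall n, measurable_fun D (f_ n)) ->
    (forall n x, D x -> `|f_ n x| <= B x) -> (forall x, D x -> f_ ^~ x @ \oo --> f x) ->
    lam.-integrable D (EFin \o f) /\
    Rintegral lam D (f_ n) @[n --> \oo] --> Rintegral lam D f.
  move=> mf fB ff.
  have [|||||] := @dominated_convergence _ _ _ lam D mD
     (fun n x => (f_ n x)%:E) (EFin \o f) (EFin \o B).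
  - by move=> n; apply/measurable_EFinP; exact: mf.
  - by apply/measurable_EFinP; exact: measurable_fun_cvg ff.
  - by apply: aeW => x Dx /=; apply: cvg_EFin; [exact: nearW|exact: ff].
  - exact: iB.
  - by apply: aeW => x n Dx /=; rewrite lee_fin fB.
  move=> i1 _ i2; split => //; apply: fine_cvg; rewrite fineK//.
  exact: integrable_fin_num.
have [r1 r2] := dct (fun n x => Re (g_ n x)) (fun x => Re (g x))
  (fun n => (mg n).1) (fun n x Dx => le_trans (Re_le_cmod _) (gB n x Dx))
  (fun x Dx => (gg x Dx).1).
have [i1 i2] := dct (fun n x => Im (g_ n x)) (fun x => Im (g x))
  (fun n => (mg n).2) (fun n x Dx => le_trans (Im_le_cmod _) (gB n x Dx))
  (fun x Dx => (gg x Dx).2).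
by split; split.
Qed.

(** Termwise integration, from dominated convergence applied to the
partial sums. *)
Lemma cintegral_series D (g_ : nat -> R -> R[i]) g B : measurable D ->
  (forall n, cmeas D (g_ n)) -> lam.-integrable D (EFin \o B) ->
  (forall n x, D x -> \sum_(i < n) cmod (g_ i x) <= B x) ->
  (forall x, D x -> ccv \oo (fun n => \sum_(i < n) g_ i x) (g x)) ->
  [/\ cintegrable D g, (forall n, cintegrable D (g_ n)) &
    ccv \oo (fun n => \sum_(i < n) cintegral D (g_ i)) (cintegral D g)].
Proof.
move=> mD mg iB gB gg.
have ign n : cintegrable D (g_ n).
  apply: cintegrable_dom (iB) _ => // x Dx; apply: le_trans (gB n.+1 x Dx).
  by rewrite big_ord_recr/= lerDr sumr_ge0// => i _; exact: cmod_ge0.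
have [|n x Dx|ig cg] := @cintegral_dct D (fun n x => \sum_(i < n) g_ i x) g B mD _ iB _ gg.
- by move=> n; apply: cmeas_sum.
- exact: le_trans (cmod_sum _ _ _) (gB n x Dx).
split => //; apply: eq_ccv cg => n.
by have [_ ->] := cintegrable_sum n mD ign.
Qed.

End cintegral.

(** * Invariance of Lebesgue measure, null sets, Fubini *)

Section preserving.
Context {R : realType}.
Local Notation lam := (@lebesgue_measure R).
Local Open Scope ereal_scope.

Lemma integral_measure_preserving (phi : measurableTypeR R -> measurableTypeR R)
    (f : measurableTypeR R -> \bar R) :
  measurable_fun setT phi ->
  (forall A, measurable A -> pushforward lam phi A = lam A) ->
  measurable_fun setT f -> \int[lam]_x f (phi x) = \int[lam]_x f x.
Proof.
move=> mphi phiE mf.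
have ge0E (h : measurableTypeR R -> \bar R) : measurable_fun setT h ->
    (forall x, 0 <= h x) -> \int[lam]_x h (phi x) = \int[lam]_x h x.
  move=> mh h0; transitivity (\int[pushforward lam phi]_x h x).
    rewrite (ge0_integral_pushforward mphi)// ?preimage_setT//.
  by apply: eq_measure_integral => A mA _; exact: phiE.
rewrite integralE [RHS]integralE; congr (_ - _).
  transitivity (\int[lam]_x f^\+ (phi x)); first by apply: eq_integral => x _; rewrite ?funeposE ?funenegE.
  by apply: ge0E => //; exact: measurable_funepos.
transitivity (\int[lam]_x f^\- (phi x)); first by apply: eq_integral => x _; rewrite ?funeposE ?funenegE.
by apply: ge0E => //; exact: measurable_funeneg.
Qed.

(** Lebesgue measure is determined by its values on half-open
intervals. *)
Lemma lebesgue_preserving_itv (phi : measurableTypeR R -> measurableTypeR R) :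
  measurable_fun setT phi ->
  (forall a b : R, a <= b -> lam (phi @^-1` `]a, b]%classic) = (b - a)%:E)%R ->
  forall A, measurable A -> pushforward lam phi A = lam A.
Proof.
move=> mphi phiE A mA.
pose phi_mixin := isMeasurableFun.Build _ _ _ _ _ mphi.
pose phi' : {mfun measurableTypeR R >-> measurableTypeR R} := HB.pack phi phi_mixin.
rewrite -[phi]/(phi' : _ -> _).
apply/esym/lebesgue_measure_unique => //= _ [[a b]] _ <-.
rewrite /pushforward/=; have [ab|ba] := leP a b; last first.
  by rewrite !set_itv_ge ?bnd_simp -?leNgt ?ltW// preimage_set0.
rewrite phiE// lebesgue_measure_itv/= lte_fin; case: ltP => // ba.
by have -> : a = b by [apply/le_anti; rewrite ab]; rewrite subrr.
Qed.

Lemma integral_shift (c : R) (f : R -> \bar R) : measurable_fun setT f ->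
  \int[lam]_x f (x + c)%R = \int[lam]_x f x.
Proof.
move=> mf; have mp : measurable_fun setT (fun x : R => (x + c)%R).
  exact: measurable_funD.
apply: (@integral_measure_preserving (fun x => x + c)%R) => //.
apply: lebesgue_preserving_itv => // a b ab.
rewrite (_ : _ @^-1` _ = `](a - c)%R, (b - c)%R]%classic).
  rewrite lebesgue_measure_itv/= lte_fin ltrD2r; case: ltP => // h.
    by rewrite -EFinB; congr (_%:E); ring.
  by have -> : a = b by [apply/le_anti; rewrite ab]; rewrite subrr.
by apply/seteqP; split => x /=; rewrite !in_itv/= ltrBlDr lerBrDr.
Qed.

Lemma integral_reflect (c : R) (f : R -> \bar R) : measurable_fun setT f ->
  \int[lam]_x f (c - x)%R = \int[lam]_x f x.
Proof.
move=> mf; have mp : measurable_fun setT (fun x : R => (c - x)%R).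
  exact: measurable_funB.
apply: (@integral_measure_preserving (fun x => c - x)%R) => //.
apply: lebesgue_preserving_itv => // a b ab.
rewrite (_ : _ @^-1` _ = `[(c - b)%R, (c - a)%R[%classic).
  rewrite lebesgue_measure_itv/= lte_fin ltrD2l ltrN2; case: ltP => // h.
    by rewrite -EFinB; congr (_%:E); ring.
  by have -> : a = b by [apply/le_anti; rewrite ab]; rewrite subrr.
by apply/seteqP; split => x /=; rewrite !in_itv/= ltrBrDr lerBlDr
  ltrBrDl lerBlDl => /andP[h1 h2]; apply/andP; split => //; rewrite addrC.
Qed.

End preserving.

Section null_insensitive.
Context {R : realType}.
Local Notation lam := (@lebesgue_measure R).
Import HBNNSimple.

(** No measurability of [f] or [g] is assumed.  The integral of a
nonnegative function is a supremum over simple functions below it, and a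
simple function may be set to 0 on a null set without changing its integral.
This matters because the iterated derivative of [f] takes uncontrolled values
on a null set. *)
Lemma integral_eq_off_null (D N : set R) (f g : R -> \bar R) :
  measurable D -> measurable N -> lam N = 0%E ->
  (forall x, D x -> ~ N x -> f x = g x) ->
  (\int[lam]_(x in D) f x = \int[lam]_(x in D) g x)%E.
Proof.
move=> mD mN N0 fg.
have ge0le (h1 h2 : R -> \bar R) : (forall x, D x -> 0 <= h1 x)%E ->
    (forall x, D x -> 0 <= h2 x)%E -> (forall x, D x -> ~ N x -> h1 x = h2 x) ->
    (\int[lam]_(x in D) h1 x <= \int[lam]_(x in D) h2 x)%E.
  move=> h10 h20 h12; rewrite ge0_integralE// [leRHS]ge0_integralE//.
  apply: ge_ereal_sup => _ /= [s sh1 <-].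
  pose s' := mul_nnsfun s (@indic_nnsfun _ (measurableTypeR R) R _ (measurableC mN)).
  apply: (@le_trans _ _ (sintegral lam s')); last first.
    apply: ereal_sup_ubound; exists s' => // x /=.
    have := sh1 x; rewrite /s'/= mindicE !patchE in_setC.
    case: ifPn => [xD|xD]; case: (boolP (x \in N)) => xN /=;
      rewrite ?mulr0 ?mulr1//.
      by rewrite h20//; exact: set_mem.
    rewrite h12//; first exact: set_mem.
    by move=> /mem_set; apply/negP.
  rewrite -!integralT_nnsfun (@ge0_negligible_integral _ _ _ lam setT N)//; last 2 first.
  - exact/measurable_EFinP.
  - by move=> x _; rewrite lee_fin.
  rewrite [leRHS](@ge0_negligible_integral _ _ _ lam setT N)//; last 2 first.
  - exact/measurable_EFinP.
  - by move=> x _; rewrite lee_fin.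
  rewrite (eq_integral (EFin \o s'))// => x /set_mem[_ xN] /=.
  by rewrite /s'/= mindicE mem_set// mulr1.
have ge0E (h1 h2 : R -> \bar R) : (forall x, D x -> 0 <= h1 x)%E ->
    (forall x, D x -> 0 <= h2 x)%E -> (forall x, D x -> ~ N x -> h1 x = h2 x) ->
    (\int[lam]_(x in D) h1 x = \int[lam]_(x in D) h2 x)%E.
  move=> h10 h20 h12; apply/eqP; rewrite eq_le (ge0le h1 h2 h10 h20 h12) (ge0le h2 h1)//.
  by move=> x Dx Nx; rewrite h12.
rewrite integralE [RHS]integralE; congr (_ - _)%E; apply: ge0E => // x Dx Nx.
  by rewrite !funeposE fg.
by rewrite !funenegE fg.
Qed.

Lemma cintegral_eq_off_null (D N : set R) (f g : R -> R[i]) :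
  measurable D -> measurable N -> lam N = 0%E ->
  (forall x, D x -> ~ N x -> f x = g x) -> cintegral D f = cintegral D g.
Proof.
move=> mD mN N0 fg; rewrite /cintegral /Rintegral.
by congr (fine _ +i* fine _); apply: (integral_eq_off_null mD mN N0) => x Dx Nx;
  rewrite fg.
Qed.

End null_insensitive.

Section fubini_kernel.
Context {R : realType}.
Local Notation lam := (@lebesgue_measure R).
Local Notation Re := complex.Re.
Local Notation Im := complex.Im.

Lemma measurable_shift (c : R) : measurable_fun setT (fun x : R => x + c).
Proof. exact: measurable_funD. Qed.

Lemma Rintegrable_meas (D : set R) (f : R -> R) :
  lam.-integrable D (EFin \o f) -> measurable_fun D f.
Proof. by move=> fi; apply/measurable_EFinP; exact: measurable_int fi. Qed.

Lemma Rintegrable_shift (c : R) (A : R -> R) : lam.-integrable setT (EFin \o A) ->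
  lam.-integrable setT (EFin \o (fun x => A (x + c))).
Proof.
move=> iA; have mA := Rintegrable_meas iA.
have /integrableP[_ Aoo] := iA; apply/integrableP; split.
  by apply/measurable_EFinP/measurableT_comp => //; exact: measurable_shift.
rewrite (@integral_shift _ c (fun x : R => `|(EFin \o A) x|%E))//.
by apply: measurableT_comp => //; apply/measurable_EFinP.
Qed.

(** The bound [A (x - t) * B t] makes [h] integrable on the plane, by
Tonelli and translation invariance. *)
Lemma fubini_kernel (h : R * R -> R) (A B : R -> R) :
  measurable_fun setT h -> lam.-integrable setT (EFin \o A) ->
  lam.-integrable setT (EFin \o B) -> (forall x, 0 <= A x) -> (forall x, 0 <= B x) ->
  (forall x t, `|h (x, t)| <= A (x - t) * B t) ->
  lam.-integrable setT (EFin \o (fun x => Rintegral lam setT (fun t => h (x, t)))) /\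
  Rintegral lam setT (fun x => Rintegral lam setT (fun t => h (x, t))) =
  Rintegral lam setT (fun t => Rintegral lam setT (fun x => h (x, t))).
Proof.
move=> mh iA iB A0 B0 hAB.
have ih : (lam \x lam)%E.-integrable setT (EFin \o h).
  apply/integrable21ltyP; first exact/measurable_EFinP.
  have ABlty : (\int[lam]_t ((Rintegral lam setT A) * B t)%:E < +oo)%E.
    have /integrableP[_] := RintegrableZ (Rintegral lam setT A) measurableT iB.
    apply: le_lt_trans; apply: ge0_le_integral => //.
    - by move=> t _; rewrite lee_fin mulr_ge0//; apply: Rintegral_ge0.
    - apply/measurable_EFinP/measurable_funM => //.
      exact: Rintegrable_meas iB.
    - apply/measurable_EFinP; apply: measurableT_comp => //.
      apply/measurable_funM => //.
      exact: Rintegrable_meas iB.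
    - by move=> t _; rewrite lee_fin ler_norm.
  apply: le_lt_trans ABlty.
  apply: ge0_le_integral => //.
  - by move=> t _; apply: integral_ge0.
  - apply: (measurable_fun_fubini_tonelli_G (m1 := lam) (abse \o (EFin \o h))) => //=.
    by apply/measurableT_comp => //; exact/measurable_EFinP.
  - apply/measurable_EFinP/measurable_funM => //.
    exact: Rintegrable_meas iB.
  move=> t _; have iAt := Rintegrable_shift (- t) iA.
  apply: (@le_trans _ _ (\int[lam]_x (B t * A (x - t))%:E)%E).
    apply: ge0_le_integral => //.
    - by apply/measurableT_comp => //; apply/measurable_EFinP/measurableT_comp => //; exact: measurable_pair2.
    - apply/measurable_EFinP/measurable_funM => //.
      exact: Rintegrable_meas iAt.
    - by move=> x _; rewrite lee_fin mulrC.
  under eq_integral do rewrite EFinM.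
  rewrite integralZl//.
  rewrite (@integral_shift _ (- t) (EFin \o A)); last exact: measurable_int iA.
  rewrite /Rintegral mulrC EFinM fineK//; exact: integrable_fin_num.
have ae1 := ae_integrable1 ih; have ae2 := ae_integrable2 ih.
have Fi := integrable_fubini_F ih.
have FE : ae_eq lam setT (fubini_F lam (EFin \o h))
   (EFin \o (fun x => Rintegral lam setT (fun t => h (x, t)))).
  apply: filterS ae1 => x ix _ /=; rewrite /fubini_F /Rintegral fineK//.
  exact: integrable_fin_num ix.
have GE : ae_eq lam setT (fubini_G lam (EFin \o h))
   (EFin \o (fun t => Rintegral lam setT (fun x => h (x, t)))).
  apply: filterS ae2 => x ix _ /=; rewrite /fubini_G /Rintegral fineK//.
  exact: integrable_fin_num ix.
have mF : measurable_fun setT (EFin \o (fun x => Rintegral lam setT (fun t => h (x, t)))).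
  apply/measurable_EFinP; rewrite /Rintegral.
  apply: (measurableT_comp (fine_measurable measurableT)); exact: (measurable_fubini_F ih).
have mG : measurable_fun setT (EFin \o (fun t => Rintegral lam setT (fun x => h (x, t)))).
  apply/measurable_EFinP; rewrite /Rintegral.
  apply: (measurableT_comp (fine_measurable measurableT)); exact: (measurable_fubini_G ih).
split.
  apply/integrableP; split => //.
  have /integrableP[mFi FFi] := Fi.
  have E0 : (\int[lam]_x `|fubini_F lam (EFin \o h) x| =
      \int[lam]_x `|(Rintegral lam setT (fun t => h (x, t)))%:E|)%E.
    apply: ae_eq_integral => //; [exact: measurableT_comp..|].
    exact: ae_eq_abse FE.
  by move: FFi; rewrite E0.
have E1 : (\int[lam]_x fubini_F lam (EFin \o h) x =
    \int[lam]_x (Rintegral lam setT (fun t => h (x, t)))%:E)%E.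
  by apply: ae_eq_integral => //; exact: (measurable_fubini_F ih).
have E2 : (\int[lam]_x fubini_G lam (EFin \o h) x =
    \int[lam]_t (Rintegral lam setT (fun x => h (x, t)))%:E)%E.
  by apply: ae_eq_integral => //; exact: (measurable_fubini_G ih).
by rewrite {1}/Rintegral [RHS]/Rintegral -E1 -E2 (Fubini ih).
Qed.

End fubini_kernel.

(** * Convolutions and primitives *)

Section convolution.
Context {R : realType}.
Local Notation lam := (@lebesgue_measure R).
Local Notation Re := complex.Re.
Local Notation Im := complex.Im.
Implicit Types (a b g phi : R -> R[i]) (v : R[i]).

Lemma cmeas_comp (d1 d2 : measure_display) (T1 : measurableType d1)
    (T2 : measurableType d2) (g : T2 -> R[i]) (f : T1 -> T2) :
  measurable_fun setT f -> cmeas setT g -> cmeas setT (fun x => g (f x)).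
Proof.
move=> mf [g1 g2]; split.
  exact: (measurableT_comp g1 mf).
exact: (measurableT_comp g2 mf).
Qed.

Lemma cintegral_shift (c : R) g : cmeas setT g ->
  cintegral setT (fun x => g (x + c)) = cintegral setT g.
Proof.
move=> [g1 g2]; rewrite /cintegral /Rintegral.
congr (fine _ +i* fine _).
  by apply: (@integral_shift _ c (fun x => (Re (g x))%:E)); apply/measurable_EFinP.
by apply: (@integral_shift _ c (fun x => (Im (g x))%:E)); apply/measurable_EFinP.
Qed.

Lemma cintegral_reflect (c : R) g : cmeas setT g ->
  cintegral setT (fun x => g (c - x)) = cintegral setT g.
Proof.
move=> [g1 g2]; rewrite /cintegral /Rintegral.
congr (fine _ +i* fine _).
  by apply: (@integral_reflect _ c (fun x => (Re (g x))%:E)); apply/measurable_EFinP.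
by apply: (@integral_reflect _ c (fun x => (Im (g x))%:E)); apply/measurable_EFinP.
Qed.

Lemma cmeas_conv_kernel a b : cmeas setT a -> cmeas setT b ->
  cmeas setT (fun p : R * R => a (p.1 - p.2) * b p.2).
Proof.
move=> ma mb; apply: cmeasM.
  apply: (cmeas_comp _ ma); exact: measurable_funB.
exact: (cmeas_comp _ mb).
Qed.

Lemma Rintegrable_patch (W : set R) (f : R -> R) : measurable W ->
  lam.-integrable setT (EFin \o (f \_ W)) -> lam.-integrable W (EFin \o f).
Proof.
move=> mW fi; apply/integrable_mkcond => //; apply: eq_integrable fi => // x _ /=.
by rewrite !patchE; case: ifP.
Qed.

Lemma cintegrable_sub_mask (W : set R) a : measurable W -> cintegrable setT a ->
  cintegrable setT (cmask W a).
Proof.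
move=> mW ia; apply/(cintegrable_mask _ mW).
exact: (cintegrableS mW measurableT (@subsetT _ _)).
Qed.

Lemma cintegral_mask_shift (W : set R) a (t : R) (z : R[i]) : measurable W ->
  cintegrable setT a ->
  cintegral setT (fun x => (\1_W x)%:C * (a (x - t) * z)) =
  z * cintegral [set s | W (s + t)] a.
Proof.
move=> mW ia; set Wt := [set s | W (s + t)].
have mWt : measurable Wt by rewrite -[Wt]setTI; apply: measurable_shift.
have iWt := cintegrable_sub_mask mWt ia.
rewrite [X in _ = z * X]cintegral_mask -(cintegralZ z measurableT iWt).
rewrite -(@cintegral_shift (- t) (fun x => z * cmask Wt a x)); last first.
  by apply: cmeasM; [exact: cmeas_cst|exact: cintegrable_meas].
apply: eq_cintegral => x _; rewrite /cmask indicE.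
have -> : (x - t \in Wt) = (x \in W).
  by apply/idP/idP; rewrite !inE /Wt/= subrK.
by case: (x \in W); [rewrite mul1r mulrC|rewrite mul0r mulr0].
Qed.

Lemma Rintegral_indic0 (W : set R) (f : R -> R -> R) x :
  Rintegral lam setT (fun t => \1_W x * f x t) =
  ((fun x => Rintegral lam setT (f x)) \_ W) x.
Proof.
rewrite patchE indicE; case: ifPn => _.
  by apply: eq_Rintegral => t _; rewrite mul1r.
by rewrite /Rintegral; under eq_integral do rewrite mul0r; rewrite integral0.
Qed.

(** The source of every statement on convolutions: with [W] the whole
line it gives the product rule for Laplace transforms, and with [W] a segment
it gives primitives of convolutions. *)
Lemma cfubini (W : set R) a b : measurable W ->
  cintegrable setT a -> cintegrable setT b ->
  let c x := cintegral setT (fun t => a (x - t) * b t) in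
  cintegrable W c /\
  cintegral W c = cintegral setT (fun t => b t * cintegral [set s | W (s + t)] a).
Proof.
move=> mW ia ib c.
have ma := cintegrable_meas ia; have mb := cintegrable_meas ib.
have [mk1 mk2] := cmeas_conv_kernel ma mb.
have mW1 : measurable_fun setT (fun p : R * R => \1_W p.1 : R).
  by apply: measurableT_comp.
have iA := cintegrable_cmod measurableT ia.
have iB := cintegrable_cmod measurableT ib.
have A0 x : 0 <= cmod (a x) := cmod_ge0 _.
have B0 x : 0 <= cmod (b x) := cmod_ge0 _.
have h1M : measurable_fun setT (fun p : R * R => \1_W p.1 * Re (a (p.1 - p.2) * b p.2)).
  exact: measurable_funM.
have h2M : measurable_fun setT (fun p : R * R => \1_W p.1 * Im (a (p.1 - p.2) * b p.2)).
  exact: measurable_funM.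
have W1 x : `|\1_W x : R| <= 1 by rewrite indicE; case: (_ \in _); rewrite ?normr1 ?normr0.
have kAB x t : cmod (a (x - t) * b t) <= cmod (a (x - t)) * cmod (b t).
  by rewrite cmodM.
have [|i1 E1] := fubini_kernel h1M iA iB A0 B0.
  move=> x t /=; rewrite normrM; apply: le_trans (kAB x t).
  by rewrite (le_trans (ler_piMl _ (W1 x)))// Re_le_cmod.
have [|i2 E2] := fubini_kernel h2M iA iB A0 B0.
  move=> x t /=; rewrite normrM; apply: le_trans (kAB x t).
  by rewrite (le_trans (ler_piMl _ (W1 x)))// Im_le_cmod.
split.
  split; apply: (Rintegrable_patch mW).
    apply: (eq_Rintegrable measurableT _ i1) => x _.
    exact: (Rintegral_indic0 W (fun x t => Re (a (x - t) * b t))).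
  apply: (eq_Rintegrable measurableT _ i2) => x _.
  exact: (Rintegral_indic0 W (fun x t => Im (a (x - t) * b t))).
have key t := cintegral_mask_shift t (b t) mW ia.
under [RHS]eq_cintegral do rewrite -key.
apply: ceqP => /=.
  rewrite Rintegral_mkcond.
  transitivity (Rintegral lam setT (fun x => Rintegral lam setT
     (fun t => \1_W x * Re (a (x - t) * b t)))).
    apply: eq_Rintegral => x _.
    exact/esym/(Rintegral_indic0 W (fun x t => Re (a (x - t) * b t))).
  rewrite E1; apply: eq_Rintegral => t _; apply: eq_Rintegral => x _.
  by rewrite [RHS]cReM/= mul0r subr0.
rewrite Rintegral_mkcond.
transitivity (Rintegral lam setT (fun x => Rintegral lam setT
   (fun t => \1_W x * Im (a (x - t) * b t)))).
  apply: eq_Rintegral => x _.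
  exact/esym/(Rintegral_indic0 W (fun x t => Im (a (x - t) * b t))).
rewrite E2; apply: eq_Rintegral => t _; apply: eq_Rintegral => x _.
by rewrite [RHS]cImM/= mul0r addr0.
Qed.

Definition conv a b (x : R) := cintegral `[0, x] (fun t => a (x - t) * b t).
Definition prim phi (x : R) := cintegral `[0, x] phi.
Definition locint phi := forall X : R, cintegrable `[0, X] phi.

(** Only the values of [a] and [b] on [[0, X]] enter, so local
integrability is enough to use the global Fubini theorem. *)
Lemma conv_mask a b (X x : R) : x <= X ->
  conv a b x = cintegral setT (fun t => cmask `[0, X] a (x - t) * cmask `[0, X] b t).
Proof.
move=> xX; rewrite /conv cintegral_mask; apply: eq_cintegral => t _; rewrite /cmask !mem_setE/=.
rewrite !in_itv/=; case: (leP 0 t) => t0/=; last by rewrite mulr0.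
case: (leP t x) => tx/=.
  rewrite (le_trans tx xX) subr_ge0 tx/= ifT//.
  by rewrite (le_trans _ xX)// gerBl.
by rewrite subr_ge0 leNgt tx/= mul0r.
Qed.

Lemma conv_cintegrable a b (X : R) :
  cintegrable `[0, X] a -> cintegrable `[0, X] b -> cintegrable `[0, X] (conv a b).
Proof.
move=> /(cintegrable_mask _ (measurable_itv _)) ia /(cintegrable_mask _ (measurable_itv _)) ib.
have [ic _] := cfubini (measurable_itv `[0, X]) ia ib.
apply: eq_cintegrable ic => // x; rewrite inE/= in_itv/= => /andP[_ xX].
by rewrite (conv_mask _ _ xX).
Qed.

(** Integrate over [x] first: for fixed [t] the factor [a (x - t)]
integrates to the primitive of [a] at [X - t]. *)
Lemma prim_conv a b (X : R) :
  cintegrable `[0, X] a -> cintegrable `[0, X] b -> prim (conv a b) X = conv (prim a) b X.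
Proof.
move=> /(cintegrable_mask _ (measurable_itv _)) ia /(cintegrable_mask _ (measurable_itv _)) ib.
have [_ E] := cfubini (measurable_itv `[0, X]) ia ib.
transitivity (cintegral `[0, X] (fun x : R =>
  cintegral setT (fun t => cmask `[0, X] a (x - t) * cmask `[0, X] b t))).
  apply: eq_cintegral => x; rewrite inE/= in_itv/= => /andP[_ xX].
  by rewrite -(conv_mask _ _ xX).
rewrite {}E /conv [RHS]cintegral_mask; apply: eq_cintegral => t _.
rewrite {1}/cmask {2}/cmask; case: ifPn => tX; last by rewrite mul0r.
rewrite mulrC; congr (_ * _); rewrite /prim cintegral_mask [RHS]cintegral_mask.
move: tX; rewrite inE/= in_itv/= => /andP[t0 tX].
have -> : [set s | (`[0, X]%classic : set R) (s + t)] = `[- t, X - t]%classic.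
  by apply/seteqP; split => s /=; rewrite !in_itv/= => /andP[h1 h2]; apply/andP; split; lra.
apply: eq_cintegral => s _; rewrite /cmask !mem_setE !in_itv/=.
case: (leP 0 s) => s0 /=; last by case: ifP.
rewrite (le_trans _ s0) ?oppr_le0//=; case: ifP => // sX.
by rewrite (le_trans sX)// gerBl.
Qed.

Lemma convC a b (X : R) : cmeas `[0, X] a -> cmeas `[0, X] b ->
  conv a b X = conv b a X.
Proof.
move=> /(cmeas_mask (measurable_itv _)) ma /(cmeas_mask (measurable_itv _)) mb.
rewrite !(conv_mask _ _ (lexx X)).
rewrite -(@cintegral_reflect X); last first.
  apply: cmeasM => //.
  by apply: (cmeas_comp _ ma); exact: measurable_funB.
by apply: eq_cintegral => t _; rewrite mulrC; congr (_ * cmask _ _ _); ring.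
Qed.

Lemma prim_conv_r a b (X : R) : cintegrable `[0, X] a -> cintegrable `[0, X] b ->
  cintegrable `[0, X] (prim b) -> prim (conv a b) X = conv a (prim b) X.
Proof.
move=> ia ib ipb; have ma := cintegrable_meas ia; have mb := cintegrable_meas ib.
rewrite [RHS]convC//; last exact: cintegrable_meas.
rewrite -(prim_conv ib ia); apply: eq_cintegral => x; rewrite inE/= in_itv/= => /andP[_ xX].
apply: convC; apply: cmeasS (measurable_itv `[0, X]) _ _ => //;
  by move=> y /=; rewrite !in_itv/= => /andP[-> /le_trans]; apply.
Qed.

End convolution.

(** * Differentiation of complex-valued functions of a real variable *)

Section cderiv.
Context {R : realType}.
Local Notation lam := (@lebesgue_measure R).
Local Notation Re := complex.Re.
Local Notation Im := complex.Im.
Implicit Types (F G f g : R -> R[i]) (t : R) (d c : R[i]).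

Definition cderiv F t d := is_derive t (1 : R) (fun x => Re (F x)) (Re d) /\
  is_derive t (1 : R) (fun x => Im (F x)) (Im d).

Definition ccont F t := {for t, continuous (fun x => Re (F x))} /\
  {for t, continuous (fun x => Im (F x))}.

Lemma is_derive_continuous (f : R -> R) t (d : R) : is_derive t (1 : R) f d ->
  {for t, continuous f}.
Proof. by move=> [df _]; apply: differentiable_continuous; apply/derivable1_diffP. Qed.

Lemma is_derive_mul (f h : R -> R) t (a b : R) : is_derive t (1 : R) f a -> is_derive t (1 : R) h b ->
  is_derive t (1 : R) (fun x => f x * h x) (a * h t + f t * b).
Proof.
move=> fa gb; rewrite (_ : _ + _ = f t *: b + h t *: a); last by rewrite /GRing.scale/=; ring.
exact: is_deriveM.
Qed.

Lemma is_derive_add (f h : R -> R) t (a b : R) : is_derive t (1 : R) f a -> is_derive t (1 : R) h b ->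
  is_derive t (1 : R) (fun x => f x + h x) (a + b).
Proof. by move=> fa gb; exact: is_deriveD. Qed.

Lemma is_derive_sub (f h : R -> R) t (a b : R) : is_derive t (1 : R) f a -> is_derive t (1 : R) h b ->
  is_derive t (1 : R) (fun x => f x - h x) (a - b).
Proof. by move=> fa gb; exact: is_deriveB. Qed.

Lemma is_derive_comp (h f : R -> R) t (a b : R) : is_derive t (1 : R) f a -> is_derive (f t) (1 : R) h b ->
  is_derive t (1 : R) (fun x => h (f x)) (b * a).
Proof. by move=> fa hb; exact: is_derive1_comp. Qed.

Lemma is_derive_sqr (x : R -> R) t a : is_derive t (1 : R) x a ->
  is_derive t (1 : R) (fun y => x y ^+ 2) (2 * x t * a).
Proof.
move=> xa; under eq_fun do rewrite expr2.
by rewrite (_ : _ * a = a * x t + x t * a); [exact: is_derive_mul|ring].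
Qed.

Lemma is_derive_val (f : R -> R) t (a b : R) : a = b -> is_derive t (1 : R) f a ->
  is_derive t (1 : R) f b.
Proof. by move=> <-. Qed.

Lemma cderiv_cont F t d : cderiv F t d -> ccont F t.
Proof. by move=> [/is_derive_continuous h1 /is_derive_continuous h2]; split. Qed.

Lemma cderiv_cst c t : cderiv (fun=> c) t 0.
Proof. by split; exact: is_derive_cst. Qed.

Lemma cderiv_real (f : R -> R) t (d : R) : is_derive t (1 : R) f d ->
  cderiv (fun x => (f x)%:C) t d%:C.
Proof. by move=> fd; split => //=; exact: is_derive_cst. Qed.

Lemma cderiv_id t : cderiv (fun x => x%:C) t 1.
Proof. by apply: cderiv_real; exact: is_derive_id. Qed.

Lemma cderivD F G t d1 d2 : cderiv F t d1 -> cderiv G t d2 ->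
  cderiv (fun x => F x + G x) t (d1 + d2).
Proof.
move=> [f1 f2] [g1 g2]; split.
  by under eq_fun do rewrite cReD; rewrite cReD; apply: is_deriveD.
by under eq_fun do rewrite cImD; rewrite cImD; apply: is_deriveD.
Qed.

Lemma cderivN F t d : cderiv F t d -> cderiv (fun x => - F x) t (- d).
Proof.
move=> [f1 f2]; split.
  by under eq_fun do rewrite cReN; rewrite cReN; apply: is_deriveN.
by under eq_fun do rewrite cImN; rewrite cImN; apply: is_deriveN.
Qed.

Lemma cderivM F G t d1 d2 : cderiv F t d1 -> cderiv G t d2 ->
  cderiv (fun x => F x * G x) t (d1 * G t + F t * d2).
Proof.
move=> [f1 f2] [g1 g2]; split.
  under eq_fun do rewrite cReM.
  apply: is_derive_val (is_derive_sub (is_derive_mul f1 g1) (is_derive_mul f2 g2)).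
  by rewrite !cReImE; ring.
under eq_fun do rewrite cImM.
apply: is_derive_val (is_derive_add (is_derive_mul f1 g2) (is_derive_mul f2 g1)).
by rewrite !cReImE; ring.
Qed.

Lemma cderivZ c F t d : cderiv F t d -> cderiv (fun x => c * F x) t (c * d).
Proof. by move=> fd; have := cderivM (cderiv_cst c t) fd; rewrite mul0r add0r. Qed.

Lemma cderiv_eq F t d d' : cderiv F t d -> d = d' -> cderiv F t d'.
Proof. by move=> ? <-. Qed.

Lemma near_cderiv F G t d : (\forall x \near t, F x = G x) -> cderiv F t d ->
  cderiv G t d.
Proof.
move=> FG [h1 h2]; split.
  by apply: near_eq_is_derive h1; apply: filterS FG => x ->.
by apply: near_eq_is_derive h2; apply: filterS FG => x ->.
Qed.

Lemma cderiv_cexp g t d : cderiv g t d ->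
  cderiv (fun x => cexp (g x)) t (d * cexp (g t)).
Proof.
move=> [g1 g2].
have eR := is_derive_comp g1 (is_derive_expR (Re (g t))).
split.
  apply: is_derive_val (is_derive_mul eR (is_derive_comp g2 (is_derive_cos (Im (g t))))).
  by rewrite cReM /=; ring.
apply: is_derive_val (is_derive_mul eR (is_derive_comp g2 (is_derive_sin (Im (g t))))).
by rewrite cImM /=; ring.
Qed.

(** Differentiate the explicit real and imaginary parts given by
[clog_Re_gt0]. *)
Lemma cderiv_clog g t d : cderiv g t d -> 0 < Re (g t) ->
  cderiv (fun x => clog (g x)) t (d / g t).
Proof.
move=> gd g0; have [gc _] := cderiv_cont gd; have [g1 g2] := gd.
have rn : \forall x \near t, 0 < Re (g x) by exact: (cvgr_gt _ gc).
pose L x : R[i] := (ln (Re (g x) ^+ 2 + Im (g x) ^+ 2) / 2) +i* atan (Im (g x) / Re (g x)).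
apply: (@near_cderiv L); first by apply: filterS rn => x x0; rewrite clog_Re_gt0.
have s0 : 0 < Re (g t) ^+ 2 + Im (g t) ^+ 2 by rewrite ltr_pwDl ?exprn_gt0 ?sqr_ge0.
have gn : g t != 0 by exact: Re_gt0_neq0.
have dg : d / g t = (Re (g t) ^+ 2 + Im (g t) ^+ 2)^-1%:C * (d * (Re (g t) -i* Im (g t))).
  apply: (mulIf gn); rewrite divfK//.
  by apply: ceqP; rewrite !cReImE/=; field; rewrite gt_eqF.
rewrite dg; split; rewrite !cReImE.
  have dS := is_derive_add (is_derive_sqr g1) (is_derive_sqr g2).
  apply: is_derive_val (is_derive_mul (is_derive_comp dS (is_derive1_ln s0))
    (is_derive_cst (2^-1 : R) t 1)).
  by rewrite /=; field; rewrite gt_eqF.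
have g0' : Re (g t) != 0 by rewrite gt_eqF.
have dV := is_deriveV g0' g1.
apply: is_derive_val (is_derive_comp (is_derive_mul g2 dV) (is_derive1_atan (Im (g t) / Re (g t)))).
rewrite /GRing.scale/=; field; rewrite g0' /= (gt_eqF s0).
done.
Qed.

Lemma cFTC F f (a b : R) : a <= b ->
  (forall t, a <= t <= b -> cderiv F t (f t)) ->
  (forall t, a <= t <= b -> ccont f t) ->
  cintegrable `[a, b] f /\ cintegral `[a, b] f = F b - F a.
Proof.
rewrite le_eqVlt => /predU1P[<- _ _|ab dF cf].
  rewrite set_itv1; split.
    split; apply/integrableP; split; rewrite ?integral_set1//; exact: measurable_fun_set1.
  by rewrite /cintegral !Rintegral_set1 subrr.
have key (G g : R -> R) : (forall t, a <= t <= b -> is_derive t (1 : R) G (g t)) ->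
    (forall t, a <= t <= b -> {for t, continuous g}) ->
    lam.-integrable `[a, b] (EFin \o g) /\ Rintegral lam `[a, b] g = G b - G a.
  move=> dG cg.
  have cgw : {within `[a, b], continuous g}.
    apply: continuous_in_subspaceT => t; rewrite inE/= in_itv/=; exact: cg.
  split.
    by apply: continuous_compact_integrable => //; exact: segment_compact.
  rewrite /Rintegral (@continuous_FTC2 _ g G)//.
    split.
    - move=> t; rewrite in_itv/= => /andP[/ltW h1 /ltW h2].
      by have [] := dG t (introT andP (conj h1 h2)).
    - apply: cvg_at_right_filter; apply: is_derive_continuous (dG a _).
      by rewrite lexx ltW.
    - apply: cvg_at_left_filter; apply: is_derive_continuous (dG b _).
      by rewrite lexx ltW.
  move=> t; rewrite in_itv/= => /andP[/ltW h1 /ltW h2].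
  by have [_] := dG t (introT andP (conj h1 h2)); rewrite derive1E.
have [i1 E1] := key _ _ (fun t h => (dF t h).1) (fun t h => (cf t h).1).
have [i2 E2] := key _ _ (fun t h => (dF t h).2) (fun t h => (cf t h).2).
by split; [split|apply: ceqP; rewrite ?cReB ?cImB /=].
Qed.

Lemma cderiv0_cst F (a b : R) : a <= b -> (forall t, a <= t <= b -> cderiv F t 0) ->
  F a = F b.
Proof.
move=> ab dF; have [_] := cFTC ab dF (fun t _ => cderiv_cont (cderiv_cst 0 t)).
by rewrite cintegral0 => /esym/eqP; rewrite subr_eq0 => /eqP.
Qed.

End cderiv.

(** * Laplace transforms and an Abelian theorem *)

Section exhaustion.
Context {R : realType}.
Local Notation lam := (@lebesgue_measure R).
Local Notation Re := complex.Re.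
Local Notation Im := complex.Im.
Implicit Types (g w : R -> R[i]) (v : R[i]).

Lemma cintegrable_bndM (D : set R) w g (M : R) : measurable D -> cmeas D w ->
  (forall x, D x -> cmod (w x) <= M) -> cintegrable D g -> cintegrable D (fun x => w x * g x).
Proof.
move=> mD mw wM ig.
apply: (cintegrable_dom mD (cmeasM mw (cintegrable_meas ig)) (RintegrableZ M mD (cintegrable_cmod mD ig))).
by move=> x Dx; rewrite cmodM ler_wpM2r ?cmod_ge0// wM.
Qed.

(** Dominated convergence for the restrictions of [g] to the
exhausting sets. *)
Lemma cintegral_exhaust (D : set R) (E_ : nat -> set R) g : measurable D ->
  (forall n, measurable (E_ n)) -> (forall n, E_ n `<=` D) ->
  (forall x, D x -> \forall n \near \oo, E_ n x) -> cintegrable D g ->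
  ccv \oo (fun n => cintegral (E_ n) g) (cintegral D g).
Proof.
move=> mD mE ED nE ig.
have icn n : cintegrable D (cmask (E_ n) g).
  apply: (cintegrableS mD measurableT (@subsetT _ _)).
  by apply/(cintegrable_mask _ (mE n)); exact: (cintegrableS (mE n) mD (ED n)).
have [] := @cintegral_dct R D (fun n => cmask (E_ n) g) g (fun x => cmod (g x)) mD.
- by move=> n; exact: cintegrable_meas.
- exact: cintegrable_cmod.
- by move=> n x _; rewrite /cmask; case: ifP => //; rewrite cmod0 cmod_ge0.
- move=> x Dx; have E : \forall n \near \oo, g x = cmask (E_ n) g x.
    by have := nE x Dx; apply: filterS => n Ex; rewrite /cmask mem_set.
  by apply: near_ccv E _; exact: ccv_cst.
move=> _; apply: eq_ccv => n; rewrite cintegral_mask [RHS]cintegral_mask.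
apply: eq_cintegral => x _; rewrite /cmask; case: ifPn => //.
by rewrite notin_setE => nD; case: ifPn => //; rewrite inE => /ED.
Qed.

Lemma itv0oo_bigcup : `[0, +oo[%classic = \bigcup_n `[0, n%:R]%classic :> set R.
Proof.
by rewrite itv_bndy_bigcup_BRight; apply: eq_bigcup => // n _; rewrite add0r.
Qed.

Lemma cmeas_0oo g : (forall X : R, @cmeas R _ R `[0, X] g) -> @cmeas R _ R `[0, +oo[ g.
Proof.
by move=> mg; rewrite itv0oo_bigcup; split; apply/measurable_fun_bigcup => // n; have [] := mg n%:R.
Qed.

Lemma cintegral_exhaust_0oo g : cintegrable `[0, +oo[ g ->
  ccv \oo (fun n : nat => cintegral `[0, n%:R] g) (cintegral `[0, +oo[ g).
Proof.
apply: (@cintegral_exhaust `[0, +oo[ (fun n => `[0, n%:R]%classic)) => //.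
- by move=> n x /=; rewrite !in_itv/= andbT => /andP[].
- move=> x /=; rewrite in_itv/= andbT => x0; near=> n; rewrite in_itv/= x0/=.
  near: n; exact: nbhs_infty_ger.
Unshelve. all: by end_near. Qed.

Lemma cmeas_expN v (D : set R) : cmeas D (fun t => cexp (- (v * t%:C))).
Proof.
apply: cmeas_cexp; apply: cmeasN; apply: cmeasM; first exact: cmeas_cst.
by apply: cmeasC; exact: measurable_id.
Qed.

Lemma cmod_expN v (t : R) : cmod (cexp (- (v * t%:C))) = expR (- (Re v * t)).
Proof. by rewrite cmod_cexp !cReImE mulr0 subr0. Qed.

Lemma Rintegral_expN (d : R) : 0 < d ->
  lam.-integrable `[0, +oo[ (EFin \o (fun t : R => expR (- (d * t)))) /\
  Rintegral lam `[0, +oo[ (fun t : R => expR (- (d * t))) = d^-1.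
Proof.
move=> d0.
have h : lam.-integrable `[0, +oo[ (EFin \o (fun t : R => expR (- (d * t)))).
  have h1 : lam.-integrable `[0, +oo[ (EFin \o exponential_pdf d).
    exact: (@integrableS _ _ _ lam setT `[0,+oo[%classic (EFin \o exponential_pdf d) measurableT (measurable_itv _) (@subsetT _ _) (integrable_exponential_pdf d0)).
  apply: (eq_Rintegrable (measurable_itv _) _ (RintegrableZ d^-1 (measurable_itv _) h1)).
  move=> x /=; rewrite in_itv/= andbT => x0.
  by rewrite exponential_pdfE// mulrA mulVf ?gt_eqF// mul1r mulNr.
split=> //; apply: (mulfI (lt0r_neq0 d0)); rewrite mulfV ?gt_eqF//.
rewrite -RintegralZl// Rintegral_mkcond /Rintegral; have := integral_exponential_pdf d0.
rewrite (_ : (\int[lam]_x _)%E = (\int[lam]_x (exponential_pdf d x)%:E)%E) => [->//|].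
apply: eq_integral => x _; rewrite /= /exponential_pdf !patchE; case: ifP => // _.
by rewrite mulNr.
Qed.

End exhaustion.

Section laplace_transform.
Context {R : realType}.
Local Notation lam := (@lebesgue_measure R).
Local Notation Re := complex.Re.
Local Notation Im := complex.Im.
Implicit Types (a b phi : R -> R[i]) (v c : R[i]).

(** The absolutely convergent transform; unlike [laplace] it is meaningful only
when [lapint] holds. *)
Definition Lap phi v := cintegral `[0, +oo[ (fun t => cexp (- (v * t%:C)) * phi t).
Definition lapint phi v := cintegrable `[0, +oo[ (fun t => cexp (- (v * t%:C)) * phi t).

Lemma lapintZ c phi v : lapint phi v -> lapint (fun t => c * phi t) v /\
  Lap (fun t => c * phi t) v = c * Lap phi v.
Proof.
move=> ip; rewrite /lapint /Lap.
have e : (fun t : R => cexp (- (v * t%:C)) * (c * phi t)) =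
  (fun t => c * (cexp (- (v * t%:C)) * phi t)) by apply/funext => t; rewrite mulrCA.
by rewrite e; split; [exact: cintegrableZ|rewrite cintegralZ].
Qed.

Lemma lapintD a b v : lapint a v -> lapint b v -> lapint (fun t => a t + b t) v /\
  Lap (fun t => a t + b t) v = Lap a v + Lap b v.
Proof.
move=> ia ib; rewrite /lapint /Lap.
have e : (fun t : R => cexp (- (v * t%:C)) * (a t + b t)) =
  (fun t => cexp (- (v * t%:C)) * a t + cexp (- (v * t%:C)) * b t).
  by apply/funext => t; rewrite mulrDr.
by rewrite e; split; [exact: cintegrableD|rewrite cintegralD].
Qed.

Lemma Lap_eq a b v : (forall t, 0 <= t -> a t = b t) -> Lap a v = Lap b v.
Proof.
move=> ab; apply: eq_cintegral => t; rewrite inE/= in_itv/= andbT => t0.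
by rewrite ab.
Qed.

Lemma lap_growth phi v (M s : R) : @cmeas R _ R `[0, +oo[ phi ->
  (forall t, 0 <= t -> cmod (phi t) <= M * expR (s * t)) -> s < Re v ->
  lapint phi v /\ cmod (Lap phi v) <= M / (Re v - s).
Proof.
move=> mp pM sv; have d0 : 0 < Re v - s by rewrite subr_gt0.
have [ie Ee] := Rintegral_expN d0.
have iB := RintegrableZ M (measurable_itv _) ie.
have mF := cmeasM (cmeas_expN v `[0, +oo[) mp.
have bd (t : R) : `[0, +oo[%classic t ->
    cmod (cexp (- (v * t%:C)) * phi t) <= M * expR (- ((Re v - s) * t)).
  rewrite /= in_itv/= andbT => t0; rewrite cmodM cmod_expN.
  apply: le_trans (ler_wpM2l (expR_ge0 _) (pM _ t0)) _.
  by rewrite mulrCA -expRD le_eqVlt; apply/orP; left; apply/eqP; congr (_ * expR _); ring.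
split; first exact: (cintegrable_dom (measurable_itv _) mF iB bd).
apply: le_trans (cmod_cintegral_le (measurable_itv _) mF iB bd) _.
by rewrite RintegralZl// Ee.
Qed.

Lemma cmask_conv_exp a b v (x : R) :
  (0 <= x -> cintegrable `[0, x] (fun t => a (x - t) * b t)) ->
  cintegral setT (fun t => @cmask R _ R `[0, +oo[ (fun t => cexp (- (v * t%:C)) * a t) (x - t)
    * @cmask R _ R `[0, +oo[ (fun t => cexp (- (v * t%:C)) * b t) t) =
  @cmask R _ R `[0, +oo[ (fun t => cexp (- (v * t%:C)) * conv a b t) x.
Proof.
move=> iab; rewrite /cmask !mem_setE in_itv/= andbT; case: (leP 0 x) => x0; last first.
  rewrite -[RHS](cintegral0 setT); apply: eq_cintegral => t _; rewrite !in_itv/= !andbT.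
  case: (leP 0 t) => t0; last by rewrite mulr0.
  by rewrite ifF ?mul0r//; apply/negbTE; rewrite -ltNge; lra.
rewrite /conv -cintegralZ//; last exact: iab.
rewrite [RHS]cintegral_mask; apply: eq_cintegral => t _; rewrite /cmask !mem_setE !in_itv/= !andbT.
case: (leP 0 t) => t0/=; last by rewrite mulr0.
rewrite subr_ge0; case: ifP => tx; last by rewrite mul0r.
rewrite mulrACA -cexpD; congr (cexp _ * _); rewrite rmorphB/=; ring.
Qed.

(** The exponential is multiplicative, so the weighted convolution is the
convolution of the weighted functions, and Fubini applies.  The hypothesis on
the integrand is needed since [conv] is an integral over [[0, x]] for every
[x], not for almost every [x]. *)
Lemma lap_conv a b v : (forall x, 0 <= x -> cintegrable `[0, x] (fun t => a (x - t) * b t)) ->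
  lapint a v -> lapint b v ->
  lapint (conv a b) v /\ Lap (conv a b) v = Lap a v * Lap b v.
Proof.
move=> iab /(cintegrable_mask _ (measurable_itv _)) ia /(cintegrable_mask _ (measurable_itv _)) ib.
have [] := cfubini measurableT ia ib.
rewrite (funext (fun x => @cmask_conv_exp a b v x (iab x))) => ic Ec; split.
  by apply/(cintegrable_mask _ (measurable_itv _)).
rewrite /Lap cintegral_mask Ec [X in _ = X * _]cintegral_mask [X in _ = _ * X]cintegral_mask.
rewrite -cintegralZ//; apply: eq_cintegral => t _; rewrite mulrC; congr (_ * _).
Qed.

Lemma lapint_locint phi v : lapint phi v -> locint phi.
Proof.
move=> ip X; have iX : cintegrable `[0, X] (fun t => cexp (- (v * t%:C)) * phi t).
  apply: (cintegrableS (measurable_itv _) (measurable_itv _) _ ip) => x /=.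
  by rewrite !in_itv/= andbT => /andP[].
apply: (@eq_cintegrable _ _ (fun t => cexp (- (- v * t%:C)) * (cexp (- (v * t%:C)) * phi t))) => //.
  by move=> t _; rewrite mulrA -cexpD mulNr opprK subrr cexp0 mul1r.
apply: (@cintegrable_bndM _ _ _ _ (expR (`|Re v| * `|X|))) => //; first exact: cmeas_expN.
move=> t /=; rewrite in_itv/= => /andP[t0 tX]; rewrite cmod_expN ler_expR !cReImE mulNr opprK.
apply: le_trans (ler_norm _) _; rewrite normrM ler_wpM2l// ger0_norm//.
exact: le_trans tX (ler_norm _).
Qed.

Lemma Lap1 v : 0 < Re v -> lapint (fun=> 1) v /\ Lap (fun=> 1) v = v^-1.
Proof.
move=> v0; have vn := Re_gt0_neq0 v0.
have [iv _] : lapint (fun=> 1) v /\ cmod (Lap (fun=> 1) v) <= 1 / (Re v - 0).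
  apply: (lap_growth (cmeas_cst _ _)) => //.
  by move=> t _; rewrite mul0r expR0 cmod1 mulr1.
split=> //.
apply: (ccv_unique (cintegral_exhaust_0oo iv)).
have dF t : cderiv (fun t => - v^-1 * cexp (- (v * t%:C))) t (cexp (- (v * t%:C)) * 1).
  apply: cderiv_eq (cderivZ _ (cderiv_cexp (cderivN (cderivZ v (cderiv_id t))))) _.
  by field.
have dE t : cderiv (fun t => cexp (- (v * t%:C)) * 1) t (- v * cexp (- (v * t%:C))).
  under eq_fun do rewrite mulr1.
  apply: cderiv_eq ((cderiv_cexp (cderivN (cderivZ v (cderiv_id t))))) _.
  by rewrite mulr1.
have E (n : nat) : v^-1 - v^-1 * cexp (- (v * n%:R%:C)) =
    cintegral `[0, n%:R] (fun t => cexp (- (v * t%:C)) * 1).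
  have [_ ->] := cFTC (ler0n _ n) (fun t _ => dF t) (fun t _ => cderiv_cont (dE t)).
  by rewrite mulr0 oppr0 cexp0; ring.
apply: (eq_ccv E).
apply: (@ccv_squeeze _ _ _ _ _ _ (fun n : nat => cmod v^-1 * expR (- (Re v * n%:R)))).
  by near=> n; rewrite addrAC subrr add0r cmodN cmodM cmod_expN.
rewrite -[X in _ --> X](mulr0 (cmod v^-1)); apply: cvgMr.
have : (expR (- (Re v)) ^+ n @[n --> \oo] --> (0 : R)).
  by apply: cvg_expr; rewrite ger0_norm ?expR_ge0// expR_lt1 oppr_lt0.
apply: cvg_trans; apply: near_eq_cvg; near=> n; rewrite -expRM_natl; congr expR; ring.
Unshelve. all: by end_near. Qed.

Lemma conv1 phi : conv (fun=> 1) phi = prim phi.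
Proof. by apply/funext => x; apply: eq_cintegral => t _; rewrite mul1r. Qed.

(** A primitive is the convolution with the constant 1. *)
Lemma lap_prim phi v : 0 < Re v -> lapint phi v ->
  lapint (prim phi) v /\ Lap (prim phi) v = Lap phi v / v.
Proof.
move=> v0 ip; have [i1 E1] := Lap1 v0.
have iab (x : R) : 0 <= x -> cintegrable `[0, x] (fun t => (fun=> 1 : R[i]) (x - t) * phi t).
  by move=> _; apply: eq_cintegrable (lapint_locint ip x) => // t _; rewrite mul1r.
have [ic Ec] := lap_conv iab i1 ip.
by rewrite -conv1 Ec E1 mulrC.
Qed.

Lemma locint_cst c : locint (fun=> c).
Proof.
move=> X; case: (leP 0 X) => X0.
  have [] := @cFTC _ (fun t => c * t%:C) (fun=> c) 0 X X0 => //.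
    by move=> t _; apply: cderiv_eq (cderivZ c (cderiv_id t)) _; rewrite mulr1.
  by move=> t _; exact: cderiv_cont (cderiv_cst c t).
rewrite set_itv_ge ?bnd_simp -?ltNge//.
by split; apply: integrable_set0.
Qed.

Lemma locint_prim phi : locint phi -> locint (prim phi).
Proof.
by move=> lp X; rewrite -conv1; apply: conv_cintegrable => //; exact: locint_cst.
Qed.

Lemma ccv_bounded (P : R -> R[i]) (l : R[i]) : ccv +oo%R P l ->
  (forall X : R, 0 <= X -> exists M, forall t, 0 <= t <= X -> cmod (P t) <= M) ->
  exists M, forall t, 0 <= t -> cmod (P t) <= M.
Proof.
move=> /ccv_cmod/cvgrPdist_lt Pl bP; have [X [_ hX]] := Pl _ ltr01.
have Y0 : 0 <= Num.max 0 (X + 1) by rewrite le_max lexx.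
have [M hM] := bP _ Y0.
exists (Num.max M (cmod l + 1)) => t t0.
have [tY|Yt] := leP t (Num.max 0 (X + 1)); first by rewrite le_max hM// t0.
move: (Yt); rewrite gt_max => /andP[_ Xt].
have := hX t (lt_trans (ltr_pwDr ltr01 (lexx X)) Xt); rewrite /= distrC => h.
rewrite le_max; apply/orP; right; rewrite -lerBlDl ltW// (le_lt_trans _ h)// ler_norm//.
Qed.

(** For small [d] the transform at [d u] is dominated by the tail of
[q]: on [[0, X]] the weight [d] makes the contribution [O(d X)], and beyond
[X], where [|q| <= e], the contribution is at most [|u| e / Re u]. *)
Lemma abelian_theorem (q : R -> R[i]) (u : R[i]) (M : R) : 0 < Re u ->
  @cmeas R _ R `[0, +oo[ q -> (forall t, 0 <= t -> cmod (q t) <= M) -> ccv +oo%R q 0 ->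
  ccv (0 : R)^'+ (fun d : R => d%:C * u * Lap q (d%:C * u)) 0.
Proof.
move=> u0 mq qM q0.
have M0 : 0 <= M by apply: le_trans (qM 0 (lexx _)); exact: cmod_ge0.
have est (e X d : R) : 0 <= e -> 0 <= X -> 0 < d -> (forall t, X <= t -> cmod (q t) <= e) ->
    cmod (d%:C * u * Lap q (d%:C * u)) <= d * (cmod u * (M * X)) + cmod u * (e / Re u).
  move=> e0 X0 d0 qe.
  have s0 : 0 < d * Re u by exact: mulr_gt0.
  have [ie Ee] := Rintegral_expN s0.
  have iI : lam.-integrable `[0, +oo[ (EFin \o (fun t : R => \1_`[0, X] t)).
    apply: (@integrableS _ _ _ lam setT `[0,+oo[%classic _ measurableT (measurable_itv _) (@subsetT _ _)).
    exact: (integrable_indic_itv 0 X true false).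
  have iX := RintegrableZ M (measurable_itv _) iI.
  have iB := RintegrableD (measurable_itv _) iX (RintegrableZ e (measurable_itv _) ie).
  have mF := cmeasM (cmeas_expN (d%:C * u) `[0, +oo[) mq.
  have bd (t : R) : `[0, +oo[%classic t -> cmod (cexp (- (d%:C * u * t%:C)) * q t) <=
      M * \1_`[0, X] t + e * expR (- (d * Re u * t)).
    rewrite /= in_itv/= andbT => t0; rewrite cmodM cmod_expN !cReImE/= mul0r subr0 indicE.
    have [tX|tX] := leP t X.
      rewrite mem_set/= ?in_itv/= ?t0// mulr1.
      apply: le_trans (_ : M <= _); last by rewrite lerDl mulr_ge0 ?expR_ge0.
      rewrite -[leRHS]mul1r ler_pM ?expR_ge0 ?cmod_ge0 ?qM// expR_le1 oppr_le0.
      by rewrite mulr_ge0// ltW.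
    rewrite memNset ?mulr0 ?add0r; last by rewrite /= in_itv/= t0/= leNgt tX.
    rewrite mulrC ler_wpM2r ?expR_ge0//.
    exact: qe (ltW tX).
  have := cmod_cintegral_le (measurable_itv _) mF iB bd.
  rewrite RintegralD//; last exact: RintegrableZ.
  rewrite RintegralZl; [|exact: measurable_itv|exact: iI].
  rewrite RintegralZl; [|exact: measurable_itv|exact: ie].
  rewrite Ee.
  have -> : Rintegral lam `[0, +oo[ (\1_`[0, X]) = X.
    rewrite /Rintegral integral_indic//.
    rewrite (_ : _ `&` _ = `[0, X]%classic); last first.
      by apply/seteqP; split => x /=; rewrite !in_itv/= andbT; [case=> /andP[-> ->]|move=> /andP[-> ->]].
    apply: (etrans (congr1 fine (@lebesgue_measure_itv R `[0, X]))) => /=.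
    by rewrite lte_fin; case: ltgtP X0 => [_ _|//|<- _] //=; rewrite oppr0 addr0.
  move=> h; rewrite !cmodM cmodC (gtr0_norm d0).
  apply: le_trans (ler_wpM2l _ h) _; first by rewrite mulr_ge0 ?cmod_ge0// ltW.
  rewrite le_eqVlt; apply/orP; left; apply/eqP; field.
  by rewrite !gt_eqF.
apply/ccvP/cvgrPdist_lt => eps eps0.
have e0 : 0 < eps / 2 * (Re u / (cmod u + 1)).
  by rewrite mulr_gt0 ?divr_gt0// ltr_wpDl ?cmod_ge0.
move: (q0) => /ccvP/cvgrPdist_lt/(_ _ e0) [X [_ hX]].
pose Y := Num.max 0 (X + 1).
have Y0 : 0 <= Y by rewrite le_max lexx.
have qY t : Y <= t -> cmod (q t) <= eps / 2 * (Re u / (cmod u + 1)).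
  rewrite ge_max => /andP[_ tX]; have /= := hX t (lt_le_trans (ltr_pwDr ltr01 (lexx X)) tX).
  by rewrite subr0 sub0r normrN ger0_norm ?cmod_ge0// => /ltW.
have K0 : 0 < cmod u * (M * Y) + 1 by rewrite ltr_wpDl// mulr_ge0 ?cmod_ge0// mulr_ge0.
have c0 : 0 < eps / 2 / (cmod u * (M * Y) + 1) by apply: divr_gt0 => //; exact: divr_gt0.
near=> d; rewrite subr0 sub0r normrN ger0_norm ?cmod_ge0//.
apply: le_lt_trans (est _ Y d (ltW e0) Y0 _ qY) _; first by near: d; exact: nbhs_right_gt.
rewrite [X in _ < X](_ : eps = eps / 2 + eps / 2); last by field.
apply: ltr_leD.
  apply: (@lt_trans _ _ (d * (cmod u * (M * Y) + 1))).
    rewrite ltr_pM2l ?ltrDl//; near: d; exact: nbhs_right_gt.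
  rewrite -ltr_pdivlMr//; near: d; exact: (nbhs_right_lt c0).
have U0 : 0 < cmod u + 1 by rewrite ltr_wpDl// cmod_ge0.
rewrite (_ : cmod u * _ = eps / 2 * (cmod u / (cmod u + 1))); last first.
  by field; rewrite !gt_eqF.
by rewrite ger_pMr ?divr_gt0// ler_pdivrMr// mul1r lerDl.
Unshelve. all: by end_near. Qed.

Lemma expN_inv v phi :
  (fun t : R => cexp (- (- v * t%:C)) * (cexp (- (v * t%:C)) * phi t)) =1 phi.
Proof. by move=> t; rewrite mulrA -cexpD mulNr opprK subrr cexp0 mul1r. Qed.

(** Replaces a conditionally convergent Laplace integral at [u] by
absolutely convergent ones.  The partial integrals [P] are bounded, being
locally bounded with a limit at infinity, and [phi] is recovered from them through
[I phi = E P - u I (E P)] with [E t = exp (u t)], which follows from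
[E * phi = E P] and Fubini.  Transforming gives the identity between [I phi]
and [P]; the limit is then the Abelian theorem applied to [P] minus its
limit. *)
Lemma laplace_continuation phi u : 0 < Re u -> laplace_exists phi u ->
  let P t := laplace_partial phi u t in
  [/\ locint phi,
     (forall v, Re u < Re v -> lapint (prim phi) v /\
        v * Lap (prim phi) v = (v - u) * Lap P (v - u)),
     ccv (0 : R)^'+ (fun d : R => (u + d%:C * u) * Lap (prim phi) (u + d%:C * u)) (laplace phi u) &
     @cmeas R _ R `[0, +oo[ P /\ exists M, forall t, 0 <= t -> cmod (P t) <= M].
Proof.
move=> u0 [iT /ccvg_ccv cP] P; have un := Re_gt0_neq0 u0.
pose E (t : R) := cexp (u * t%:C).
have EN t : E t = cexp (- (- u * t%:C)) by rewrite /E mulNr opprK.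
have Ederiv (t : R) : cderiv (fun x => E x / u) t (E t).
  apply: cderiv_eq (cderivM (cderiv_cexp (cderivZ u (cderiv_id t))) (cderiv_cst u^-1 t)) _.
  by rewrite /E; field.
have Econt (t : R) : ccont E t.
  exact: cderiv_cont (cderiv_cexp (cderivZ u (cderiv_id t))).
have lE : locint E.
  move=> X; case: (leP 0 X) => X0.
    by have [] := cFTC X0 (fun t _ => Ederiv t) (fun t _ => Econt t).
  by rewrite set_itv_ge ?bnd_simp -?ltNge//; split; exact: integrable_set0.
have iT' (X : R) : cintegrable `[0, X] (fun t => cexp (- (u * t%:C)) * phi t).
  case: (ltP 0 X) => [/iT//|X0].
  apply: (@cintegrableS _ _ `[0, 1]) (iT _ ltr01) => // t /=; rewrite !in_itv/=.
  by move=> /andP[-> tX]; rewrite (le_trans tX)// (le_trans X0).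
have lphi : locint phi.
  move=> X; apply: (@eq_cintegrable _ _ (fun t => E t * (cexp (- (u * t%:C)) * phi t))) => //.
    by move=> t _; rewrite EN (expN_inv u phi).
  apply: (@cintegrable_bndM _ _ _ _ (expR (`|Re u| * `|X|))) => //.
    by apply: eq_cmeas (cmeas_expN (- u) _) => t _; rewrite EN.
  move=> t /=; rewrite in_itv/= => /andP[t0 tX]; rewrite EN cmod_expN ler_expR !cReImE mulNr opprK.
  apply: le_trans (ler_norm _) _; rewrite normrM ler_wpM2l// ger0_norm//.
  exact: le_trans tX (ler_norm _).
have convE x : conv E phi x = E x * P x.
  rewrite /P /laplace_partial -cintegralZ//; apply: eq_cintegral => t _.
  by rewrite mulrA -cexpD; congr (cexp _ * _); rewrite rmorphB/=; ring.
have primE (x : R) : 0 <= x -> prim E x = (E x - 1) / u.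
  move=> x0; have [_] := cFTC x0 (fun t _ => Ederiv t) (fun t _ => Econt t).
  by rewrite /prim => ->; rewrite {2}/E mulr0 cexp0; field.
have lc : locint (fun x => E x * P x).
  by move=> X; rewrite -(funext convE); exact: conv_cintegrable.
have iabE (x : R) : cintegrable `[0, x] (fun t => E (x - t) * phi t).
  apply: (@eq_cintegrable _ _ (fun t => E x * (cexp (- (u * t%:C)) * phi t))) => //.
    by move=> t _; rewrite mulrA -cexpD; congr (cexp _ * _); rewrite rmorphB/=; ring.
  exact: cintegrableZ.
(* Integrate [exp (u (x - t)) phi t] over the triangle, using [I E = (E - 1) / u]. *)
have key (x : R) : prim phi x = E x * P x - u * prim (fun x => E x * P x) x.
  rewrite -(funext convE) (prim_conv (lE x) (lphi x)).
  have -> : conv (prim E) phi x = cintegral `[0, x] (fun t => u^-1 * (E (x - t) * phi t - phi t)).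
    apply: eq_cintegral => t; rewrite inE/= in_itv/= => /andP[t0 tx].
    by rewrite primE ?subr_ge0//; field.
  rewrite cintegralZ//; last by apply: cintegrableB => //; exact: iabE.
  rewrite cintegralB//.
  rewrite -/(conv E phi x) convE mulrA mulfV// mul1r opprB addrCA subrr addr0.
  by [].
have mP : @cmeas R _ R `[0, +oo[ P.
  apply: cmeas_0oo => X.
  have h := cmeasM (cmeas_expN u `[0, X]) (cintegrable_meas (lc X)).
  by apply: eq_cmeas h => t _; rewrite /E mulrA -cexpD addNr cexp0 mul1r.
have [M PM] : exists M, forall t, 0 <= t -> cmod (P t) <= M.
  apply: (ccv_bounded cP) => X X0.
  exists (Rintegral lam `[0, X] (fun t => cmod (cexp (- (u * t%:C)) * phi t))) => t /andP[t0 tX].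
  have sub : `[0, t]%classic `<=` (`[0, X]%classic : set R).
    by move=> s /=; rewrite !in_itv/= => /andP[-> /le_trans]; apply.
  apply: le_trans (cmod_cintegral (measurable_itv _) (iT' t)) _.
  have iC := cintegrable_cmod (measurable_itv _) (iT' X).
  rewrite /Rintegral; apply: fine_le.
  - by apply: integrable_fin_num => //; apply: integrableS iC.
  - exact: integrable_fin_num.
  - apply: ge0_subset_integral => //.
      exact: measurable_int iC.
    by move=> s _; rewrite lee_fin cmod_ge0.
have M0 : 0 <= M by apply: le_trans (PM 0 (lexx _)); exact: cmod_ge0.
have lapE v (t : R) : cexp (- (v * t%:C)) * (E t * P t) = cexp (- ((v - u) * t%:C)) * P t.
  by rewrite mulrA -cexpD; congr (cexp _ * _); ring.
have lp v : Re u < Re v -> [/\ lapint (fun x => E x * P x) v, lapint P (v - u) &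
    Lap (fun x => E x * P x) v = Lap P (v - u)].
  move=> uv; have [h _] : lapint P (v - u) /\ cmod (Lap P (v - u)) <= M / (Re (v - u) - 0).
    apply: lap_growth => //; last by rewrite cReB subr_gt0.
    by move=> t t0; rewrite mul0r expR0 mulr1 PM.
  by split => //; rewrite /lapint /Lap (funext (lapE v)).
have main v : Re u < Re v -> lapint (prim phi) v /\
        v * Lap (prim phi) v = (v - u) * Lap P (v - u).
  move=> uv; have v0 := lt_trans u0 uv; have vn := Re_gt0_neq0 v0.
  have [i1 i2 E12] := lp v uv.
  have [i3 E3] := lap_prim v0 i1; have [i4 E4] := lapintZ (- u) i3.
  have [i5 E5] := lapintD i1 i4.
  rewrite (_ : prim phi = fun t => E t * P t + - u * prim (fun x => E x * P x) t); last first.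
    by apply/funext => t; rewrite key mulNr.
  split; first exact: i5.
  by rewrite E5 E4 E3 E12; field.
split; [exact: lphi|exact: main| |by split; [exact: mP|exists M]].
have q0 : ccv +oo%R (fun t => P t - laplace phi u) 0.
  by rewrite -[X in ccv _ _ X](subrr (laplace phi u)); apply: ccvB => //; exact: ccv_cst.
have mq := cmeasB mP (@cmeas_cst R _ R `[0, +oo[ (laplace phi u)).
have qM t : 0 <= t -> cmod (P t - laplace phi u) <= M + cmod (laplace phi u).
  by move=> t0; apply: le_trans (cmodB _ _) _; rewrite lerD2r PM.
have FF : Filter (0 : R)^'+ by exact: at_right_proper_filter.
have := @ccvD R R (0 : R)^'+ FF _ _ _ _ (@ccv_cst R R (0 : R)^'+ FF (laplace phi u)) (abelian_theorem u0 mq qM q0).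
rewrite addr0 => h.
have H : \forall d \near (0 : R)^'+, laplace phi u + d%:C * u * Lap (fun t => P t - laplace phi u) (d%:C * u)
    = (u + d%:C * u) * Lap (prim phi) (u + d%:C * u); last exact: (@near_ccv _ _ _ FF _ _ _ H h).
near=> d.
have d0 : 0 < d by near: d; exact: nbhs_right_gt.
have s0 : 0 < Re (d%:C * u) by rewrite !cReImE/= mul0r subr0 mulr_gt0.
have uv : Re u < Re (u + d%:C * u) by rewrite cReD ltrDl.
have [_ ->] := main _ uv; have [_ + _] := lp _ uv; rewrite addrAC subrr add0r => iP.
have [iC EC] := lapintZ (laplace phi u) (Lap1 s0).1.
have [i1 E1] := lapintZ (-1) iC; have [i2 E2] := lapintD iP i1.
rewrite (_ : (fun t => P t - laplace phi u) = fun t => P t + -1 * (laplace phi u * 1)); last first.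
  by apply/funext => t; rewrite mulr1 mulN1r.
rewrite E2 E1 EC (Lap1 s0).2; have := Re_gt0_neq0 s0; move: (d%:C * u) => w wn.
by field.
Unshelve. all: by end_near. Qed.

End laplace_transform.

(** * Complex series; the exponential and binomial series *)

Section csequences.
Context {R : realType}.
Local Notation Re := complex.Re.
Local Notation Im := complex.Im.
Implicit Types (a b : nat -> R[i]) (c z w l : R[i]).

Lemma ccv_bound {T : Type} (F : set_system T) {FF : ProperFilter F} (g : T -> R[i]) l (B : R) :
  ccv F g l -> (\forall x \near F, cmod (g x) <= B) -> cmod l <= B.
Proof. by move=> /ccv_cmod gl gB; exact: cvgr_to_le gl gB. Qed.

Lemma ccv_sum {T : Type} (F : set_system T) {FF : Filter F} (n : nat) (g : nat -> T -> R[i]) (l_ : nat -> R[i]) :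
  (forall i, (i < n)%N -> ccv F (g i) (l_ i)) ->
  ccv F (fun x => \sum_(i < n) g i x) (\sum_(i < n) l_ i).
Proof.
elim: n => [|n IH] gl.
  rewrite big_ord0 (_ : (fun x => _) = fun=> 0); first exact: ccv_cst.
  by apply/funext => x; rewrite big_ord0.
rewrite big_ord_recr/=; apply: eq_ccv (ccvD (IH _) (gl n _)) => //.
- by move=> x; rewrite big_ord_recr.
- by move=> i im; apply: gl; rewrite ltnW.
Qed.

Lemma ccvn_cst c : ccv \oo (fun=> c) c.
Proof. exact: ccv_cst. Qed.
Lemma ccvnZ c (g : nat -> R[i]) l : ccv \oo g l -> ccv \oo (fun n => c * g n) (c * l).
Proof. by move=> gl; apply: ccvM gl; exact: ccv_cst. Qed.
Lemma ccvnD (g h : nat -> R[i]) l w : ccv \oo g l -> ccv \oo h w -> ccv \oo (fun n => g n + h n) (l + w).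
Proof. exact: ccvD. Qed.
Lemma ccvn_shift1 (g : nat -> R[i]) l : ccv \oo g l -> ccv \oo (fun n => g n.+1) l.
Proof.
move=> [h1 h2]; split.
  by move: h1; rewrite -cvg_shiftS.
by move: h2; rewrite -cvg_shiftS.
Qed.
Lemma ccvn_near (g h : nat -> R[i]) l (N : nat) : (forall n, (N <= n)%N -> g n = h n) ->
  ccv \oo g l -> ccv \oo h l.
Proof. by move=> gh; apply: near_ccv; exists N. Qed.

Lemma abs_rseries (u : nat -> R) (M : R) : (forall n, \sum_(j < n) `|u j| <= M) ->
  cvgn (fun n => \sum_(j < n) u j).
Proof.
move=> uM; have -> : (fun n => \sum_(j < n) u j) = series u.
  by apply/funext => n; rewrite /series /= big_mkord.
apply: normed_cvg; apply: nondecreasing_is_cvgn.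
  by apply: nondecreasing_series => n _ _ /=; exact: normr_ge0.
exists M => _ [n _ <-]; have := uM n; by rewrite -(big_mkord xpredT (fun j => `|u j|)).
Qed.

Lemma cvgr_sum {T : Type} (F : set_system T) {FF : Filter F} (n : nat) (g : nat -> T -> R) (l_ : nat -> R) :
  (forall i, (i < n)%N -> g i x @[x --> F] --> l_ i) ->
  \sum_(i < n) g i x @[x --> F] --> \sum_(i < n) l_ i.
Proof.
move=> gl; have [] := @ccv_sum _ F _ n (fun i x => (g i x)%:C) (fun i => (l_ i)%:C) (fun i h => ccvC (gl i h)).
rewrite cRe_sum/=; under eq_fun do rewrite cRe_sum/=; done.
Qed.

Lemma abs_series a (M : R) : (forall n, \sum_(j < n) cmod (a j) <= M) ->
  exists l, ccv \oo (fun n => \sum_(j < n) a j) l /\ cmod l <= M.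
Proof.
move=> aM.
have r1 : cvgn (fun n => \sum_(j < n) Re (a j)).
  by apply: (@abs_rseries (fun j => Re (a j)) M) => n; apply: le_trans (aM n); apply: ler_sum => i _; exact: Re_le_cmod.
have r2 : cvgn (fun n => \sum_(j < n) Im (a j)).
  by apply: (@abs_rseries (fun j => Im (a j)) M) => n; apply: le_trans (aM n); apply: ler_sum => i _; exact: Im_le_cmod.
have cl : ccv \oo (fun n => \sum_(j < n) a j)
   (limn (fun n => \sum_(j < n) Re (a j)) +i* limn (fun n => \sum_(j < n) Im (a j))).
  split; [apply: cvg_trans r1|apply: cvg_trans r2]; apply: near_eq_cvg; near=> n.
    by rewrite cRe_sum.
  by rewrite cIm_sum.
eexists; split; first exact: cl.
apply: (ccv_bound cl); near=> n; apply: le_trans (cmod_sum _ _ _) (aM n).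
Unshelve. all: by end_near. Qed.

(** The only uniformity used when a double series is summed in the
other order. *)
Lemma rseries_tail (u : nat -> R) (M e : R) : (forall n, 0 <= u n) ->
  (forall n, \sum_(j < n) u j <= M) -> 0 < e ->
  exists N, forall n, \sum_(j < n) u (N + j)%N <= e.
Proof.
move=> u0 uM e0.
have /cvg_ex[l /cvgrPdist_lt ul] : cvgn (fun n => \sum_(j < n) u j).
  by apply: (@abs_rseries _ M) => n; under eq_bigr do rewrite ger0_norm//.
have [N _ hN] := ul _ (divr_gt0 e0 (ltr0n _ 2)); exists N => n.
have := hN N (leqnn N); have := hN (N + n)%N (leq_addr _ _); rewrite /= big_split_ord/=.
move: (\sum_(i < N) _) (\sum_(i < n) _) => x y; rewrite !ltr_norml => /andP[h1 h2] /andP[h3 h4].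
lra.
Qed.

(** Fubini for absolutely convergent double series of complex numbers:
row sums [r_], column sums [c_]. *)
Lemma double_series (b : nat -> nat -> R[i]) (M_ : nat -> R) (M : R)
    (r_ c_ : nat -> R[i]) (S : R[i]) :
  (forall n J, \sum_(j < J) cmod (b n j) <= M_ n) -> (forall N, \sum_(n < N) M_ n <= M) ->
  (forall n, ccv \oo (fun J => \sum_(j < J) b n j) (r_ n)) ->
  (forall j, ccv \oo (fun N => \sum_(n < N) b n j) (c_ j)) ->
  ccv \oo (fun N => \sum_(n < N) r_ n) S ->
  (forall J, \sum_(j < J) cmod (c_ j) <= M) /\ ccv \oo (fun J => \sum_(j < J) c_ j) S.
Proof.
move=> bM MM br bc rS.
have M0 n : 0 <= M_ n by have := bM n 0%N; rewrite big_ord0.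
have rM n : cmod (r_ n) <= M_ n.
  by apply: (ccv_bound (br n)); near=> J; apply: le_trans (cmod_sum _ _ _) (bM n J).
have exch N0 N J : \sum_(j < J) \sum_(n < N) cmod (b (N0 + n)%N j) <= \sum_(n < N) M_ (N0 + n)%N.
  by rewrite exchange_big/=; apply: ler_sum => n _; exact: bM.
split=> [J|].
  have : \sum_(j < J) cmod (\sum_(n < N) b n j) @[N --> \oo] --> \sum_(j < J) cmod (c_ j).
    by apply: (@cvgr_sum _ \oo _ J (fun j N => cmod (\sum_(n < N) b n j)) (fun j => cmod (c_ j))) => j _; exact: ccv_cmod (bc j).
  move=> /cvgr_to_le; apply; near=> N; apply: le_trans (MM N).
  apply: le_trans (exch 0%N N J); apply: ler_sum => j _; exact: cmod_sum.
apply/ccvP/cvgrPdist_le => e e0; have e3 : 0 < e / 3 by exact: divr_gt0.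
have [N hN] := rseries_tail M0 MM e3.
have tS : cmod (S - \sum_(n < N) r_ n) <= e / 3.
  have h : ccv \oo (fun n => \sum_(j < N + n) r_ j - \sum_(j < N) r_ j) (S - \sum_(j < N) r_ j).
    apply: ccvB; last exact: ccv_cst.
    have [h1 h2] := rS; split.
      by apply: cvg_comp h1; exact: cvg_addnl.
    by apply: cvg_comp h2; exact: cvg_addnl.
  apply: (ccv_bound h); near=> n; rewrite big_split_ord/= addrAC subrr add0r.
  by apply: le_trans (cmod_sum _ _ _) (le_trans _ (hN n)); apply: ler_sum => i _; exact: rM.
have tc J : cmod (\sum_(j < J) c_ j - \sum_(j < J) \sum_(n < N) b n j) <= e / 3.
  have h : ccv \oo (fun n => \sum_(j < J) \sum_(i < N + n) b i j - \sum_(j < J) \sum_(n < N) b n j)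
     (\sum_(j < J) c_ j - \sum_(j < J) \sum_(n < N) b n j).
    apply: ccvB; last exact: ccv_cst.
    apply: (@ccv_sum _ _ _ J (fun j n => \sum_(i < N + n) b i j)) => j _.
    have [h1 h2] := bc j; split.
      by apply: cvg_comp h1; exact: cvg_addnl.
    by apply: cvg_comp h2; exact: cvg_addnl.
  apply: (ccv_bound h); near=> n; rewrite -sumrB.
  under eq_bigr do rewrite big_split_ord/= addrAC subrr add0r.
  apply: le_trans (cmod_sum _ _ _) (le_trans _ (hN n)); apply: le_trans (exch N n J).
  by apply: ler_sum => j _; exact: cmod_sum.
have hN' : ccv \oo (fun J => \sum_(n < N) \sum_(j < J) b n j) (\sum_(n < N) r_ n).
  exact: (@ccv_sum _ \oo _ N (fun n J => \sum_(j < J) b n j) r_ (fun n _ => br n)).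
move: hN' => /ccvP/cvgrPdist_le/(_ _ e3); apply: filterS => J.
rewrite !sub0r !normrN !(ger0_norm (cmod_ge0 _)) exchange_big/= => h.
rewrite (_ : _ - S = (\sum_(j < J) c_ j - \sum_(j < J) \sum_(n < N) b n j)
  + ((\sum_(j < J) \sum_(n < N) b n j - \sum_(n < N) r_ n) - (S - \sum_(n < N) r_ n))); last by ring.
apply: le_trans (cmodD _ _) _; apply: le_trans (lerD (tc J) (cmodB _ _)) _.
have := tS; have := h; lra.
Unshelve. all: by end_near. Qed.

Lemma geo_bound (t : R) n : 0 <= t < 1 -> \sum_(j < n) t ^+ j <= (1 - t)^-1.
Proof.
move=> /andP[t0 t1]; have t10 : 0 < 1 - t by rewrite subr_gt0.
rewrite -[leRHS]mul1r ler_pdivlMr//.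
move: (subrX1 t n); set S := \sum_(i < n) _ => h.
have := exprn_ge0 n t0; lra.
Qed.

Lemma pseries_cvg (u : nat -> R) (C th x : R) : 0 <= C -> 0 <= th ->
  (forall n, `|u n| <= C * th ^+ n) -> th * `|x| < 1 -> cvgn (pseries u x).
Proof.
move=> C0 th0 uC thx; have -> : pseries u x = (fun n => \sum_(j < n) (u j * x ^+ j)).
  by apply/funext => n; rewrite /pseries /series /= big_mkord.
apply: (@abs_rseries (fun j => u j * x ^+ j) (C * (1 - th * `|x|)^-1)) => n.
apply: (@le_trans _ _ (\sum_(j < n) C * (th * `|x|) ^+ j)).
  apply: ler_sum => j _; rewrite normrM normrX exprMn mulrA ler_wpM2r ?exprn_ge0//.
rewrite -mulr_sumr ler_wpM2l// geo_bound// thx mulr_ge0//.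
Qed.

Lemma natr_geo_bound (q : R) n : 0 <= q < 1 -> n.+1%:R * q ^+ n <= (1 - q)^-1.
Proof.
move=> q01; apply: le_trans (geo_bound n.+1 q01); have /andP[q0 /ltW q1] := q01.
rewrite mulr_natl -[X in _ *+ X](card_ord n.+1) -sumr_const; apply: ler_sum => j _.
by rewrite ler_wiXn2l// -ltnS.
Qed.

(** The factor [n] is absorbed by any increase of the ratio [th]. *)
Lemma diffs_bound (u : nat -> R) (C th th' : R) : 0 <= C -> 0 <= th ->
  (forall n, `|u n| <= C * th ^+ n) -> th < th' ->
  exists2 C', 0 <= C' & forall n, `|pseries_diffs u n| <= C' * th' ^+ n.
Proof.
move=> C0 th0 uC lt; have th'0 : 0 < th' by exact: le_lt_trans lt.
have q01 : 0 <= th / th' < 1 by rewrite ltr_pdivrMr// mul1r lt divr_ge0// ltW.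
exists (C * th * (1 - th / th')^-1) => [|n].
  by rewrite mulr_ge0// ?mulr_ge0// invr_ge0 subr_ge0; case/andP : q01 => _ /ltW.
rewrite /pseries_diffs normrM normr_nat.
apply: le_trans (ler_wpM2l (ler0n _ _) (uC n.+1)) _.
rewrite (_ : n.+1%:R * (C * _) = C * th * (n.+1%:R * (th / th') ^+ n) * th' ^+ n); last first.
  by rewrite exprS expr_div_n; field; rewrite expf_neq0// gt_eqF.
by rewrite ler_wpM2r ?exprn_ge0 ?(ltW th'0)// ler_wpM2l ?mulr_ge0// natr_geo_bound.
Qed.

Lemma pseries_deriv (u : nat -> R) (C th t : R) : 0 <= C -> 0 <= th ->
  (forall n, `|u n| <= C * th ^+ n) -> th * `|t| < 1 ->
  [/\ cvgn (pseries u t), cvgn (pseries (pseries_diffs u) t) &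
   is_derive t (1 : R) (fun x => limn (pseries u x)) (limn (pseries (pseries_diffs u) t))].
Proof.
move=> C0 th0 uC tht.
have [K tK thK] : exists2 K, `|t| < K & th * K < 1.
  exists (`|t| + (1 - th * `|t|) / (2 * (th + 1))); first by rewrite ltrDl divr_gt0// ?subr_gt0// mulr_gt0// ltr_wpDl.
  rewrite mulrDr -ltrBrDl mulrCA gtr_pMr ?subr_gt0// ltr_pdivrMr ?mulr_gt0 ?ltr_wpDl//; lra.
have K0 : 0 < K by exact: le_lt_trans tK.
pose d := (1 - th * K) / (4 * K); have d0 : 0 < d by rewrite divr_gt0 ?subr_gt0// mulr_gt0.
have dK : d * K = (1 - th * K) / 4 by rewrite /d; field; rewrite gt_eqF.
have thd0 : 0 <= th + d by rewrite addr_ge0// ltW.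
have [C1 C10 uC1] := diffs_bound C0 th0 uC (ltr_pwDr d0 (lexx th)).
have [C2 C20 uC2] := diffs_bound C10 thd0 uC1 (ltr_pwDr d0 (lexx (th + d))).
have [h1 h2] : (th + d) * K < 1 /\ (th + d + d) * K < 1.
  by rewrite !mulrDl dK; split; lra.
have nK : `|K| = K by rewrite gtr0_norm.
have tK' : `|t| < `|K| by rewrite nK.
split.
- exact: (pseries_cvg C0 th0 uC).
- apply: (pseries_cvg C10 thd0 uC1); apply: le_lt_trans h1; rewrite ler_wpM2l// ltW//.
- apply: (@pseries_snd_diffs _ _ K) => //.
  + by apply: (pseries_cvg C0 th0 uC); rewrite nK.
  + by apply: (pseries_cvg C10 thd0 uC1); rewrite nK.
  + by apply: (pseries_cvg C20 _ uC2); rewrite ?nK// addr_ge0// ltW.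
Qed.

(** Termwise differentiation along the real axis, componentwise from
the real case. *)
Lemma cpseries_deriv a (C th t : R) : 0 <= C -> 0 <= th -> (forall n, cmod (a n) <= C * th ^+ n) ->
  th * `|t| < 1 ->
  let F t := clim \oo (fun n => \sum_(j < n) a j * t%:C ^+ j) in
  let G t := clim \oo (fun n => \sum_(j < n) j.+1%:R * a j.+1 * t%:C ^+ j) in
  [/\ ccv \oo (fun n => \sum_(j < n) a j * t%:C ^+ j) (F t),
   ccv \oo (fun n => \sum_(j < n) j.+1%:R * a j.+1 * t%:C ^+ j) (G t) & cderiv F t (G t)].
Proof.
move=> C0 th0 aC tht F G.
have RX (x : R) j : x%:C ^+ j = (x ^+ j)%:C :> R[i] by rewrite rmorphXn.
have e1 x n : Re (\sum_(j < n) a j * x%:C ^+ j) = pseries (fun j => Re (a j)) x n.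
  by rewrite cRe_sum /pseries /series /= big_mkord; apply: eq_bigr => j _; rewrite RX !cReImE mulr0 subr0.
have e2 x n : Im (\sum_(j < n) a j * x%:C ^+ j) = pseries (fun j => Im (a j)) x n.
  by rewrite cIm_sum /pseries /series /= big_mkord; apply: eq_bigr => j _; rewrite RX !cReImE mulr0 add0r.
have e3 x n : Re (\sum_(j < n) j.+1%:R * a j.+1 * x%:C ^+ j) = pseries (pseries_diffs (fun j => Re (a j))) x n.
  rewrite cRe_sum /pseries /series /= big_mkord; apply: eq_bigr => j _.
  by rewrite RX cReM cReC cImC mulr0 subr0 cReM cRe_nat cIm_nat mul0r subr0.
have e4 x n : Im (\sum_(j < n) j.+1%:R * a j.+1 * x%:C ^+ j) = pseries (pseries_diffs (fun j => Im (a j))) x n.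
  rewrite cIm_sum /pseries /series /= big_mkord; apply: eq_bigr => j _.
  by rewrite RX cImM cReC cImC mulr0 add0r cImM cRe_nat cIm_nat mul0r addr0.
have [r1 r2 r3] := pseries_deriv C0 th0 (fun n => le_trans (Re_le_cmod _) (aC n)) tht.
have [i1 i2 i3] := pseries_deriv C0 th0 (fun n => le_trans (Im_le_cmod _) (aC n)) tht.
split.
- by apply: ccvg_ccv; split; [rewrite (funext (e1 t))|rewrite (funext (e2 t))].
- by apply: ccvg_ccv; split; [rewrite (funext (e3 t))|rewrite (funext (e4 t))].
- split; rewrite /F /G /clim /=.
    by under eq_fun do rewrite (funext (e1 _)); rewrite (funext (e3 t)).
  by under eq_fun do rewrite (funext (e2 _)); rewrite (funext (e4 t)).
Qed.

(** The product of [G] with [exp (- L)] has zero derivative. *)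
Lemma ode_unique (G l L : R -> R[i]) :
  (forall t : R, 0 <= t <= 1 -> cderiv G t (l t * G t)) ->
  (forall t : R, 0 <= t <= 1 -> cderiv L t (l t)) -> G 1 = G 0 * cexp (L 1 - L 0).
Proof.
move=> dG dL.
have := @cderiv0_cst R (fun t => G t * cexp (- L t)) 0 1 ler01.
have h t : 0 <= t <= 1 -> cderiv (fun t => G t * cexp (- L t)) t 0.
  move=> t01; apply: cderiv_eq (cderivM (dG t t01) (cderiv_cexp (cderivN (dL t t01)))) _.
  by ring.
move=> /(_ h) E; apply: (mulIf (cexp_neq0 (- L 1))); rewrite -E -mulrA -cexpD.
by congr (_ * cexp _); ring.
Qed.

Lemma ratio_bound (u : nat -> R) (th : R) (n0 : nat) : (forall n, 0 <= u n) -> 0 < th ->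
  (forall n, (n0 <= n)%N -> u n.+1 <= th * u n) ->
  exists2 C, 0 <= C & forall n, u n <= C * th ^+ n.
Proof.
move=> u0 th0 uS; exists (\sum_(j < n0.+1) u j / th ^+ j).
  by apply: sumr_ge0 => j _; rewrite divr_ge0// exprn_ge0// ltW.
have small n : (n <= n0)%N -> u n <= (\sum_(j < n0.+1) u j / th ^+ j) * th ^+ n.
  move=> nn0; rewrite -ler_pdivrMr ?exprn_gt0// (bigD1 (Ordinal (nn0 : (n < n0.+1)%N)))//= lerDl.
  by apply: sumr_ge0 => j _; rewrite divr_ge0// exprn_ge0// ltW.
elim=> [|n IH]; first exact: small.
case: (leqP n.+1 n0) => [|n0n]; first exact: small.
apply: le_trans (uS n n0n) _; rewrite exprS mulrCA ler_wpM2l// ltW//.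
Qed.

(** Sums a power series at 1 from the linear differential equation that it
satisfies on [[0, 1]].  Both the exponential series and the binomial series
are instances, which avoids the holomorphic theory: for a complex argument [z]
the variable is moved into the coefficients [a n * z ^ n]. *)
Lemma pow_ode a (C th : R) (l L : R -> R[i]) : 0 <= C -> 0 <= th < 1 ->
  (forall n, cmod (a n) <= C * th ^+ n) ->
  (forall (t : R) (F G : R[i]), 0 <= t <= 1 ->
     ccv \oo (fun n => \sum_(j < n) a j * t%:C ^+ j) F ->
     ccv \oo (fun n => \sum_(j < n) j.+1%:R * a j.+1 * t%:C ^+ j) G -> G = l t * F) ->
  (forall t : R, 0 <= t <= 1 -> cderiv L t (l t)) ->
  ccv \oo (fun n => \sum_(j < n) a j) (a 0%N * cexp (L 1 - L 0)).
Proof.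
move=> C0 /andP[th0 th1] aC ode dL.
pose F (t : R) := clim \oo (fun n => \sum_(j < n) a j * t%:C ^+ j).
have tht (t : R) : 0 <= t <= 1 -> th * `|t| < 1.
  by move=> /andP[t0 t1]; rewrite ger0_norm//; apply: le_lt_trans th1; exact: ler_piMr.
have E1 : F 1 = F 0 * cexp (L 1 - L 0).
  apply: (@ode_unique F l L) => // t t01.
  have [h1 h2 h3] := cpseries_deriv C0 th0 aC (tht _ t01).
  by apply: cderiv_eq h3 _; exact: ode h1 h2.
have F0 : F 0 = a 0%N.
  apply: ccv_clim; apply: (@ccvn_near (fun=> a 0%N) _ _ 1 _ (ccvn_cst _)) => -[//|n] _.
  rewrite big_ord_recl/= expr0 mulr1 big1 ?addr0// => j _.
  by rewrite /bump/= add1n expr0n/= mulr0.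
rewrite -F0 -E1; have [h _ _] := cpseries_deriv C0 th0 aC (tht 1 (introT andP (conj ler01 (lexx _)))).
apply: eq_ccv h => n; apply: eq_bigr => j _; by rewrite expr1n mulr1.
Qed.

Lemma exp_coeff_le (x : R) n : 0 <= x -> x ^+ n / n`!%:R <= expR x.
Proof.
move=> x0; rewrite /expR; apply: (@le_trans _ _ (series (exp_coeff x) n.+1)).
  rewrite /series /= big_nat_recr//= lerDr; apply: sumr_ge0 => j _; exact: exp_coeff_ge0.
apply: nondecreasing_cvgn_le; last exact: is_cvg_series_exp_coeff.
by apply: nondecreasing_series => j _ _; exact: exp_coeff_ge0.
Qed.

Lemma cexp_series z : ccv \oo (fun n => \sum_(j < n) z ^+ j / j`!%:R) (cexp z).
Proof.
have := @pow_ode (fun j => z ^+ j / j`!%:R) (expR (2 * cmod z)) 2^-1 (fun=> z) (fun t => z * t%:C).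
rewrite expr0 fact0 divr1 mul1r mulr1 mulr0 subr0; apply.
- exact: expR_ge0.
- by apply/andP; split; lra.
- move=> n; rewrite cmodM cmodV cmodX cmod_nat exprVn.
  have := @exp_coeff_le (2 * cmod z) n; rewrite mulr_ge0 ?cmod_ge0// => /(_ isT).
  rewrite exprMn -mulrA mulrC -ler_pdivlMr// exprn_gt0//.
- move=> t F G _ hF hG; apply: ccv_unique hG _.
  have := ccvnZ z hF; apply: eq_ccv => n; rewrite mulr_sumr; apply: eq_bigr => j _.
  rewrite exprS factS natrM; field.
  rewrite addrC natr1 !pnatr_eq0 andbT -lt0n; exact: fact_gt0.
- by move=> t _; apply: cderiv_eq (cderivZ z (cderiv_id t)) _; rewrite mulr1.
Qed.

(** The Pochhammer symbol. *)
Definition risefac c n := \prod_(i < n) (c + i%:R).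

Lemma risefacS c n : risefac c n.+1 = risefac c n * (c + n%:R).
Proof. by rewrite /risefac big_ord_recr. Qed.

Lemma cmod_risefac c n : cmod (risefac c n) <= \prod_(i < n) (cmod c + i%:R).
Proof.
rewrite /risefac cmod_prod; apply: ler_prod => i _; rewrite cmod_ge0/=.
by apply: le_trans (cmodD _ _) _; rewrite cmod_nat.
Qed.

Lemma risefac_real (x : R) n : risefac x%:C n = (\prod_(i < n) (x + i%:R))%:C.
Proof. by rewrite rmorph_prod; apply: eq_bigr => i _; rewrite rmorphD/= natC. Qed.

(** The ratio of consecutive terms tends to [y < 1], so it is eventually
below the midpoint [(1 + y) / 2]. *)
Lemma binomial_bound (B y : R) : 0 <= B -> 0 <= y < 1 ->
  exists C th, [/\ 0 <= C, 0 <= th < 1 &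
    forall n, (\prod_(i < n) (B + i%:R)) / n`!%:R * y ^+ n <= C * th ^+ n].
Proof.
(* Any ratio strictly between [y] and 1 would do. *)
move=> B0 /andP[y0 y1]; pose th := (1 + y) / 2.
have yth : y < th by rewrite /th; lra.
have p0 n : 0 <= \prod_(i < n) (B + i%:R) :> R by apply: prodr_ge0 => i _; rewrite addr_ge0.
have th0 : 0 < th by rewrite /th; lra.
have [|//||C C0 hC] := @ratio_bound (fun n => (\prod_(i < n) (B + i%:R)) / n`!%:R * y ^+ n) th
    (Num.truncn (B * y / (th - y))).+1.
- by move=> n; rewrite mulr_ge0 ?exprn_ge0// divr_ge0.
- move=> n hn; rewrite big_ord_recr/= exprS factS natrM.
  have f0 : (n`!%:R : R) != 0 by rewrite pnatr_eq0 -lt0n fact_gt0.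
  have n0 : (n.+1%:R : R) != 0 by rewrite pnatr_eq0.
  rewrite (_ : _ * (y * _) = ((B + n%:R) * y / n.+1%:R) *
      ((\prod_(i < n) (B + i%:R)) / n`!%:R * y ^+ n)); last first.
    by move: f0 n0; move: (n`!%:R : R) (n.+1%:R : R) => a b f0 n0; field; rewrite f0 n0.
  apply: ler_wpM2r; first by rewrite mulr_ge0 ?exprn_ge0// divr_ge0.
  rewrite ler_pdivrMr//.
  have h : B * y <= n%:R * (th - y).
    rewrite -ler_pdivrMr ?subr_gt0//; apply: le_trans (ltW (truncnS_gt _)) _; by rewrite ler_nat.
  rewrite -natr1; have := th0; have := y0; move: h; rewrite mulrBr mulrDl mulrDr mulr1 [th * _]mulrC; lra.
- by exists C, th; split => //; rewrite (ltW th0)/= /th; lra.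
Qed.

(** The series [F] satisfies [(1 - t z) F' = c z F], and so does
[exp (- c log (1 - t z))]; the segment from 1 to [1 - z] stays in the right
half-plane, where the principal logarithm is differentiable. *)
Lemma binomial_series c z : cmod z < 1 ->
  ccv \oo (fun n => \sum_(j < n) risefac c j / j`!%:R * z ^+ j) (cpow (1 - z) (- c)).
Proof.
move=> z1.
have Re1 (t : R) : 0 <= t <= 1 -> 0 < Re (1 - t%:C * z).
  move=> /andP[t0 t1]; rewrite !cReImE/= mul0r subr0 subr_gt0; apply: le_lt_trans z1.
  apply: le_trans (ler_norm _) _; rewrite normrM (ger0_norm t0).
  by apply: le_trans (Re_le_cmod z); apply: ler_piMl.
have z01 : 0 <= cmod z < 1 by rewrite cmod_ge0.
have [C [th [C0 th01 bC]]] := binomial_bound (cmod_ge0 c) z01.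
have := @pow_ode (fun j => risefac c j / j`!%:R * z ^+ j) C th
  (fun t => c * z / (1 - t%:C * z)) (fun t => - c * clog (1 - t%:C * z)) C0 th01.
have -> : risefac c 0 / (0`!)%:R * z ^+ 0 = 1 by rewrite /risefac big_ord0 fact0 divr1 mulr1.
have -> : clog (1 - (0 : R)%:C * z) = 0 by rewrite mul0r subr0 (clogC ltr01) ln1.
have n1 : 1 - z != 0.
  by have := Re1 1; rewrite mul1r ler01 lexx => /(_ isT) /Re_gt0_neq0.
rewrite !mul1r mulr0 subr0 cpowE//; apply.
- move=> n; rewrite cmodM cmodX; apply: le_trans (bC n); apply: ler_wpM2r; first exact: exprn_ge0 (cmod_ge0 _).
  rewrite cmodM cmodV cmod_nat; apply: ler_wpM2r; [by rewrite invr_ge0|exact: cmod_risefac].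
- move=> t F G t01 hF hG; have tn := Re_gt0_neq0 (Re1 t t01).
  apply: (mulfI tn); rewrite mulrA [(1 - _) * (_ / _)]mulrC divfK//.
  have h1 := ccvnZ (c * z) hF; have h2 := ccvnZ (t%:C * z) hG.
  suff h3 : ccv \oo (fun n => \sum_(j < n.+1) j.+1%:R * (risefac c j.+1 / j.+1`!%:R * z ^+ j.+1) * t%:C ^+ j)
    (c * z * F + t%:C * z * G).
    have E : G = c * z * F + t%:C * z * G.
      by apply: ccv_unique h3; exact: ccvn_shift1 hG.
    by rewrite mulrBl mul1r {1}E addrK.
  have hF' : ccv \oo (fun n => c * z * \sum_(j < n.+1) risefac c j / j`!%:R * z ^+ j * t%:C ^+ j) (c * z * F).
    exact: ccvn_shift1 h1.
  have := ccvnD hF' h2; apply: eq_ccv => n.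
  rewrite big_ord_recl/= mulr_sumr; under eq_bigr do rewrite /bump/= add1n.
  rewrite mulrDr mulr_sumr -addrA -big_split/= [RHS]big_ord_recl/=; congr (_ + _).
    by rewrite risefacS /risefac big_ord0 !divr1 !expr0 expr1 !mulr1 !mul1r addr0.
  apply: eq_bigr => j _; rewrite /bump/= add1n (risefacS _ j.+1) !exprS (factS j.+1) natrM.
  have f0 : (j.+1`!%:R : R[i]) != 0 by rewrite pnatr_eq0 -lt0n fact_gt0.
  have n0 : (j.+2%:R : R[i]) != 0 by rewrite pnatr_eq0.
  have e2 : (j.+2%:R : R[i]) = j.+1%:R + 1 by rewrite natr1.
  move: f0 n0 e2; move: (j.+1`!%:R : R[i]) (j.+2%:R : R[i]) (j.+1%:R : R[i]) => p q r p0 q0 _.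
  by field; rewrite p0 q0.
- move=> t t01; have tn := Re_gt0_neq0 (Re1 t t01).
  have d1 := cderivD (cderiv_cst 1 t) (cderivN (cderivM (cderiv_id t) (cderiv_cst z t))).
  apply: cderiv_eq (cderivZ (- c) (cderiv_clog d1 (Re1 t t01))) _.
  by field.
Qed.

(** The coefficients for [c] are dominated by those for [|c|], which are
nonnegative, so a partial sum is below the full sum of the real series. *)
Lemma binomial_abs c z n : cmod z < 1 ->
  \sum_(j < n) cmod (risefac c j / j`!%:R * z ^+ j) <= (1 - cmod z) `^ (- cmod c).
Proof.
move=> z1; have y01 : cmod (cmod z)%:C < 1 by rewrite cmodC ger0_norm ?cmod_ge0.
have [+ _] := @binomial_series (cmod c)%:C _ y01.
have y0 : 0 < 1 - cmod z by rewrite subr_gt0.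
rewrite (_ : 1 - _ = (1 - cmod z)%:C); last by rewrite rmorphB.
rewrite cpowC// -rmorphN -rmorphM cexpC [X in _ --> X]/= => h.
rewrite /powR gt_eqF//.
have E m : Re (\sum_(j < m) risefac (cmod c)%:C j / j`!%:R * (cmod z)%:C ^+ j) =
  \sum_(j < m) (\prod_(i < j) (cmod c + i%:R)) / j`!%:R * cmod z ^+ j.
  rewrite cRe_sum; apply: eq_bigr => i _.
  by rewrite risefac_real -natC -fmorphV -rmorphXn -!rmorphM.
apply: (@le_trans _ _ (Re (\sum_(j < n) risefac (cmod c)%:C j / j`!%:R * (cmod z)%:C ^+ j))).
  rewrite E//; apply: ler_sum => j _; rewrite cmodM cmodX cmodM cmodV cmod_nat.
  apply: ler_wpM2r; first exact: exprn_ge0 (cmod_ge0 _).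
  by apply: ler_wpM2r; [rewrite invr_ge0|exact: cmod_risefac].
have p0 j : 0 <= \prod_(i < j) (cmod c + i%:R) :> R by apply: prodr_ge0 => i _; rewrite addr_ge0 ?cmod_ge0.
apply: (cvgr_to_ge h); near=> m; have nm : (n <= m)%N by near: m; exact: nbhs_infty_ge.
rewrite -(subnKC nm) !E big_split_ord/= lerDl; apply: sumr_ge0 => j _.
apply: mulr_ge0; last exact: exprn_ge0 (cmod_ge0 _).
by apply: divr_ge0; [exact: p0|exact: ler0n].
Unshelve. all: by end_near. Qed.

End csequences.

(** * Real-analytic functions and the identity theorem *)

Section taylor.
Context {R : realType}.
Local Notation lam := (@lebesgue_measure R).
Local Notation Re := complex.Re.
Local Notation Im := complex.Im.
Implicit Types (F G : R -> R[i]) (a : nat -> R[i]) (rho M : R).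

(** The norm [sum_j |a_j| rho^j] is submultiplicative, so the functions with
finite norm form a Banach algebra; [has_taylor rho M F] is the ball of radius
[M].  This replaces compositions of holomorphic functions by norm
estimates. *)
Definition taylor a rho M F := (forall n, \sum_(j < n) cmod (a j) * rho ^+ j <= M) /\
  forall x : R, `|x| <= rho -> ccv \oo (fun n => \sum_(j < n) a j * x%:C ^+ j) (F x).

Definition has_taylor rho M F := exists a, taylor a rho M F.

Lemma tay_ext rho M F G : (forall x : R, `|x| <= rho -> F x = G x) -> has_taylor rho M F -> has_taylor rho M G.
Proof. by move=> FG [a [h1 h2]]; exists a; split => // x xr; rewrite -FG//; exact: h2. Qed.

Lemma tay_mono rho' rho M F : 0 <= rho' <= rho -> has_taylor rho M F -> has_taylor rho' M F.
Proof.
move=> /andP[r0 rr] [a [h1 h2]]; exists a; split => [n|x xr]; last by apply: h2; exact: le_trans rr.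
apply: le_trans (h1 n); apply: ler_sum => j _.
apply: ler_wpM2l; [exact: cmod_ge0|apply: lerXn2r => //].
by rewrite nnegrE (le_trans r0).
Qed.

Lemma tay_ge0 rho M F : has_taylor rho M F -> 0 <= M.
Proof. by move=> [a [h _]]; have := h 0%N; rewrite big_ord0. Qed.

Lemma tay_term a rho M F n : 0 <= rho -> taylor a rho M F -> cmod (a n) * rho ^+ n <= M.
Proof.
move=> r0 [h _]; apply: le_trans (h n.+1); rewrite big_ord_recr/= lerDr.
by apply: sumr_ge0 => j _; rewrite mulr_ge0 ?cmod_ge0 ?exprn_ge0.
Qed.

Lemma taylor_sum a rho M F x n : taylor a rho M F -> `|x| <= rho ->
  \sum_(j < n) cmod (a j * x%:C ^+ j) <= M.
Proof.
move=> [h _] xr; apply: le_trans (h n); apply: ler_sum => j _.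
rewrite cmodM cmodX cmodC; apply: ler_wpM2l; first exact: cmod_ge0.
by apply: lerXn2r => //; rewrite nnegrE// (le_trans _ xr).
Qed.

Lemma tay_bound rho M F x : has_taylor rho M F -> `|x| <= rho -> cmod (F x) <= M.
Proof.
move=> [a aF] xr; have [_ h] := aF; apply: (ccv_bound (h x xr)); near=> n.
by apply: le_trans (cmod_sum _ _ _) _; exact: taylor_sum aF xr.
Unshelve. all: by end_near. Qed.

Lemma tay_cst rho (c : R[i]) : has_taylor rho (cmod c) (fun=> c).
Proof.
exists (fun j => if j == 0%N then c else 0); split => [[|n]|x _].
- by rewrite big_ord0 cmod_ge0.
- by rewrite big_ord_recl/= expr0 mulr1 big1 ?addr0// => j _; rewrite cmod0 mul0r.
- apply: (@ccvn_near _ (fun=> c) _ _ 1 _ (ccvn_cst _)) => -[//|n] _.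
  by rewrite big_ord_recl/= expr0 mulr1 big1 ?addr0// => j _; rewrite mul0r.
Qed.

Lemma tay_mulX rho M F : 0 <= rho -> has_taylor rho M F -> has_taylor rho (rho * M) (fun x => x%:C * F x).
Proof.
move=> r0 aF; have M0 := tay_ge0 aF; have [a [h1 h2]] := aF.
exists (fun j => if j is i.+1 then a i else 0); split => [[|n]|x xr].
- by rewrite big_ord0 mulr_ge0.
- rewrite big_ord_recl/= cmod0 mul0r add0r; apply: le_trans (ler_wpM2l r0 (h1 n)).
  rewrite mulr_sumr; apply: ler_sum => j _ /=; rewrite /bump/= add1n exprS.
  by rewrite mulrCA.
- have := ccvnZ x%:C (h2 x xr) => h.
  have {}h : ccv \oo (fun n => \sum_(j < n.+1) (if (j : nat) is i.+1 then a i else 0) * x%:C ^+ j) (x%:C * F x).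
    apply: eq_ccv h => n; rewrite big_ord_recl/= mul0r add0r mulr_sumr; apply: eq_bigr => j _.
    by rewrite /bump/= add1n exprS mulrCA.
  have [g1 g2] := h; split.
    by rewrite -cvg_shiftS.
  by rewrite -cvg_shiftS.
Qed.

Lemma tay_scale rho M F (c : R[i]) : has_taylor rho M F -> has_taylor rho (cmod c * M) (fun x => c * F x).
Proof.
move=> [a [h1 h2]]; exists (fun j => c * a j); split => [n|x xr].
  under eq_bigr do rewrite cmodM -mulrA; rewrite -mulr_sumr; apply: ler_wpM2l => //; exact: cmod_ge0.
have := ccvnZ c (h2 x xr); apply: eq_ccv => n; rewrite mulr_sumr; apply: eq_bigr => j _.
by rewrite mulrA.
Qed.

Lemma tay_add rho M N F G : 0 < rho -> has_taylor rho M F -> has_taylor rho N G -> has_taylor rho (M + N) (fun x => F x + G x).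
Proof.
move=> r0 [a [h1 h2]] [b [h3 h4]]; exists (fun j => a j + b j); split => [n|x xr].
  apply: le_trans (lerD (h1 n) (h3 n)); rewrite -big_split/=; apply: ler_sum => j _.
  by rewrite -mulrDl; apply: ler_wpM2r; [rewrite exprn_ge0// ltW|exact: cmodD].
have := ccvnD (h2 x xr) (h4 x xr); apply: eq_ccv => n; rewrite -big_split/=.
by apply: eq_bigr => j _; rewrite mulrDl.
Qed.

(** Completeness of the algebra.  The coefficients of the sum are obtained
at [x = rho], where convergence is guaranteed by the norm bound, and divided
by [rho ^ j]. *)
Lemma tay_series rho M (M_ : nat -> R) (F_ : nat -> R -> R[i]) F : 0 < rho ->
  (forall n, has_taylor rho (M_ n) (F_ n)) -> (forall N, \sum_(n < N) M_ n <= M) ->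
  (forall x : R, `|x| <= rho -> ccv \oo (fun N => \sum_(n < N) F_ n x) (F x)) -> has_taylor rho M F.
Proof.
move=> r0 tF MM FF; have M_0 n : 0 <= M_ n := tay_ge0 (tF n).
have [a_ ha] := choice tF.
have hex : forall j, exists l : R[i], ccv \oo (fun N => \sum_(n < N) a_ n j * rho%:C ^+ j) l.
  move=> j; have [|l [hl _]] := @abs_series _ (fun n => a_ n j * rho%:C ^+ j) M; last by exists l.
  move=> N; apply: le_trans (MM N); apply: ler_sum => n _.
  by rewrite cmodM cmodX cmodC (gtr0_norm r0); exact: tay_term (ltW r0) (ha n).
have [c hc] := choice hex.
have rr : `|rho| <= rho by rewrite gtr0_norm.
have [] := @double_series _ (fun n j => a_ n j * rho%:C ^+ j) M_ M (fun n => F_ n rho) c (F rho).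
- by move=> n J; exact: (taylor_sum J (ha n) rr).
- exact: MM.
- by move=> n; have [_ h] := ha n; exact: h rr.
- exact: hc.
- exact: FF rr.
move=> cM _.
pose b j := c j / rho%:C ^+ j.
have rX j : rho%:C ^+ j != 0 :> R[i] by rewrite expf_neq0// RCneq0.
exists b; split => [n|x xr].
  apply: le_trans (cM n); apply: ler_sum => j _.
  by rewrite /b cmodM cmodV cmodX cmodC (gtr0_norm r0) divfK// expf_neq0// gt_eqF//.
have [] := @double_series _ (fun n j => a_ n j * x%:C ^+ j) M_ M (fun n => F_ n x) (fun j => b j * x%:C ^+ j) (F x).
- by move=> n J; exact: (taylor_sum J (ha n) xr).
- exact: MM.
- by move=> n; have [_ h] := ha n; exact: h xr.
- move=> j; have := ccvnZ (x%:C ^+ j / rho%:C ^+ j) (hc j).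
  rewrite (_ : _ * c j = b j * x%:C ^+ j); last by rewrite /b; field.
  by apply: eq_ccv => n; rewrite mulr_sumr; apply: eq_bigr => i _; field.
- exact: FF xr.
by [].
Qed.

(** Expand the first factor only and use completeness, which needs just
multiplication by [x]. *)
Lemma tay_mul rho M N F G : 0 < rho -> has_taylor rho M F -> has_taylor rho N G ->
  has_taylor rho (M * N) (fun x => F x * G x).
Proof.
move=> r0 [a [h1 h2]] tG; have N0 := tay_ge0 tG.
have tX n : has_taylor rho (rho ^+ n * N) (fun x => x%:C ^+ n * G x).
  elim: n => [|n IH].
    rewrite expr0 mul1r; apply: tay_ext tG => x _; by rewrite expr0 mul1r.
  rewrite exprS -mulrA; apply: tay_ext (tay_mulX (ltW r0) IH) => x _.
  by rewrite exprS mulrA.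
apply: (@tay_series _ _ (fun n => cmod (a n) * (rho ^+ n * N)) (fun n x => a n * (x%:C ^+ n * G x))) => //.
- by move=> n; exact: tay_scale.
- by move=> n; under eq_bigr do rewrite mulrA; rewrite -mulr_suml; apply: ler_wpM2r.
- move=> x xr; have := ccvnZ (G x) (h2 x xr); rewrite mulrC; apply: eq_ccv => n.
  by rewrite mulrC mulr_suml; apply: eq_bigr => j _; rewrite mulrA.
Qed.

Lemma tay_exp rho M F n : 0 < rho -> has_taylor rho M F -> has_taylor rho (M ^+ n) (fun x => F x ^+ n).
Proof.
move=> r0 tF; elim: n => [|n IH].
  by have := tay_cst rho 1; rewrite cmod1.
by rewrite exprS; apply: tay_ext (tay_mul r0 tF IH) => x _; rewrite exprS.
Qed.

Lemma taylor_lip a rho M F x : 0 < rho -> taylor a rho M F -> `|x| <= rho ->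
  cmod (F x - a 0%N) <= `|x| * (M / rho).
Proof.
move=> r0 aF xr; have [h1 h2] := aF; have := ccvn_shift1 (h2 x xr) => h.
have {}h := ccvnD h (ccvn_cst (- a 0%N)).
apply: (ccv_bound h); near=> n.
rewrite big_ord_recl/= expr0 mulr1 addrAC subrr add0r; apply: le_trans (cmod_sum _ _ _) _.
apply: (@le_trans _ _ (`|x| / rho * \sum_(j < n) cmod (a j.+1) * rho ^+ j.+1)).
  rewrite mulr_sumr; apply: ler_sum => j _; rewrite /bump/= add1n cmodM cmodX cmodC.
  rewrite [leRHS](_ : _ = cmod (a j.+1) * (`|x| * rho ^+ j)); last by rewrite exprS; field; rewrite gt_eqF.
  apply: ler_wpM2l; first exact: cmod_ge0.
  rewrite exprS; apply: ler_wpM2l => //; apply: lerXn2r => //; by rewrite nnegrE// ltW.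
rewrite mulrAC -mulrA; apply: ler_wpM2l => //; apply: ler_wpM2r; first by rewrite invr_ge0 ltW.
apply: le_trans (h1 n.+1); rewrite [leRHS]big_ord_recl/= expr0 mulr1.
by apply: ler_wpDl; [exact: cmod_ge0|apply: ler_sum => j _].
Unshelve. all: by end_near. Qed.

Lemma taylor_at0 a rho M F : 0 <= rho -> taylor a rho M F -> F 0 = a 0%N.
Proof.
move=> r0 [_ h]; have := h 0; rewrite normr0 => /(_ r0) h0; apply: ccv_unique h0 _.
apply: (@ccvn_near _ (fun=> a 0%N) _ _ 1 _ (ccvn_cst _)) => -[//|n] _.
rewrite big_ord_recl/= expr0 mulr1 big1 ?addr0// => j _.
by rewrite /bump/= add1n expr0n/= mulr0.
Qed.

(** By induction: the lowest coefficient is the limit at 0 from the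
right, and dividing by [x] shifts the series. *)
Lemma taylor_coef0 rho j : 0 < rho -> forall a M F, taylor a rho M F ->
  (forall x, 0 < x <= rho -> F x = 0) -> a j = 0.
Proof.
move=> r0; have z0 a M F : taylor a rho M F -> (forall x, 0 < x <= rho -> F x = 0) -> a 0%N = 0.
  move=> aF F0; apply/eqP; rewrite -cmod_eq0; apply/negPn/negP => an.
  have ap : 0 < cmod (a 0%N) by rewrite lt_def an cmod_ge0.
  have M0 : 0 <= M by apply: tay_ge0; exists a; exact: aF.
  pose x := Num.min rho (cmod (a 0%N) / (2 * (M / rho + 1))).
  have K0 : 0 < M / rho + 1 by rewrite ltr_wpDl// divr_ge0// ltW.
  have x0 : 0 < x by rewrite lt_min r0/= divr_gt0// mulr_gt0.
  have xr : x <= rho by rewrite ge_min lexx.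
  have := taylor_lip r0 aF (_ : `|x| <= rho); rewrite (gtr0_norm x0) => /(_ xr).
  rewrite F0 ?x0// sub0r cmodN leNgt => /negP; apply.
  have h : x <= cmod (a 0%N) / (2 * (M / rho + 1)) by rewrite ge_min lexx orbT.
  apply: le_lt_trans (_ : x * (M / rho + 1) < _); first by rewrite ler_pM2l// lerDl.
  apply: le_lt_trans (ler_wpM2r (ltW K0) h) _.
  rewrite [ltLHS](_ : _ = cmod (a 0%N) / 2); first by rewrite ltr_pdivrMr// mulr_natr mulr2n ltrDl.
  by clear -K0; move: (M / rho + 1) K0 => K K0; field; rewrite gt_eqF.
elim: j => [|j IH] a M F aF F0; first exact: z0 aF F0.
have a0 := z0 _ _ _ aF F0; have [h1 h2] := aF.
apply: (IH (fun i => a i.+1) (M / rho) (fun x => if x == 0 then a 1%N else F x / x%:C)).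
  split => [n|x xr].
    rewrite ler_pdivlMr// mulr_suml; apply: le_trans (h1 n.+1).
    rewrite big_ord_recl/= a0 cmod0 mul0r add0r; apply: ler_sum => i _.
    by rewrite /bump/= add1n exprSr mulrA.
  have [->|xn] := eqVneq x 0.
    apply: (@ccvn_near _ (fun=> a 1%N) _ _ 1 _ (ccvn_cst _)) => -[//|n] _.
    rewrite big_ord_recl/= expr0 mulr1 big1 ?addr0// => i _.
    by rewrite /bump/= add1n expr0n/= mulr0.
  have xn' : x%:C != 0 :> R[i] by rewrite -cmod_eq0 cmodC normr_eq0.
  have := ccvnZ x%:C^-1 (ccvn_shift1 (h2 x xr)); rewrite mulrC; apply: eq_ccv => n.
  rewrite big_ord_recl/= a0 mul0r add0r mulr_sumr; apply: eq_bigr => i _.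
  by rewrite /bump/= add1n exprS; field.
by move=> x /andP[x0 xr]; rewrite gt_eqF// F0 ?mul0r// x0.
Qed.

Lemma tay_identity rho M F : 0 < rho -> has_taylor rho M F -> (forall x, 0 < x <= rho -> F x = 0) ->
  forall x, `|x| <= rho -> F x = 0.
Proof.
move=> r0 [a aF] F0 x xr; have [_ h] := aF; apply: ccv_unique (h x xr) _.
apply: (@eq_ccv _ _ _ (fun=> 0)); last exact: ccvn_cst.
by move=> n; rewrite big1// => j _; rewrite (taylor_coef0 j r0 aF F0) mul0r.
Qed.

(** Analyticity along the real line only, with values in the complex
numbers. *)
Definition analytic F (c : R) := exists rho M, 0 < rho /\ has_taylor rho M (fun x => F (c + x)).

(** Were [F r] nonzero, the supremum of the points where [F] does not
vanish would be a point with [F = 0] immediately to its right; the local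
identity theorem makes [F] vanish to its left as well, a contradiction. *)
Lemma analytic_eq0 F (r0 : R) : (forall c, 1 < c -> analytic F c) ->
  (forall r, r0 < r -> F r = 0) -> forall r, 1 < r -> F r = 0.
Proof.
move=> aF F0 r r1; apply: contrapT => Fr.
pose S := [set x | r <= x /\ F x <> 0].
have Sr : S r by split.
have Sub : ubound S r0 by move=> x [_ Fx]; rewrite leNgt; apply/negP => /F0.
have hS : has_sup S by split; [exists r|exists r0].
have rs : r <= sup S by exact: ub_le_sup (hS.2) _ Sr.
have [rho [M [rho0 tF]]] := aF (sup S) (lt_le_trans r1 rs).
have [y [ry Fy] sy] := sup_adherent rho0 hS.
have ys : y <= sup S by apply: ub_le_sup => //; exact: hS.2.
apply: Fy; have -> : y = sup S + (y - sup S) by rewrite addrC subrK.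
apply: (tay_identity rho0 tF).
  move=> x /andP[x0 _]; apply: contrapT => Fx.
  have : sup S + x <= sup S.
    by apply: ub_le_sup; [exact: hS.2|split => //; rewrite (le_trans rs)// lerDl ltW].
  by rewrite gerDl leNgt x0.
by rewrite ler0_norm ?subr_le0// opprB lerBlDr -lerBlDl ltW.
Qed.

Lemma analytic_cst (k : R[i]) (c : R) : analytic (fun=> k) c.
Proof. by exists 1, (cmod k); split => //; exact: tay_cst. Qed.

Lemma analytic_ext F G (c e : R) : 0 < e -> (forall x, `|x| <= e -> F (c + x) = G (c + x)) ->
  analytic F c -> analytic G c.
Proof.
move=> e0 FG [rho [M [r0 tF]]]; exists (Num.min e rho), M.
have m0 : 0 < Num.min e rho by rewrite lt_min e0.
split => //; apply: tay_ext (tay_mono _ tF); last by rewrite (ltW m0) ge_min lexx orbT.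
by move=> x; rewrite le_min => /andP[xe _]; exact: FG.
Qed.

Lemma analytic_id (c : R) : analytic (fun x => x%:C) c.
Proof.
exists 1, (cmod c%:C + 1 * cmod 1); split => //.
apply: tay_ext (tay_add ltr01 (tay_cst 1 c%:C) (tay_mulX ler01 (tay_cst 1 1))) => x _.
by rewrite mulr1 rmorphD.
Qed.

Lemma analytic_two F G (c : R) (H : R -> R[i]) (N : R -> R -> R) :
  (forall rho M1 M2, 0 < rho -> has_taylor rho M1 (fun x => F (c + x)) -> has_taylor rho M2 (fun x => G (c + x)) ->
    has_taylor rho (N M1 M2) (fun x => H (c + x))) ->
  analytic F c -> analytic G c -> analytic H c.
Proof.
move=> h [r1 [M1 [r10 t1]]] [r2 [M2 [r20 t2]]]; exists (Num.min r1 r2), (N M1 M2).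
have m0 : 0 < Num.min r1 r2 by rewrite lt_min r10.
split => //; apply: h; first exact: m0.
  by apply: tay_mono t1; rewrite (ltW m0) ge_min lexx.
by apply: tay_mono t2; rewrite (ltW m0) ge_min lexx orbT.
Qed.

Lemma analyticD F G (c : R) : analytic F c -> analytic G c -> analytic (fun x => F x + G x) c.
Proof. by apply: (analytic_two (N := +%R)) => rho M1 M2; exact: tay_add. Qed.

Lemma analyticM F G (c : R) : analytic F c -> analytic G c -> analytic (fun x => F x * G x) c.
Proof. by apply: (analytic_two (N := *%R)) => rho M1 M2; exact: tay_mul. Qed.

Lemma analyticX F (c : R) n : analytic F c -> analytic (fun x => F x ^+ n) c.
Proof.
move=> aF; elim: n => [|n IH]; first exact: analytic_cst.
apply: (analytic_ext ltr01 _ (analyticM aF IH)) => x _; by rewrite exprS.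
Qed.

Lemma analytic_sum (n : nat) (F_ : nat -> R -> R[i]) (c : R) :
  (forall i, (i < n)%N -> analytic (F_ i) c) -> analytic (fun x => \sum_(i < n) F_ i x) c.
Proof.
elim: n => [|n IH] aF.
  by apply: (analytic_ext ltr01 _ (analytic_cst 0 c)) => x _; rewrite big_ord0.
apply: (analytic_ext ltr01 _ (analyticD (IH _) (aF n _))) => //.
- by move=> x _; rewrite big_ord_recr.
- by move=> i im; apply: aF; exact: ltnW.
Qed.

Lemma analytic_right F (c : R) : analytic F c -> ccv (0 : R)^'+ (fun x => F (c + x)) (F c).
Proof.
move=> [rho [M [r0 [a aF]]]].
apply: (@ccv_squeeze _ _ _ _ _ _ (fun x => `|x| * (M / rho))).
  near=> x; have -> : F c = a 0%N by rewrite -(taylor_at0 (ltW r0) aF) addr0.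
  apply: (taylor_lip r0 aF); rewrite ger0_norm; last by near: x; exact: nbhs_right_ge.
  by near: x; exact: nbhs_right_le.
rewrite -[X in _ --> X](mul0r (M / rho)); apply: cvgMl.
rewrite -[X in _ --> X](normr0 R); apply: cvg_norm.
exact: cvg_at_right_filter cvg_id.
Unshelve. all: by end_near. Qed.

End taylor.

(** * Analyticity of Laplace transforms and of powers *)

Section analytic_examples.
Context {R : realType}.
Local Notation lam := (@lebesgue_measure R).
Local Notation Re := complex.Re.
Local Notation Im := complex.Im.

(** Turns a sum of moduli of integrals into one integral, whose
modulus can be estimated under the integral sign. *)
Lemma unimodular_factor (z : R[i]) : exists w : R[i], cmod w <= 1 /\ w * z = (cmod z)%:C.
Proof.
have [->|z0] := eqVneq z 0; first by exists 0; rewrite cmod0 mulr0.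
exists ((cmod z)%:C / z); split; last by rewrite divfK.
by rewrite cmodM cmodV cmodC ger0_norm ?cmod_ge0// mulfV ?cmod_eq0.
Qed.

Lemma exp_sum_le (x : R) n : 0 <= x -> \sum_(j < n) x ^+ j / j`!%:R <= expR x.
Proof.
move=> x0; rewrite /expR -(big_mkord xpredT (fun j => x ^+ j / j`!%:R)).
apply: (@nondecreasing_cvgn_le _ (series (exp_coeff x)) _ _ n); last exact: is_cvg_series_exp_coeff.
by apply: nondecreasing_series => j _ _; exact: exp_coeff_ge0.
Qed.

(** Expand [exp (- x u t)] in powers of [x]; the series of moduli is
dominated by [exp (del t / 2)] with [del = c Re u - s], which leaves an
integrable function. *)
Lemma lap_analytic (phi : R -> R[i]) (u : R[i]) (M s c : R) :
  @cmeas R _ R `[0, +oo[ phi -> (forall t, 0 <= t -> cmod (phi t) <= M * expR (s * t)) ->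
  s < c * Re u -> analytic (fun r => Lap phi (r%:C * u)) c.
Proof.
move=> mp pM scu; pose del := c * Re u - s; have d0 : 0 < del by rewrite subr_gt0.
(* Half of the gap [del] pays for the expansion of the exponential; adding 1 to [|u|] only avoids a division by 0. *)
have U0 : 0 < cmod u + 1 by rewrite ltr_wpDl// cmod_ge0.
pose rho := del / (2 * (cmod u + 1)); have r0 : 0 < rho by rewrite divr_gt0// mulr_gt0.
have ru : cmod u * rho <= del / 2.
  rewrite /rho [leLHS](_ : _ = del / 2 * (cmod u / (cmod u + 1))); last by field; rewrite gt_eqF.
  by rewrite ger_pMr ?divr_gt0// ler_pdivrMr// mul1r lerDl.
pose H : set R := `[0, +oo[%classic; have mH : measurable H by exact: measurable_itv.
pose e (t : R) := cexp (- (c%:C * u * t%:C)) * phi t.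
pose g (j : nat) (t : R) := (- (u * t%:C)) ^+ j / j`!%:R * e t.
pose B (t : R) := M * expR (- (del / 2 * t)).
have me : cmeas H e by apply: cmeasM => //; exact: cmeas_expN.
have mg j : cmeas H (g j).
  apply: cmeasM => //; apply: cmeasM; last exact: cmeas_cst.
  apply: cmeasX; apply: cmeasN; apply: cmeasM; first exact: cmeas_cst.
  by apply: cmeasC; exact: measurable_id.
have iB : lam.-integrable H (EFin \o B).
  by apply: RintegrableZ => //; have [] := Rintegral_expN (divr_gt0 d0 (ltr0n _ 2)).
have gB n t : H t -> \sum_(j < n) cmod (g j t) * rho ^+ j <= B t.
  rewrite /H/= in_itv/= andbT => t0.
  apply: (@le_trans _ _ (\sum_(j < n) ((cmod u * rho * t) ^+ j / j`!%:R) * cmod (e t))).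
    apply: ler_sum => j _; rewrite /g cmodM cmodM cmodX cmodN cmodM cmodC (ger0_norm t0) cmodV cmod_nat.
    rewrite le_eqVlt; apply/orP; left; apply/eqP; rewrite !exprMn.
    have f0 : (j`!%:R : R) != 0 by rewrite pnatr_eq0 -lt0n fact_gt0.
    by field.
  rewrite -mulr_suml; apply: (@le_trans _ _ (expR (del / 2 * t) * (expR (- (c * Re u * t)) * (M * expR (s * t))))).
    have y0 : 0 <= cmod u * rho * t by rewrite mulr_ge0// mulr_ge0 ?cmod_ge0// ltW.
    apply: ler_pM.
    - by apply: sumr_ge0 => j _; rewrite divr_ge0// exprn_ge0.
    - exact: cmod_ge0.
    - apply: le_trans (exp_sum_le _ y0) _.
      by rewrite ler_expR ler_wpM2r.
    - rewrite /e cmodM cmod_expN !cReImE/= mul0r subr0; apply: ler_wpM2l; [exact: expR_ge0|exact: pM].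
  rewrite /B [leLHS](_ : _ = M * (expR (del / 2 * t) * expR (- (c * Re u * t)) * expR (s * t))); last by ring.
  rewrite -!expRD le_eqVlt; apply/orP; left; apply/eqP; congr (_ * expR _).
  by rewrite /del; field.
have ig j : cintegrable H (g j).
  apply: (cintegrable_dom mH (mg j) (RintegrableZ (rho ^- j) mH iB)) => t Ht.
  rewrite mulrC ler_pdivlMr ?exprn_gt0//; apply: le_trans (gB j.+1 t Ht).
  rewrite big_ord_recr/= lerDr; apply: sumr_ge0 => i _; rewrite mulr_ge0 ?cmod_ge0// exprn_ge0// ltW//.
exists rho, (Rintegral lam H B); split => //; exists (fun j => cintegral H (g j)); split => [n|x xr].
  have [w hw] := choice (fun j => unimodular_factor (cintegral H (g j))).
  have iwg j : cintegrable H (fun t => w j * (rho ^+ j)%:C * g j t) by exact: cintegrableZ.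
  have [i1 E1] := @cintegrable_sum R n H (fun j t => w j * (rho ^+ j)%:C * g j t) mH iwg.
  have -> : \sum_(j < n) cmod (cintegral H (g j)) * rho ^+ j =
      Re (cintegral H (fun t => \sum_(j < n) w j * (rho ^+ j)%:C * g j t)).
    rewrite E1 cRe_sum; apply: eq_bigr => j _; rewrite cintegralZ// mulrAC (hw j).2.
    by rewrite -rmorphM.
  apply: le_trans (ler_norm _) _; apply: le_trans (Re_le_cmod _) _.
  apply: (cmod_cintegral_le mH (cintegrable_meas i1) iB) => t Ht.
  apply: le_trans (cmod_sum _ _ _) _; apply: le_trans (gB n t Ht); apply: ler_sum => j _.
  rewrite cmodM cmodM cmodC (ger0_norm (exprn_ge0 _ (ltW r0))) mulrC.
  apply: ler_wpM2l; first exact: cmod_ge0.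
  by apply: ler_piMl; [rewrite exprn_ge0// ltW|exact: (hw j).1].
have [] := @cintegral_series R H (fun j t => x%:C ^+ j * g j t) (fun t => cexp (- ((c + x)%:C * u * t%:C)) * phi t) B mH.
- by move=> j; apply: cmeasM => //; exact: cmeas_cst.
- exact: iB.
- move=> n t Ht; apply: le_trans (gB n t Ht); apply: ler_sum => j _.
  rewrite cmodM cmodX cmodC mulrC; apply: ler_wpM2l; first exact: cmod_ge0.
  apply: lerXn2r => //; by rewrite nnegrE// ltW.
- move=> t Ht.
  have -> : cexp (- ((c + x)%:C * u * t%:C)) * phi t = e t * cexp (- (x%:C * u * t%:C)).
    rewrite /e [RHS]mulrAC -cexpD; congr (cexp _ * _); rewrite rmorphD/=; ring.
  have := ccvnZ (e t) (cexp_series (- (x%:C * u * t%:C))); apply: eq_ccv => n.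
  rewrite mulr_sumr; apply: eq_bigr => j _; rewrite /g -mulrA -mulrN exprMn; ring.
move=> _ _; apply: eq_ccv => n; apply: eq_bigr => j _; rewrite cintegralZ// mulrC//.
Qed.

(** The binomial expansion of [c^s (1 + x/c)^s]. *)
Lemma tay_pow (c rho : R) (s : R[i]) : 0 < rho < c ->
  has_taylor rho (cmod (cpow c%:C s) * (1 - rho / c) `^ (- cmod s)) (fun x => cpow (c + x)%:C s).
Proof.
move=> /andP[r0 rc]; have c0 := lt_trans r0 rc.
have cn : c%:C != 0 :> R[i] := RCneq0 c0.
have rc1 : cmod (- (rho / c))%:C < 1 by rewrite cmodC normrN gtr0_norm ?divr_gt0// ltr_pdivrMr// mul1r.
exists (fun j => cpow c%:C s * (risefac (- s) j / j`!%:R * (- c^-1)%:C ^+ j)); split => [n|x xr].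
  have := @binomial_abs _ (- s) _ n rc1; rewrite cmodN cmodC normrN gtr0_norm ?divr_gt0// => h.
  apply: le_trans (ler_wpM2l (cmod_ge0 _) h); rewrite mulr_sumr; apply: ler_sum => j _.
  rewrite cmodM -mulrA; apply: ler_wpM2l; first exact: cmod_ge0.
  rewrite [cmod (_ * (- c^-1)%:C ^+ j)]cmodM [cmod (_ * (- (rho / c))%:C ^+ j)]cmodM -mulrA.
  apply: ler_wpM2l; first exact: cmod_ge0.
  rewrite !cmodX !cmodC !normrN normfV (gtr0_norm c0) (gtr0_norm (divr_gt0 r0 c0)).
  by rewrite -exprMn mulrC.
have xc : cmod (- (x / c))%:C < 1.
  rewrite cmodC normrN normrM normfV (gtr0_norm c0) ltr_pdivrMr// mul1r; exact: le_lt_trans rc.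
have E : (c + x)%:C = c%:C * (1 - (- (x / c))%:C) :> R[i].
  by rewrite -[1]/(1%:C) -rmorphB -rmorphM/=; congr (_%:C); field; rewrite gt_eqF.
have n1 : 1 - (- (x / c))%:C != 0 :> R[i].
  apply: Re_gt0_neq0; rewrite cReB cRe1 cReC opprK.
  by move: xc; rewrite cmodC normrN ltr_norml => /andP[h _]; rewrite -ltrBlDl sub0r.
rewrite E cpowZ//; have := ccvnZ (cpow c%:C s) (@binomial_series _ (- s) _ xc).
rewrite opprK; apply: eq_ccv => n; rewrite mulr_sumr; apply: eq_bigr => j _.
rewrite -!mulrA -exprMn; congr (_ * (_ * (_ * _ ^+ _))).
by rewrite -rmorphM/=; congr (_%:C); ring.
Qed.

(** The binomial series converges in the Banach algebra because the norm
of [W] is at most [M < 1]. *)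
Lemma tay_binom (rho M : R) (W : R -> R[i]) (b : R[i]) : 0 < rho -> has_taylor rho M W -> M < 1 ->
  has_taylor rho ((1 - M) `^ (- cmod b)) (fun x => cpow (1 - W x) (- b)).
Proof.
move=> r0 tW M1; have M0 := tay_ge0 tW.
have cM : cmod M%:C = M by rewrite cmodC ger0_norm.
apply: (@tay_series _ _ _ (fun n => cmod (risefac b n / n`!%:R) * M ^+ n)
  (fun n x => risefac b n / n`!%:R * W x ^+ n)) => //.
- by move=> n; apply: tay_scale; exact: tay_exp.
- move=> N; have := @binomial_abs _ b M%:C N; rewrite cM => /(_ M1); apply: le_trans.
  by apply: ler_sum => j _; rewrite (cmodM (risefac b j / j`!%:R)) cmodX cM.
- move=> x xr; apply: binomial_series; apply: le_lt_trans M1; exact: tay_bound tW xr.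
Qed.

(** Near [c] the norm of [z (c + x)^s2] on a disc of radius [rho] tends
to [|z| c^(Re s2) < 1] as [rho] tends to 0, so [tay_binom] applies for small
[rho]. *)
Lemma kernel_analytic (c : R) (s1 s2 b z : R[i]) : 0 < c -> cmod z * c `^ Re s2 < 1 ->
  analytic (fun r => cpow r%:C s1 * cpow (1 - z * cpow r%:C s2) (- b)) c.
Proof.
move=> c0 zc; apply: analyticM.
  by exists (c / 2), (cmod (cpow c%:C s1) * (1 - c / 2 / c) `^ (- cmod s1)); split; [exact: divr_gt0|apply: tay_pow; rewrite divr_gt0// ltr_pdivrMr// mulr_natr mulr2n ltrDl].
have [rho /andP[r0 rc] h] : exists2 rho, 0 < rho < c &
    cmod z * (cmod (cpow c%:C s2) * (1 - rho / c) `^ (- cmod s2)) < 1.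
  have h1 : 1 - x / c @[x --> (0 : R)^'+] --> (1 : R).
    rewrite -[X in _ --> X](subr0 1); apply: cvgB; first exact: cvg_cst.
    rewrite -[X in _ --> X](mul0r c^-1); apply: cvgMl; exact: cvg_at_right_filter cvg_id.
  have h2 : (1 - x / c) `^ (- cmod s2) @[x --> (0 : R)^'+] --> (1 : R).
    have h2 : (1 - x / c) `^ (- cmod s2) @[x --> (0 : R)^'+] --> (1 : R) `^ (- cmod s2).
      exact: (@cvg_comp _ _ _ (fun x => 1 - x / c) (fun y => y `^ (- cmod s2)) _ _ _ h1 (is_derive_continuous (is_derive1_powR _ ltr01))).
    by rewrite powR1 in h2.
  have h3 : cmod z * (cmod (cpow c%:C s2) * (1 - x / c) `^ (- cmod s2)) @[x --> (0 : R)^'+] -->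
     cmod z * (cmod (cpow c%:C s2) * 1) by apply: cvgMr; apply: cvgMr.
  have l1 : cmod z * (cmod (cpow c%:C s2) * 1) < 1 by rewrite mulr1 cmod_cpowC.
  have n1 := cvgr_lt _ h3 _ l1.
  near (0 : R)^'+ => x; exists x; last by near: x; exact: n1.
  by apply/andP; split; near: x; [exact: nbhs_right_gt|exact: nbhs_right_lt].
exists rho, ((1 - cmod z * (cmod (cpow c%:C s2) * (1 - rho / c) `^ (- cmod s2))) `^ (- cmod b)); split => //.
apply: (@tay_binom _ _ (fun x => z * cpow (c + x)%:C s2)) => //.
by apply: tay_scale; apply: tay_pow; rewrite r0.
Unshelve. all: by end_near. Qed.

End analytic_examples.

(** * Exhaustion and substitution on the open half-line *)

Section exhaust_pos.
Context {R : realType}.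
Local Notation lam := (@lebesgue_measure R).
Local Notation Re := complex.Re.
Local Notation Im := complex.Im.
Implicit Types (g : R -> R[i]) (t x : R).

Definition posR : set R := `]0, +oo[%classic.
(** Closed segments that exhaust the open half-line; the exponential keeps the
left endpoint positive. *)
Definition excl (n : nat) : set R := `[expR (- n%:R), n.+1%:R]%classic.

Lemma posRE x : posR x = (0 < x) :> Prop.
Proof. by rewrite /posR/= in_itv/= andbT. Qed.

Lemma measurable_posR : measurable posR. Proof. exact: measurable_itv. Qed.
Lemma measurable_excl n : measurable (excl n). Proof. exact: measurable_itv. Qed.

Lemma exclE n x : excl n x = (expR (- n%:R) <= x <= n.+1%:R) :> Prop.
Proof. by rewrite /excl/= in_itv/=. Qed.

Lemma excl_pos n : excl n `<=` posR.
Proof. by move=> x; rewrite exclE posRE => /andP[h _]; exact: lt_le_trans (expR_gt0 _) h. Qed.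

Lemma excl_homo : {homo excl : n m / (n <= m)%N >-> (n <= m)%O}.
Proof.
move=> n m nm; apply/subsetPset => x; rewrite !exclE => /andP[h1 h2]; apply/andP; split.
  by apply: le_trans h1; rewrite ler_expR lerN2 ler_nat.
by apply: le_trans h2 _; rewrite ler_nat.
Qed.

Lemma excl_near x : posR x -> \forall n \near \oo, excl n x.
Proof.
rewrite posRE => x0; near=> n; rewrite exclE; apply/andP; split.
  rewrite -[leRHS]lnK ?posrE// ler_expR lerNl; near: n; exact: nbhs_infty_ger.
apply: (@le_trans _ _ n%:R); last by rewrite ler_nat.
near: n; exact: nbhs_infty_ger.
Unshelve. all: by end_near. Qed.

Lemma excl_bigcup : \bigcup_n excl n = posR.
Proof.
apply/seteqP; split => [x [n _]|x /excl_near [N _ hN]]; first exact: excl_pos.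
by exists N => //; exact: hN (leqnn N).
Qed.

Lemma expN_le1 (n : nat) : expR (- n%:R) <= (1 : R).
Proof. by rewrite expR_le1 oppr_le0. Qed.

Lemma excl_le (n : nat) : expR (- n%:R) <= n.+1%:R :> R.
Proof. by apply: le_trans (expN_le1 n) _; rewrite ler1n. Qed.

Lemma Rintegrable_exhaust (f : R -> R) (M : R) : measurable_fun posR f ->
  (forall x, 0 < x -> 0 <= f x) -> (forall n, lam.-integrable (excl n) (EFin \o f)) ->
  (forall n, Rintegral lam (excl n) f <= M) -> lam.-integrable posR (EFin \o f).
Proof.
move=> mf f0 fi fM; have mfE : measurable_fun posR (EFin \o f) by apply/measurable_EFinP.
apply/integrableP; split; first exact: mfE.
apply: (@le_lt_trans _ _ M%:E); last exact: ltry.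
rewrite (_ : (\int[lam]_(x in posR) _)%E = (\int[lam]_(x in posR) (f x)%:E)%E); last first.
  apply: eq_integral => x; rewrite inE posRE => x0; by rewrite /= ger0_norm ?f0.
have h : (\int[lam]_(x in excl n) (f x)%:E)%E @[n --> \oo] --> (\int[lam]_(x in \bigcup_i excl i) (f x)%:E)%E.
  apply: ge0_nondecreasing_set_cvg_integral.
  - exact: excl_homo.
  - exact: measurable_excl.
  - by move=> n; apply: (@measurable_funS _ _ _ _ posR _ _ measurable_posR (@excl_pos n) mfE).
  - by move=> n x /excl_pos; rewrite posRE => x0; rewrite lee_fin f0.
rewrite -excl_bigcup; apply: (cvge_to_le h).
near=> n.
have Fn : (\int[lam]_(x in excl n) (f x)%:E)%E \is a fin_num.
  by apply: integrable_fin_num; [exact: measurable_excl|exact: fi].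
rewrite -(fineK Fn) lee_fin; exact: fM.
Unshelve. all: by end_near. Qed.

(** Monotone convergence: continuous functions are integrable on
each segment, and uniform bounds pass to the half-line. *)
Lemma cintegrable_exhaust g (M : R) : cmeas posR g -> (forall n, cintegrable (excl n) g) ->
  (forall n, Rintegral lam (excl n) (fun x => cmod (g x)) <= M) -> cintegrable posR g.
Proof.
move=> mg ig gM; apply: (cintegrableP measurable_posR mg).
apply: (Rintegrable_exhaust (cmeas_cmod mg) _ _ gM).
  by move=> x _; exact: cmod_ge0.
by move=> n; exact: cintegrable_cmod (measurable_excl n) (ig n).
Qed.

Lemma cintegral_exhaust_pos g : cintegrable posR g ->
  ccv \oo (fun n => cintegral (excl n) g) (cintegral posR g).
Proof. exact: (cintegral_exhaust measurable_posR measurable_excl excl_pos excl_near). Qed.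

Lemma cderiv_cpow (s : R[i]) t : 0 < t ->
  cderiv (fun x => cpow x%:C s) t (s * cpow t%:C (s - 1)).
Proof.
move=> t0; have tn := RCneq0 t0.
have d := cderiv_cexp (cderivZ s (cderiv_real (is_derive1_ln t0))).
apply: (@near_cderiv _ (fun x => cexp (s * (ln x)%:C))).
  near=> x; rewrite cpowC//; near: x; exact: lt_nbhsr.
apply: cderiv_eq d _; rewrite -cpowC// (cpowD _ _ tn) cpowN// cpow1// fmorphV/=.
by rewrite mulrAC mulrA.
Unshelve. all: by end_near. Qed.

Lemma ccontM g (h : R -> R[i]) t : ccont g t -> ccont h t -> ccont (fun x => g x * h x) t.
Proof. by move=> gc hc; exact: (@ccvM _ _ (nbhs t) _ g h (g t) (h t) gc hc). Qed.

Lemma ccont_cmod g t : ccont g t -> ccont (fun x => (cmod (g x))%:C) t.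
Proof. move=> gc; have h : cmod (g x) @[x --> t] --> cmod (g t) := @ccv_cmod R R (nbhs t) _ g (g t) gc.
by split; [exact: h|exact: cvg_cst]. Qed.

Lemma ccont_meas g : (forall t, 0 < t -> ccont g t) -> cmeas posR g.
Proof.
move=> gc; have oP : open posR by exact: interval_open.
split; apply: open_continuous_measurable_fun => // x; rewrite inE posRE => x0; by have [] := gc x x0.
Qed.

Lemma ccont_seg g (a b : R) : (forall t, 0 < t -> ccont g t) -> 0 < a -> cintegrable `[a, b] g.
Proof.
move=> gc a0; split; apply: continuous_compact_integrable; try exact: segment_compact;
  apply: continuous_in_subspaceT => t; rewrite inE/= in_itv/= => /andP[at_ _];
  by have [] := gc t (lt_le_trans a0 at_).
Qed.

Lemma ccont_antideriv g (a : R) : (forall t, 0 < t -> ccont g t) -> 0 < a ->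
  forall x, a < x -> cderiv (fun y => cintegral `[a, y] g) x (g x).
Proof.
move=> gc a0 x ax; have [i1 i2] := ccont_seg (x + 1) gc a0; have x0 := lt_trans a0 ax.
have xx : x < x + 1 by rewrite ltrDl.
have [c1 c2] := gc x x0.
have [D1 E1] := continuous_FTC1_closed xx i1 ax c1.
have [D2 E2] := continuous_FTC1_closed xx i2 ax c2.
have d1 := DeriveDef D1 (etrans (esym (derive1E _ _)) E1).
have d2 := DeriveDef D2 (etrans (esym (derive1E _ _)) E2).
split; [exact: d1|exact: d2].
Qed.

Lemma cderiv_rcomp g (phi : R -> R) t (d : R[i]) (p : R) : cderiv g (phi t) d ->
  is_derive t (1 : R) phi p -> cderiv (fun x => g (phi x)) t (p%:C * d).
Proof.
move=> [g1 g2] dp; split; rewrite !cReImE ?mul0r ?subr0 ?addr0 mulrC.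
  exact: (is_derive_comp dp g1).
exact: (is_derive_comp dp g2).
Qed.

Lemma Rintegral_cmod_subset (D E : set R) g : measurable D -> measurable E -> D `<=` E ->
  cintegrable E g -> Rintegral lam D (fun x => cmod (g x)) <= Rintegral lam E (fun x => cmod (g x)).
Proof.
move=> mD mE DE ig; have iC := cintegrable_cmod mE ig.
rewrite /Rintegral; apply: fine_le.
- by apply: integrable_fin_num => //; apply: integrableS iC.
- exact: integrable_fin_num.
- apply: ge0_subset_integral => //; first exact: measurable_int iC.
  by move=> s _; rewrite lee_fin cmod_ge0.
Qed.

Section substitution.
Variables (phi psi : R -> R).
Hypotheses (phi0 : forall t, 0 < t -> 0 < phi t)
  (dphi : forall t, 0 < t -> is_derive t (1 : R) phi (psi t))
  (psic : forall t, 0 < t -> {for t, continuous psi})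
  (pm : forall x y, 0 < x -> x <= y -> phi x <= phi y).

Lemma ccont_subst g : (forall t, 0 < t -> ccont g t) ->
  forall t, 0 < t -> ccont (fun t => (psi t)%:C * g (phi t)) t.
Proof.
move=> gc t t0; apply: ccontM; first by split; [exact: psic|exact: cvg_cst].
have [g1 g2] := gc _ (phi0 t0); have pc := is_derive_continuous (dphi t0).
split.
  exact: (@continuous_comp _ _ _ phi (fun x => Re (g x))).
exact: (@continuous_comp _ _ _ phi (fun x => Im (g x))).
Qed.

Lemma csubst_seg g (a b : R) : (forall t, 0 < t -> ccont g t) -> 0 < a -> a <= b ->
  cintegrable `[a, b] (fun t => (psi t)%:C * g (phi t)) /\
  cintegral `[a, b] (fun t => (psi t)%:C * g (phi t)) = cintegral `[phi a, phi b] g.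
Proof.
move=> gc a0 ab.
pose c := phi a / 2; have c0 : 0 < c by rewrite divr_gt0// phi0.
have ca : c < phi a by rewrite ltr_pdivrMr// mulr_natr mulr2n ltrDl phi0.
pose G x := cintegral `[c, x] g.
have dG x : phi a <= x -> cderiv G x (g x).
  by move=> ax; apply: ccont_antideriv => //; exact: lt_le_trans ax.
have [|||_ E1] := @cFTC _ G g (phi a) (phi b); first exact: pm.
- by move=> t /andP[at_ _]; exact: dG.
- by move=> t /andP[at_ _]; apply: gc; exact: lt_le_trans (phi0 a0) at_.
rewrite E1; apply: (@cFTC _ (fun t => G (phi t))) => //.
  move=> t /andP[at_ _]; have t0 := lt_le_trans a0 at_; apply: cderiv_rcomp (dphi t0); apply: dG; exact: pm.
move=> t /andP[at_ _]; exact: ccont_subst (lt_le_trans a0 at_).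
Qed.

Hypotheses (psi0 : forall t, 0 < t -> 0 <= psi t)
  (phis : forall x, 0 < x -> exists2 t, 0 < t & phi t = x).

(** Change of variables by an increasing bijection of the half-line.  On
segments it is the fundamental theorem of calculus; integrability of the left
side comes from the same formula for the modulus of [g]. *)
Lemma csubst_pos g : (forall t, 0 < t -> ccont g t) -> cintegrable posR g ->
  cintegrable posR (fun t => (psi t)%:C * g (phi t)) /\
  cintegral posR (fun t => (psi t)%:C * g (phi t)) = cintegral posR g.
Proof.
move=> gc ig.
pose D (n : nat) : set R := `[phi (expR (- n%:R)), phi n.+1%:R]%classic.
have mD n : measurable (D n) by exact: measurable_itv.
have Dp n : D n `<=` posR.
  move=> x; rewrite /D/= in_itv/= posRE => /andP[h _]; apply: lt_le_trans h; apply: phi0; exact: expR_gt0.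
have iS : cintegrable posR (fun t => (psi t)%:C * g (phi t)).
  apply: (@cintegrable_exhaust _ (Rintegral lam posR (fun x => cmod (g x)))).
  - exact: ccont_meas (ccont_subst gc).
  - by move=> n; exact: ccont_seg (ccont_subst gc) (expR_gt0 _).
  - move=> n.
    have gcm : forall t, 0 < t -> ccont (fun x => (cmod (g x))%:C) t.
      by move=> t t0; exact: ccont_cmod (gc t t0).
    have [_ E] := csubst_seg gcm (expR_gt0 (- n%:R)) (excl_le n).
    have -> : Rintegral lam (excl n) (fun x => cmod ((psi x)%:C * g (phi x))) =
      Rintegral lam (D n) (fun x => cmod (g x)).
      have := congr1 (fun z => Re z) E; rewrite /cintegral/= => <-; apply: eq_Rintegral => x.
      rewrite inE => /excl_pos; rewrite posRE => x0.
      by rewrite cmodM cmodC ger0_norm ?psi0// mul0r subr0.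
    exact: (Rintegral_cmod_subset (mD n) measurable_posR (@Dp n) ig).
split=> //; apply: (ccv_unique (cintegral_exhaust_pos iS)).
have := @cintegral_exhaust _ posR D g measurable_posR mD Dp _ ig => h.
have {}h : ccv \oo (fun n => cintegral (D n) g) (cintegral posR g).
  apply: h => x; rewrite posRE => x0; have [t t0 tx] := phis x0.
  have := excl_near (_ : posR t); rewrite posRE => /(_ t0); apply: filterS => n.
  rewrite exclE /D/= in_itv/= -tx => /andP[h1 h2]; rewrite !pm// expR_gt0//.
apply: eq_ccv h => n.
by have [_ ->] := csubst_seg gc (expR_gt0 (- n%:R)) (excl_le n).
Qed.

End substitution.

End exhaust_pos.

(** * The gamma function and a lower bound for its modulus *)

Section gamma.
Context {R : realType}.
Local Notation lam := (@lebesgue_measure R).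
Local Notation Re := complex.Re.
Local Notation Im := complex.Im.
Implicit Types (s : R[i]) (t x p : R).

Lemma Rintegral_le (D : set R) (f g : R -> R) : measurable D -> lam.-integrable D (EFin \o f) ->
  lam.-integrable D (EFin \o g) -> (forall x, D x -> f x <= g x) ->
  Rintegral lam D f <= Rintegral lam D g.
Proof. by move=> mD fi gi fg; apply: le_Rintegral. Qed.

Lemma Rintegrable_sub (D E : set R) (f : R -> R) : measurable D -> measurable E -> D `<=` E ->
  lam.-integrable E (EFin \o f) -> lam.-integrable D (EFin \o f).
Proof. by move=> mD mE DE fi; apply: integrableS fi. Qed.

Lemma Rintegral_sub (D E : set R) (f : R -> R) : measurable D -> measurable E -> D `<=` E ->
  lam.-integrable E (EFin \o f) -> (forall x, E x -> 0 <= f x) ->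
  Rintegral lam D f <= Rintegral lam E f.
Proof.
move=> mD mE DE fi f0; rewrite /Rintegral; apply: fine_le.
- by apply: integrable_fin_num => //; exact: Rintegrable_sub fi.
- exact: integrable_fin_num.
- by apply: ge0_subset_integral => //; exact: measurable_int fi.
Qed.

(** The integrand of Euler's integral. *)
Definition gint s t : R[i] := cexp (- t%:C) * cpow t%:C (s - 1).
Definition cGamma s := cintegral posR (gint s).

Lemma cmod_gint s t : 0 < t -> cmod (gint s t) = expR (- t) * t `^ (Re s - 1).
Proof. by move=> t0; rewrite cmodM cmod_cexp cmod_cpowC// cReN cReB. Qed.

Lemma cpow_real (p t : R) : 0 < t -> cpow t%:C p%:C = (t `^ p)%:C.
Proof. by move=> t0; rewrite cpowC// -rmorphM cexpC /powR gt_eqF. Qed.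

Lemma gint_real (p t : R) : 0 < t -> gint p%:C t = (expR (- t) * t `^ (p - 1))%:C.
Proof. by move=> t0; rewrite /gint -rmorphN cexpC -[1]/(1%:C) -rmorphB cpow_real// -rmorphM. Qed.

Lemma cderiv_expN t : cderiv (fun x => cexp (- x%:C)) t (- cexp (- t%:C)).
Proof. by apply: cderiv_eq (cderiv_cexp (cderivN (cderiv_id t))) _; rewrite mulN1r. Qed.

Lemma ccont_gint s t : 0 < t -> ccont (gint s) t.
Proof. by move=> t0; exact: cderiv_cont (cderivM (cderiv_expN t) (cderiv_cpow (s - 1) t0)). Qed.

Lemma pow_exp_bound p : 0 <= p -> exists2 C, 0 <= C &
  forall t, 0 < t -> t `^ p * expR (- t) <= C * expR (- (t / 2)).
Proof.
move=> p0; pose N := (Num.truncn p).+1.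
have pN : p <= N%:R by exact: ltW (truncnS_gt _).
exists (N`!%:R * 2 ^+ N * expR (1 / 2)) => [|t t0].
  by rewrite !mulr_ge0// ?exprn_ge0// expR_ge0.
have t1 : 1 <= 1 + t by rewrite lerDl ltW.
have h1 : t `^ p <= N`!%:R * 2 ^+ N * expR ((1 + t) / 2).
  apply: (@le_trans _ _ ((1 + t) `^ p)).
    by apply: ge0_ler_powR => //; rewrite ?nnegrE ?(ltW t0)//; lra.
  apply: le_trans (ler_powR t1 pN) _; rewrite powR_mulrn; last by lra.
  have h : 0 <= (1 + t) / 2 by lra.
  have := exp_coeff_le N h; rewrite expr_div_n ler_pdivrMr ?ltr0n ?fact_gt0// ler_pdivrMr ?exprn_gt0//.
  by have -> : N`!%:R * 2 ^+ N * expR ((1 + t) / 2) = expR ((1 + t) / 2) * N`!%:R * 2 ^+ N by ring.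
apply: le_trans (ler_wpM2r (expR_ge0 _) h1) _.
by rewrite -[leLHS]mulrA -[leRHS]mulrA -!expRD le_eqVlt; apply/orP; left; apply/eqP; congr (_ * expR _); field.
Qed.

Lemma cderiv_gint s t : 0 < t ->
  cderiv (fun t => cpow t%:C s * cexp (- t%:C)) t (s * gint s t - gint (s + 1) t).
Proof.
move=> t0; apply: cderiv_eq (cderivM (cderiv_cpow s t0) (cderiv_expN t)) _.
by rewrite /gint addrK; ring.
Qed.

Lemma ccontZ (c : R[i]) (g : R -> R[i]) t : ccont g t -> ccont (fun x => c * g x) t.
Proof. by apply: ccontM; split; exact: cvg_cst. Qed.

Lemma ccontB (g h : R -> R[i]) t : ccont g t -> ccont h t -> ccont (fun x => g x - h x) t.
Proof. by move=> gc hc; exact: (@ccvB _ _ (nbhs t) _ g h (g t) (h t) gc hc). Qed.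

Lemma gint_excl s n : cintegral (excl n) (fun t => s * gint s t - gint (s + 1) t) =
  cpow n.+1%:R%:C s * cexp (- n.+1%:R%:C) - cpow (expR (- n%:R))%:C s * cexp (- (expR (- n%:R))%:C).
Proof.
have t0 t : expR (- n%:R) <= t <= n.+1%:R -> 0 < t.
  by move=> /andP[h _]; exact: lt_le_trans (expR_gt0 _) h.
have cF t : expR (- n%:R) <= t <= n.+1%:R -> ccont (fun t => s * gint s t - gint (s + 1) t) t.
  move=> h; apply: ccontB; first by apply: ccontZ; apply: ccont_gint; exact: t0.
  by apply: ccont_gint; exact: t0.
by have [_ E] := cFTC (excl_le n) (fun t h => cderiv_gint s (t0 t h)) cF.
Qed.

Lemma gint_seg s n : cintegrable (excl n) (gint s).
Proof. by apply: ccont_seg (expR_gt0 _); move=> t t0; exact: ccont_gint. Qed.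

Lemma exp_half_excl n (C : R) : 0 <= C -> lam.-integrable (excl n) (EFin \o (fun t => C * expR (- (t / 2)))) /\
  Rintegral lam (excl n) (fun t => C * expR (- (t / 2))) <= 2 * C.
Proof.
move=> C0; have h0 : (0 : R) < 2^-1 by rewrite invr_gt0.
have [i1 E1] := Rintegral_expN h0.
have e : (fun t : R => expR (- (t / 2))) = fun t => expR (- (2^-1 * t)).
  by apply/funext => t; rewrite mulrC.
have sub : @excl R n `<=` `[0, +oo[%classic.
  by move=> x /excl_pos; rewrite posRE /= in_itv/= andbT => /ltW.
have i2 : lam.-integrable (excl n) (EFin \o (fun t => expR (- (t / 2)))).
  rewrite e; exact: (Rintegrable_sub (measurable_excl n) (measurable_itv _) sub i1).
split; first exact: RintegrableZ (measurable_excl n) i2.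
rewrite RintegralZl; [|exact: measurable_excl|exact: i2].
rewrite mulrC; apply: ler_wpM2r => //; rewrite -[leRHS]invrK -E1 e.
by apply: (Rintegral_sub (measurable_excl n) (measurable_itv _) sub i1) => t _; exact: expR_ge0.
Qed.

(** On a segment, integration by parts expresses [Re s] times the
integral of the modulus by the integral with exponent [Re s + 1], which
decays like [exp (- t / 2)] and has no singularity at 0, plus boundary
terms. *)
Lemma gint_integrable s : 0 < Re s -> cintegrable posR (gint s).
Proof.
move=> s0; set p := Re s; have [C C0 hC] := pow_exp_bound (ltW s0).
apply: (@cintegrable_exhaust _ _ ((C + 2 * C) / p)).
- exact: ccont_meas (ccont_gint s).
- exact: gint_seg.
move=> n; have mE := @measurable_excl R n; rewrite ler_pdivlMr// mulrC.
have i1 := gint_seg p%:C n; have i2 := gint_seg (p%:C + 1) n.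
have := gint_excl p%:C n; rewrite cintegralB//; last exact: cintegrableZ.
rewrite cintegralZ// => /(congr1 (fun z => Re z)).
have p1E : p%:C + 1 = (p + 1)%:C :> R[i] by rewrite rmorphD.
rewrite cReB cReM [Re p%:C]/= [Im p%:C]/= mul0r subr0 /cintegral [Re (_ +i* _)]/= [X in _ - X]/=.
have -> : Rintegral lam (excl n) (fun t => Re (gint p%:C t)) = Rintegral lam (excl n) (fun t => cmod (gint s t)).
  apply: eq_Rintegral => t; rewrite inE => /excl_pos; rewrite posRE => t0.
  by rewrite gint_real// cmod_gint.
move=> E.
have h1 : Rintegral lam (excl n) (fun t => Re (gint (p%:C + 1) t)) <= 2 * C.
  have [iB hB] := exp_half_excl n C0; apply: le_trans hB.
  apply: (Rintegral_le mE _ iB); first by case: i2.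
  move=> t /excl_pos; rewrite posRE => t0.
  by rewrite p1E gint_real//= addrK mulrC hC.
have h2 : Re (cpow n.+1%:R%:C p%:C * cexp (- n.+1%:R%:C) - cpow (expR (- n%:R))%:C p%:C * cexp (- (expR (- n%:R))%:C)) <= C.
  rewrite !cpow_real ?expR_gt0// -!rmorphN !cexpC -!rmorphM -rmorphB/=.
  apply: (@le_trans _ _ (n.+1%:R `^ p * expR (- n.+1%:R))).
    by rewrite gerBl mulr_ge0 ?powR_ge0 ?expR_ge0.
  by apply: le_trans (hC _ _) _ => //; apply: ler_piMr => //; rewrite expR_le1 oppr_le0 divr_ge0.
rewrite -lerBlDr; apply: le_trans (lerB (lexx _) h1) _; rewrite -E in h2.
lra.
Qed.

(** Integration by parts on the segments [excl n]; the boundary terms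
vanish in the limit. *)
Lemma cGammaS s : 0 < Re s -> cGamma (s + 1) = s * cGamma s.
Proof.
move=> s0; have s10 : 0 < Re (s + 1) by rewrite cReD cRe1 addr_gt0.
have i1 := gint_integrable s0; have i2 := gint_integrable s10.
apply/esym/eqP; rewrite -subr_eq0; apply/eqP.
have mP := @measurable_posR R; have iZ := cintegrableZ s mP i1.
rewrite /cGamma -cintegralZ// -cintegralB//.
apply: (ccv_unique (cintegral_exhaust_pos (cintegrableB mP iZ i2))).
have [C C0 hC] := pow_exp_bound (ltW s0).
apply: (@ccv_squeeze _ _ _ _ _ _ (fun n => C * expR (- 2^-1) ^+ n + expR (- Re s) ^+ n)).
  near=> n; rewrite gint_excl subr0; apply: le_trans (cmodB _ _) _; apply: lerD.
    rewrite cmodM cmod_cpowC// cmod_cexp cReN; apply: le_trans (hC _ _) _ => //.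
    by apply: ler_wpM2l => //; rewrite -expRM_natl ler_expR -natr1; have := ler0n R n; lra.
  rewrite cmodM cmod_cpowC ?expR_gt0// cmod_cexp cReN/= -[leRHS]mulr1; apply: ler_pM.
  - exact: powR_ge0.
  - exact: expR_ge0.
  - by rewrite /powR gt_eqF ?expR_gt0// expRK -expRM_natl ler_expR; lra.
  - by rewrite expR_le1 oppr_le0 expR_ge0.
rewrite -[X in _ --> X](addr0 0) -[X in X + _](mulr0 C); apply: cvgD.
  by apply: cvgMr; apply: cvg_expr; rewrite ger0_norm ?expR_ge0// expR_lt1 oppr_lt0 invr_gt0.
by apply: cvg_expr; rewrite ger0_norm ?expR_ge0// expR_lt1 oppr_lt0.
Unshelve. all: by end_near. Qed.

Definition rGamma p := Rintegral lam posR (fun t => expR (- t) * t `^ (p - 1)).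

Lemma cGamma_real p : cGamma p%:C = (rGamma p)%:C.
Proof.
apply: ceqP; rewrite /cGamma /cintegral/=; last first.
  rewrite (_ : Rintegral _ _ _ = Rintegral lam posR (fun=> 0)).
    by rewrite /Rintegral integral0.
  by apply: eq_Rintegral => t; rewrite inE posRE => t0; rewrite gint_real.
by apply: eq_Rintegral => t; rewrite inE posRE => t0; rewrite gint_real.
Qed.

Lemma rGamma_integrable p : 0 < p -> lam.-integrable posR (EFin \o (fun t => expR (- t) * t `^ (p - 1))).
Proof.
move=> p0; have := cintegrable_cmod measurable_posR (gint_integrable (_ : 0 < Re p%:C)) => /(_ p0).
by apply: eq_Rintegrable => [|t]; [exact: measurable_posR|rewrite posRE => t0; rewrite cmod_gint].
Qed.

Lemma rGammaS p : 0 < p -> rGamma (p + 1) = p * rGamma p.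
Proof.
move=> p0; have := @cGammaS p%:C p0; rewrite (_ : p%:C + 1 = (p + 1)%:C); last by rewrite rmorphD.
by rewrite !cGamma_real -rmorphM => /(congr1 (fun z => Re z)).
Qed.

Lemma rGamma_gt0 p : 0 < p -> 0 < rGamma p.
Proof.
move=> p0; have h1 q : 1 <= q -> 0 < rGamma q.
  move=> q1; have q0 := lt_le_trans ltr01 q1.
  have sub : `[1, 2]%classic `<=` (@posR R).
    by move=> x /=; rewrite in_itv/= posRE => /andP[h _]; exact: lt_le_trans h.
  have mI : measurable (`[1, 2]%classic : set R) by exact: measurable_itv.
  have i1 := rGamma_integrable q0.
  have i2 : lam.-integrable `[1, 2] (EFin \o (fun t => expR (- t) * t `^ (q - 1))).
    exact: (Rintegrable_sub mI measurable_posR sub i1).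
  apply: (@lt_le_trans _ _ (Rintegral lam `[1, 2] (fun t => expR (- t) * t `^ (q - 1)))); last first.
    apply: (Rintegral_sub mI measurable_posR sub i1) => t _.
    by rewrite mulr_ge0 ?expR_ge0 ?powR_ge0.
  apply: (@lt_le_trans _ _ (expR (-2))); first exact: expR_gt0.
  have -> : expR (-2) = Rintegral lam `[1, 2] (fun=> expR (-2)) :> R.
    rewrite Rintegral_cst//; apply: (etrans _ (esym (congr1 (fun z => _ * fine z) (@lebesgue_measure_itv R `[1, 2])))).
    by rewrite /= lte_fin ltr1n/=; ring.
  apply: (Rintegral_le mI _ i2).
    by have [] := @ccont_seg _ (fun=> (expR (-2))%:C) 1 2 (fun t _ => cderiv_cont (cderiv_cst _ t)) ltr01.
  move=> t /=; rewrite in_itv/= => /andP[t1 t2]; rewrite -[leLHS]mulr1; apply: ler_pM => //.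
  - by rewrite ler_expR lerN2.
  - by rewrite -[leLHS](powRr0 t); apply: ler_powR => //; rewrite subr_ge0.
have := h1 (p + 1); rewrite lerDr (ltW p0) rGammaS// => /(_ isT); by rewrite pmulr_rgt0.
Qed.

(** Integrate [cos <= 1] twice. *)
Lemma cos_ge (x : R) : 1 - x ^+ 2 / 2 <= cos x.
Proof.
suff key (y : R) : 0 <= y -> 1 - y ^+ 2 / 2 <= cos y.
  by case: (leP 0 x) => [/key//|x0]; have := key (- x); rewrite cosN sqrrN; apply; rewrite oppr_ge0 ltW.
move=> y0.
have d1 t : is_derive t (1 : R) (fun t => t - sin t) (1 - cos t).
  exact: is_derive_sub.
have d2 t : is_derive t (1 : R) (fun t => cos t + t ^+ 2 / 2) (t - sin t).
  apply: is_derive_val (is_derive_add (is_derive_cos t) (is_derive_mul (is_derive_sqr (is_derive_id t 1)) (is_derive_cst (2^-1 : R) t 1))) => /=.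
  by field.
have s1 t : 0 <= t -> 0 <= t - sin t.
  move=> t0; have [i E] := @cFTC R (fun t => (t - sin t)%:C) (fun t => (1 - cos t)%:C) 0 t t0
    (fun t _ => cderiv_real (d1 t)) (fun t _ => cderiv_cont (cderiv_real (is_derive_sub (is_derive_cst (1 : R) t (1 : R)) (is_derive_cos t)))).
  have := congr1 (fun z => Re z) E; rewrite /= sin0 subrr subr0 /cintegral/= => <-.
  by apply: Rintegral_ge0 => v _; rewrite subr_ge0 cos_le1.
have [i E] := @cFTC R (fun t => (cos t + t ^+ 2 / 2)%:C) (fun t => (t - sin t)%:C) 0 y y0
    (fun t _ => cderiv_real (d2 t)) (fun t _ => cderiv_cont (cderiv_real (d1 t))).
have := congr1 (fun z => Re z) E; rewrite /= cos0 expr0n/= mul0r addr0 /cintegral/= => E'.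
have : 0 <= Rintegral lam `[0, y] (fun t => t - sin t).
  by apply: Rintegral_ge0 => v /=; rewrite in_itv/= => /andP[v0 _]; exact: s1.
rewrite E'; lra.
Qed.

Lemma ln_sqr_le (x : R) : 0 < x -> ln x ^+ 2 <= (x - 1) ^+ 2 + (x^-1 - 1) ^+ 2.
Proof.
have key (y : R) : 1 <= y -> ln y ^+ 2 <= (y - 1) ^+ 2.
  move=> y1; have y0 := lt_le_trans ltr01 y1; apply: lerXn2r; rewrite ?nnegrE ?subr_ge0 ?ln_ge0//.
  have := expR_ge1Dx (ln y); rewrite lnK ?posrE//; lra.
move=> x0; case: (leP 1 x) => x1; first by apply: le_trans (key x x1) _; rewrite lerDl sqr_ge0.
apply: (@le_trans _ _ ((x^-1 - 1) ^+ 2)); last by rewrite lerDr sqr_ge0.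
have := key x^-1; rewrite lnV ?posrE// sqrrN; apply.
by rewrite invf_ge1// ltW.
Qed.

Definition gpow (q t : R) : R := expR (- t) * t `^ (q - 1).

Lemma gpow_ge0 q t : 0 <= gpow q t.
Proof. by rewrite mulr_ge0 ?expR_ge0 ?powR_ge0. Qed.

Lemma gpowS q t : 0 < t -> gpow (q + 1) t = t * gpow q t.
Proof.
move=> t0; rewrite /gpow addrK mulrCA; congr (_ * _).
by rewrite -[X in X * _](powRr1 (ltW t0)) -powRD ?(gt_eqF t0) ?implybT//; congr (_ `^ _); ring.
Qed.

Lemma gpow_cintegral q : 0 < q ->
  cintegrable posR (fun t => (gpow q t)%:C) /\ cintegral posR (fun t => (gpow q t)%:C) = (rGamma q)%:C.
Proof.
move=> q0; split.
  have mP := @measurable_posR R; split; first exact: rGamma_integrable.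
  by have [] := cintegrable0 mP.
by apply: ceqP => //=; rewrite /cintegral/= /Rintegral integral0.
Qed.

(** A lower bound of [gpow p t * cos (tau * ln (t / p))], obtained from
[cos x >= 1 - x^2/2] and [(ln y)^2 <= (y - 1)^2 + (1/y - 1)^2] with
[y = t / p].  It is a combination of shifted gamma integrands, so its
integral is explicit. *)
Definition gamma_minorant (p tau t : R) := gpow p t - tau ^+ 2 / 2 *
  (((p^-2 * gpow (p + 1 + 1) t - 2 / p * gpow (p + 1) t) + gpow p t) +
   ((p ^+ 2 * gpow (p - 1 - 1) t - 2 * p * gpow (p - 1) t) + gpow p t)).

Lemma gamma_minorant_integral (p tau : R) : 2 < p ->
  lam.-integrable posR (EFin \o gamma_minorant p tau) /\ Rintegral lam posR (gamma_minorant p tau) =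
    rGamma p * (1 - tau ^+ 2 / 2 * (p^-1 + (p + 2) / ((p - 1) * (p - 1 - 1)))).
Proof.
move=> p2; have mP := @measurable_posR R.
have g0 : 0 < p by lra.
have g1 : 0 < p + 1 by lra.
have g2 : 0 < p + 1 + 1 by lra.
have g3 : 0 < p - 1 by lra.
have g4 : 0 < p - 1 - 1 by lra.
have r1 : rGamma (p + 1 + 1) = (p + 1) * p * rGamma p by rewrite !rGammaS// mulrA.
have r2 : rGamma (p + 1) = p * rGamma p by rewrite rGammaS.
have r3 : rGamma (p - 1) = rGamma p / (p - 1).
  by have := rGammaS g3; rewrite subrK => ->; field; rewrite gt_eqF.
have r4 : rGamma (p - 1 - 1) = rGamma p / ((p - 1) * (p - 1 - 1)).
  by have := rGammaS g4; rewrite subrK r3 => h; apply: (mulfI (lt0r_neq0 g4)); rewrite -h; field; rewrite !gt_eqF.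
rewrite [X in _ /\ _ = X](_ : _ = rGamma p - tau ^+ 2 / 2 * (((p^-2 * rGamma (p + 1 + 1) - 2 / p * rGamma (p + 1)) + rGamma p) +
   ((p ^+ 2 * rGamma (p - 1 - 1) - 2 * p * rGamma (p - 1)) + rGamma p))); last first.
  by rewrite r1 r2 r3 r4; clear -g0 g3 g4; move: (rGamma p) => G; field; rewrite !gt_eqF.
clear r1 r2 r3 r4.
have [a1 b1] := gpow_cintegral g0; have [a2 b2] := gpow_cintegral g1; have [a3 b3] := gpow_cintegral g2.
have [a4 b4] := gpow_cintegral g3; have [a5 b5] := gpow_cintegral g4.
have A1 := cintegrableD mP (cintegrableB mP (cintegrableZ (p^-2)%:C mP a3) (cintegrableZ (2 / p)%:C mP a2)) a1.
have A2 := cintegrableD mP (cintegrableB mP (cintegrableZ (p ^+ 2)%:C mP a5) (cintegrableZ (2 * p)%:C mP a4)) a1.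
have A3 := cintegrableB mP a1 (cintegrableZ (tau ^+ 2 / 2)%:C mP (cintegrableD mP A1 A2)).
have LE : (fun t => Re ((gpow p t)%:C - (tau ^+ 2 / 2)%:C * ((((p^-2)%:C * (gpow (p + 1 + 1) t)%:C - (2 / p)%:C * (gpow (p + 1) t)%:C) + (gpow p t)%:C) +
   (((p ^+ 2)%:C * (gpow (p - 1 - 1) t)%:C - (2 * p)%:C * (gpow (p - 1) t)%:C) + (gpow p t)%:C)))) = gamma_minorant p tau.
  by apply/funext => t; rewrite -!(rmorphM, rmorphB, rmorphD).
have IE := cintegralB mP a1 (cintegrableZ (tau ^+ 2 / 2)%:C mP (cintegrableD mP A1 A2)).
rewrite cintegralZ in IE; [|exact: mP|exact: (cintegrableD mP A1 A2)].
rewrite (cintegralD mP A1 A2) in IE.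
rewrite (cintegralD mP (cintegrableB mP (cintegrableZ (p^-2)%:C mP a3) (cintegrableZ (2 / p)%:C mP a2)) a1) in IE.
rewrite (cintegralD mP (cintegrableB mP (cintegrableZ (p ^+ 2)%:C mP a5) (cintegrableZ (2 * p)%:C mP a4)) a1) in IE.
rewrite (cintegralB mP (cintegrableZ (p^-2)%:C mP a3) (cintegrableZ (2 / p)%:C mP a2)) in IE.
rewrite (cintegralB mP (cintegrableZ (p ^+ 2)%:C mP a5) (cintegrableZ (2 * p)%:C mP a4)) in IE.
rewrite (cintegralZ _ mP a2) (cintegralZ _ mP a3) (cintegralZ _ mP a4) (cintegralZ _ mP a5) b1 b2 b3 b4 b5 in IE.
have [A3r _] := A3; split; first by rewrite -LE; exact: A3r.
have := congr1 (fun z => Re z) IE; rewrite -!(rmorphM, rmorphB, rmorphD) /cintegral [Re (_ +i* _)]/= LE => ->.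
by [].
Qed.

Lemma gamma_minorant_le (p tau t : R) : 0 < p -> 0 < t -> gamma_minorant p tau t <= gpow p t * cos (tau * ln (t / p)).
Proof.
move=> p0 t0; apply: le_trans (ler_wpM2l (gpow_ge0 p t) (cos_ge _)).
have e1 : gpow (p + 1) t = t * gpow p t by exact: gpowS.
have e2 : gpow (p + 1 + 1) t = t ^+ 2 * gpow p t by rewrite !gpowS// mulrA.
have e3 : gpow (p - 1) t = t^-1 * gpow p t by rewrite -[p in RHS](subrK 1) gpowS// mulrA mulVf ?mul1r// gt_eqF.
have e4 : gpow (p - 1 - 1) t = t ^- 2 * gpow p t.
  by apply: (mulfI (lt0r_neq0 t0)); rewrite -gpowS// subrK e3; field; rewrite gt_eqF.
rewrite /gamma_minorant e1 e2 e3 e4.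
have := ln_sqr_le (divr_gt0 t0 p0); rewrite invf_div => h.
have h2 : tau ^+ 2 / 2 * gpow p t * ln (t / p) ^+ 2 <= tau ^+ 2 / 2 * gpow p t * ((t / p - 1) ^+ 2 + (p / t - 1) ^+ 2).
  by apply: ler_wpM2l => //; rewrite mulr_ge0 ?gpow_ge0// divr_ge0// sqr_ge0.
rewrite (_ : _ - _ = gpow p t - tau ^+ 2 / 2 * gpow p t * ((t / p - 1) ^+ 2 + (p / t - 1) ^+ 2)); last first.
  by clear -p0 t0; move: (gpow p t) => G; field; rewrite !gt_eqF.
rewrite exprMn (_ : gpow p t * _ = gpow p t - tau ^+ 2 / 2 * gpow p t * ln (t / p) ^+ 2); last first.
  by clear; move: (gpow p t) (ln _) => G l; field.
by rewrite lerD2l lerN2.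
Qed.

(** The correction is of order [tau^2 / p], since the two variances
are of order [1 / p]. *)
Lemma gamma_half_arith (p tau : R) : 4 <= p -> 5 * tau ^+ 2 <= p ->
  tau ^+ 2 / 2 * (p^-1 + (p + 2) / ((p - 1) * (p - 1 - 1))) <= 2^-1.
Proof.
move=> p4 tp; have p0 : 0 < p by lra.
have p1 : 0 < p - 1 by lra.
have p2 : 0 < p - 1 - 1 by lra.
have q1 : (p + 2) / ((p - 1) * (p - 1 - 1)) <= 4 / p.
  rewrite ler_pdivrMr ?mulr_gt0// mulrAC ler_pdivlMr// -subr_ge0.
  rewrite (_ : _ - _ = (3 * p - 2) * (p - 4)); last by ring.
  by apply: mulr_ge0; lra.
apply: (@le_trans _ _ (tau ^+ 2 / 2 * (5 / p))).
  apply: ler_wpM2l; first by rewrite divr_ge0// sqr_ge0.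
  by rewrite (_ : 5 / p = p^-1 + 4 / p); [rewrite lerD2l|field; rewrite gt_eqF].
rewrite (_ : _ * _ = (5 * tau ^+ 2 / p) / 2); last by field; rewrite gt_eqF.
by rewrite -[leRHS]mul1r ler_wpM2r// ler_pdivrMr// mul1r.
Qed.

(** Multiplication by the unimodular constant [p^(- i tau)] centres the
oscillation [t^(i tau)] at [t = p], where the gamma density of parameter [p]
concentrates. *)
Lemma gint_rotate s t : 0 < t ->
  Re (cexp (- ((s - (Re s)%:C) * (ln (Re s))%:C)) * gint s t) =
  gpow (Re s) t * cos (Im s * (ln t - ln (Re s))).
Proof.
move=> t0; rewrite /gint cpowC// mulrCA -cexpD -rmorphN cexpC.
set X := (X in cexp X).
have reX : Re X = (Re s - 1) * ln t.
  by rewrite /X; move: (ln t) (ln (Re s)) => a b; rewrite !cReImE; ring.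
have imX : Im X = Im s * (ln t - ln (Re s)).
  by rewrite /X; move: (ln t) (ln (Re s)) => a b; rewrite !cReImE; ring.
by rewrite cReM cReC cImC mul0r subr0 /cexp reX imX [Re (_ +i* _)]/= /gpow /powR gt_eqF// mulrA.
Qed.

(** For [Re s] large compared with [(Im s)^2] the oscillating factor is
nearly constant where the gamma density has its mass, so the integral loses at
most half of its modulus. *)
Lemma cGamma_ge_half s : 4 <= Re s -> 5 * Im s ^+ 2 <= Re s -> rGamma (Re s) <= 2 * cmod (cGamma s).
Proof.
move=> p4 tp; have s0 : 0 < Re s by apply: lt_le_trans p4.
have ig := gint_integrable s0; have mP := @measurable_posR R.
pose w := cexp (- ((s - (Re s)%:C) * (ln (Re s))%:C)).
have w1 : cmod w = 1.
  by rewrite cmod_cexp !cReImE subrr mul0r mulr0 subr0 oppr0 expR0.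
have p2 : 2 < Re s by lra.
have [iL EL] := gamma_minorant_integral (Im s) p2.
have iw := cintegrableZ w mP ig.
have h1 : Rintegral lam posR (gamma_minorant (Re s) (Im s)) <= cmod (cGamma s).
  apply: (@le_trans _ _ (Re (cintegral posR (fun t => w * gint s t)))).
    apply: (Rintegral_le mP iL); first by case: iw.
    move=> t; rewrite posRE => t0; rewrite gint_rotate// -lnV ?posrE// -lnM ?posrE ?invr_gt0//.
    exact: gamma_minorant_le.
  apply: le_trans (ler_norm _) _; apply: le_trans (Re_le_cmod _) _.
  by rewrite cintegralZ// cmodM w1 mul1r.
have G0 := rGamma_gt0 s0.
have := ler_wpM2l (ltW G0) (gamma_half_arith p4 tp).
rewrite EL mulrBr mulr1 in h1.
move=> h2; clear -h1 h2.
move: (rGamma (Re s)) (cmod (cGamma s)) h1 h2 => G C; move: (G * _) => x; lra.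
Qed.

End gamma.

(** * The k-gamma function and Laplace transforms of powers *)

Section cGamma_ge_ratio.
Context {R : realType}.
Local Notation lam := (@lebesgue_measure R).
Local Notation Re := complex.Re.
Local Notation Im := complex.Im.
Implicit Types (s v : R[i]) (t x p : R).

Lemma ReDn s n : Re (s + n%:R) = Re s + n%:R.
Proof. by rewrite cReD cRe_nat. Qed.
Lemma ImDn s n : Im (s + n%:R) = Im s.
Proof. by rewrite cImD cIm_nat addr0. Qed.

Lemma cGammaDn s n : 0 < Re s -> cGamma (s + n%:R) = risefac s n * cGamma s.
Proof.
move=> s0; elim: n => [|n IH]; first by rewrite addr0 /risefac big_ord0 mul1r.
rewrite -natr1 addrA cGammaS; last by rewrite ReDn ltr_wpDr.
by rewrite IH risefacS mulrCA mulrA.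
Qed.

Lemma sum_inv_sqr p n : 0 < p -> \sum_(j < n) (p + j%:R) ^- 2 <= p^-1 + p ^- 2.
Proof.
move=> p0.
have key m : \sum_(j < m.+1) (p + j%:R) ^- 2 <= p^-1 + p ^- 2 - (p + m%:R)^-1.
  elim: m => [|m IH]; first by rewrite big_ord1 addr0 addrAC subrr add0r.
  rewrite big_ord_recr/=; apply: le_trans (lerD IH (lexx _)) _.
  rewrite -natr1 addrA; have q0 : 0 < p + m%:R by rewrite ltr_wpDr.
  move: (p + m%:R) q0 => q q0; rewrite -addrA lerD2l.
  have h : (q + 1) ^- 2 <= q^-1 - (q + 1)^-1.
    rewrite (_ : q^-1 - _ = (q * (q + 1))^-1); last by field; rewrite !gt_eqF ?addr_gt0.
    rewrite lef_pV2 ?posrE ?mulr_gt0 ?exprn_gt0 ?addr_gt0// expr2 ler_pM2r ?addr_gt0//; lra.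
  lra.
case: n => [|n]; first by rewrite big_ord0 addr_ge0// ?invr_ge0 ?exprn_ge0// ltW.
by apply: le_trans (key n) _; rewrite gerBl invr_ge0 addr_ge0// ltW.
Qed.

(** From [|q + i y| <= q exp (y^2 / (2 q^2))] in each factor and the
convergence of [sum_j (p + j)^-2]. *)
Lemma cmod_risefac_le s n : 0 < Re s ->
  cmod (risefac s n) <= \prod_(j < n) (Re s + j%:R) * expR (Im s ^+ 2 / 2 * ((Re s)^-1 + (Re s) ^- 2)).
Proof.
move=> s0; have pj j : 0 < Re s + j%:R by rewrite ltr_wpDr.
have h j : cmod (s + j%:R) <= (Re s + j%:R) * expR (Im s ^+ 2 / 2 * (Re s + j%:R) ^- 2).
  rewrite cmodE ReDn ImDn; have := pj j; move: (Re s + j%:R) (Im s) => q y q0.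
  apply: (@le_trans _ _ (Num.sqrt ((q * expR (y ^+ 2 / 2 * q ^- 2)) ^+ 2))); last first.
    by rewrite sqrtr_sqr ger0_norm// mulr_ge0 ?expR_ge0// ltW.
  rewrite ler_sqrt ?sqr_ge0// exprMn -expRM_natl.
  have := expR_ge1Dx (2%:R * (y ^+ 2 / 2 * q ^- 2)) => /(ler_wpM2l (sqr_ge0 q)); apply: le_trans.
  by rewrite le_eqVlt; apply/orP; left; apply/eqP; field; rewrite gt_eqF.
rewrite /risefac cmod_prod; apply: (@le_trans _ _ (\prod_(j < n) ((Re s + j%:R) * expR (Im s ^+ 2 / 2 * (Re s + j%:R) ^- 2)))).
  by apply: ler_prod => j _; rewrite cmod_ge0 h.
rewrite big_split/=; apply: ler_wpM2l.
  by apply: prodr_ge0 => j _; rewrite ltW.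
rewrite -expR_sum ler_expR -mulr_sumr; apply: ler_wpM2l; last exact: sum_inv_sqr.
by rewrite divr_ge0// sqr_ge0.
Qed.

(** Shift [s] by a large integer, where [cGamma_ge_half] applies, and
come back with the functional equation; the rising factorials for [s] and
[Re s] differ by a bounded factor. *)
Lemma cGamma_ge_ratio s : 0 < Re s ->
  rGamma (Re s) <= 2 * expR (Im s ^+ 2 / 2 * ((Re s)^-1 + (Re s) ^- 2)) * cmod (cGamma s).
Proof.
(* A shift large enough for both hypotheses of [cGamma_ge_half]. *)
move=> s0; pose n := (Num.truncn (4 + 5 * Im s ^+ 2)).+1.
have nb : 4 + 5 * Im s ^+ 2 <= n%:R by exact: ltW (truncnS_gt _).
have y0 := sqr_ge0 (Im s).
have h := @cGamma_ge_half _ (s + n%:R); rewrite ReDn ImDn in h.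
have {}h : rGamma (Re s + n%:R) <= 2 * cmod (cGamma (s + n%:R)) by apply: h; lra.
have rG : rGamma (Re s + n%:R) = \prod_(j < n) (Re s + j%:R) * rGamma (Re s).
  have := @cGammaDn (Re s)%:C n s0; rewrite risefac_real -natC -rmorphD !cGamma_real -rmorphM.
  by move=> /(congr1 (fun z => Re z)).
move: h; rewrite rG cGammaDn// cmodM => h.
have P0 : 0 < \prod_(j < n) (Re s + j%:R) by apply: prodr_gt0 => j _; rewrite ltr_wpDr.
rewrite -(ler_pM2l P0); apply: le_trans h _.
have := ler_wpM2r (cmod_ge0 (cGamma s)) (cmod_risefac_le n s0).
move: (cmod (risefac _ _)) (\prod_(j < n) _) (expR _) (cmod (cGamma s)) => a b c d h.
have := ler_wpM2l (ler0n R 2) h; rewrite (_ : b * (2 * c * d) = 2 * (b * c * d)); last by ring.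
by [].
Qed.

Lemma cGamma_neq0 s : 0 < Re s -> cGamma s != 0.
Proof.
move=> s0; apply/eqP => G0; have := cGamma_ge_ratio s0; rewrite G0 cmod0 mulr0 leNgt.
by rewrite rGamma_gt0.
Qed.

Lemma powsubst (c ka : R) (g : R -> R[i]) : 0 < c -> 0 < ka ->
  (forall t, 0 < t -> ccont g t) -> cintegrable posR g ->
  cintegrable posR (fun t => (c * (ka * t `^ (ka - 1)))%:C * g (c * t `^ ka)) /\
  cintegral posR (fun t => (c * (ka * t `^ (ka - 1)))%:C * g (c * t `^ ka)) = cintegral posR g.
Proof.
move=> c0 k0; apply: (@csubst_pos R (fun t => c * t `^ ka) (fun t => c * (ka * t `^ (ka - 1)))).
- by move=> t t0; rewrite mulr_gt0// powR_gt0.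
- move=> t t0; apply: is_derive_val (is_derive_mul (is_derive_cst c t (1 : R)) (is_derive1_powR ka t0)).
  by rewrite mul0r add0r.
- move=> t t0; apply: is_derive_continuous.
  exact: (is_derive_mul (is_derive_cst c t (1 : R)) (is_derive_mul (is_derive_cst ka t (1 : R)) (is_derive1_powR (ka - 1) t0))).
- move=> x y x0 xy; rewrite ler_pM2l// ge0_ler_powR// ?nnegrE ?ltW//; exact: lt_le_trans xy.
- by move=> t t0; rewrite !mulr_ge0 ?powR_ge0// ltW.
- move=> x x0; exists ((x / c) `^ ka^-1); first by rewrite powR_gt0// divr_gt0.
  by rewrite -powRrM mulVf ?gt_eqF// powRr1 ?divr_ge0 ?ltW// mulrC divfK// gt_eqF.
Qed.

Lemma kGammaE (k : R) s : 0 < k -> 0 < Re s ->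
  kGamma k (k%:C * s) = cpow k%:C (s - 1) * cGamma s.
Proof.
move=> k0 s0; have ki : 0 < k^-1 by rewrite invr_gt0.
have [i1 E1] := powsubst ki k0 (ccont_gint s) (gint_integrable s0).
rewrite /cGamma -E1 -(cintegralZ _ (@measurable_posR R) i1).
rewrite /kGamma -/posR; apply: eq_cintegral => t; rewrite inE posRE => t0.
have tk : 0 < t `^ k by exact: powR_gt0.
have kt0 : 0 < k^-1 * t `^ k by exact: mulr_gt0.
rewrite /gint (mulrA k^-1) mulVf ?gt_eqF// mul1r -cpow_real// [k^-1 * _]mulrC.
rewrite [k^-1 * _]mulrC in kt0.
rewrite (cpowC _ kt0) !cpowC// lnM ?posrE// lnV ?posrE// ln_powR -!cexpD.
congr cexp; move: (ln t) (ln k) => a b; rewrite !(rmorphM, rmorphB, rmorphD, rmorphN)/=.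
by ring.
Qed.

Lemma gint_scale (c : R) s : 0 < c -> 0 < Re s ->
  cintegrable posR (fun t => cexp (- (c * t)%:C) * cpow t%:C (s - 1)) /\
  cintegral posR (fun t => cexp (- (c * t)%:C) * cpow t%:C (s - 1)) = cpow c%:C (- s) * cGamma s.
Proof.
move=> c0 s0; have [i1 E1] := powsubst c0 ltr01 (ccont_gint s) (gint_integrable s0).
have e t : posR t -> cexp (- (c * t)%:C) * cpow t%:C (s - 1) =
    cpow c%:C (- s) * ((c * (1 * t `^ (1 - 1)))%:C * gint s (c * t `^ 1)).
  rewrite posRE => t0; rewrite subrr powRr0 powRr1 ?ltW// mulr1 mulr1 /gint.
  have cn := RCneq0 c0; have tn := RCneq0 t0.
  rewrite [(c * t)%:C]rmorphM/= (cpowZ _ c0 tn) (cpowD _ _ cn) !cpowN// cpow1//.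
  by field; rewrite cn cpow_neq0.
split.
  apply: (@eq_cintegrable _ _ (fun t => cpow c%:C (- s) * ((c * (1 * t `^ (1 - 1)))%:C * gint s (c * t `^ 1)))).
  - exact: measurable_posR.
  - by move=> t; rewrite inE => /e ->.
  - by apply: cintegrableZ => //; exact: measurable_posR.
rewrite /cGamma -E1 -(cintegralZ _ (@measurable_posR R) i1).
by apply: eq_cintegral => t; rewrite inE => /e.
Qed.

(** For real [v] this is a scaling.  A complex [v] is written as
[c (1 + z)] with [c > 0] and [|z| < 1]; expanding [exp (- c z t)] and
integrating termwise gives the binomial series of [(1 + z)^(- s)].  This
takes the place of a rotation of the contour. *)
Lemma lap_pow s v : 0 < Re s -> 0 < Re v ->
  cintegrable posR (fun t => cexp (- (v * t%:C)) * cpow t%:C (s - 1)) /\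
  cintegral posR (fun t => cexp (- (v * t%:C)) * cpow t%:C (s - 1)) = cGamma s * cpow v (- s).
Proof.
move=> s0 v0; have vn := Re_gt0_neq0 v0.
(* Here [c Re v = |v|^2], so [|v - c|^2 = c^2 - c Re v < c^2]. *)
pose c := cmod v ^+ 2 / Re v; have c0 : 0 < c by rewrite divr_gt0// exprn_gt0// cmod_gt0.
have cn : c%:C != 0 :> R[i] := RCneq0 c0.
pose z := v / c%:C - 1.
have zE : v = c%:C * (1 - - z) by rewrite /z; field.
have z1 : cmod (- z) < 1.
  rewrite cmodN -(@ltr_pM2l _ c)// mulr1 -{1}(gtr0_norm c0) -cmodC -cmodM.
  have -> : c%:C * z = v - c%:C by rewrite /z; field.
  rewrite -(@ltr_pXn2r _ 2) ?nnegrE ?cmod_ge0 ?ltW//.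
  have sq (w : R[i]) : cmod w ^+ 2 = Re w ^+ 2 + Im w ^+ 2.
    by rewrite cmodE sqr_sqrtr// addr_ge0// sqr_ge0.
  rewrite sq cReB cImB cReC cImC subr0.
  have : c * Re v = Re v ^+ 2 + Im v ^+ 2 by rewrite /c divfK ?gt_eqF// sq.
  have := mulr_gt0 c0 v0; rewrite sqrrB; nra.
clearbody z; clearbody c.
have y1 : 0 < c * (1 - cmod z) by rewrite mulr_gt0// subr_gt0 -cmodN.
have [iB _] := @gint_scale _ (Re s)%:C y1 s0.
pose g (j : nat) t : R[i] := (- z) ^+ j / j`!%:R * (c%:C * t%:C) ^+ j * (cexp (- (c * t)%:C) * cpow t%:C (s - 1)).
have sj j : 0 < Re (s + j%:R) by rewrite ReDn ltr_wpDr.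
have gE j t : 0 < t -> g j t = (- z) ^+ j / j`!%:R * c%:C ^+ j * (cexp (- (c * t)%:C) * cpow t%:C (s + j%:R - 1)).
  move=> t0; have tn := RCneq0 t0.
  by rewrite /g exprMn [s + _ - 1]addrAC (cpowD (s - 1) j%:R tn) cpow_nat//; ring.
have [] := @cintegral_series R posR g (fun t => cexp (- (v * t%:C)) * cpow t%:C (s - 1))
   (fun t => cmod (cexp (- (c * (1 - cmod z) * t)%:C) * cpow t%:C ((Re s)%:C - 1))) (@measurable_posR R).
- move=> j; have [i1 _] := gint_scale c0 (sj j).
  apply: eq_cmeas (cintegrable_meas (cintegrableZ ((- z) ^+ j / j`!%:R * c%:C ^+ j) (@measurable_posR R) i1)).
  by move=> t; rewrite inE posRE => t0; rewrite gE.
- exact: cintegrable_cmod (@measurable_posR R) iB.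
- move=> n t; rewrite posRE => t0.
  have -> : cmod (cexp (- (c * (1 - cmod z) * t)%:C) * cpow t%:C ((Re s)%:C - 1)) =
     expR (cmod z * (c * t)) * cmod (cexp (- (c * t)%:C) * cpow t%:C (s - 1)).
    rewrite !cmodM !cmod_cexp !cmod_cpowC// !cReImE mulrA -expRD; congr (expR _ * _); ring.
  apply: le_trans (ler_wpM2r (cmod_ge0 _) (@exp_sum_le _ (cmod z * (c * t)) n _)); last first.
    by rewrite mulr_ge0 ?cmod_ge0// mulr_ge0// ltW.
  rewrite mulr_suml; apply: ler_sum => j _; rewrite /g (cmodM (_ * _ ^+ j)).
  apply: ler_wpM2r; first exact: cmod_ge0.
  rewrite !cmodM cmodV !cmodX cmodN cmod_nat cmodM !cmodC !gtr0_norm// exprMn.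
  rewrite (_ : (cmod z * (c * t)) ^+ j / j`!%:R = cmod z ^+ j / j`!%:R * (c ^+ j * t ^+ j)).
    exact: lexx.
  by rewrite !exprMn; ring.
- move=> t; rewrite posRE => t0.
  have -> : cexp (- (v * t%:C)) * cpow t%:C (s - 1) = (cexp (- (c * t)%:C) * cpow t%:C (s - 1)) * cexp (- z * (c%:C * t%:C)).
    rewrite [RHS]mulrAC -cexpD; congr (cexp _ * _).
    have -> : v = c%:C * (1 - - z) by [].
    by rewrite rmorphM/=; ring.
  have := ccvnZ (cexp (- (c * t)%:C) * cpow t%:C (s - 1)) (cexp_series (- z * (c%:C * t%:C))); apply: eq_ccv => n.
  rewrite mulr_sumr; apply: eq_bigr => j _; rewrite /g exprMn; ring.
move=> i1 _ h; split => //; apply: (ccv_unique h).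
have := ccvnZ (cpow c%:C (- s) * cGamma s) (binomial_series s z1).
rewrite -mulrA [X in ccv _ _ X](_ : _ = cGamma s * cpow v (- s)); last first.
  rewrite zE cpowZ//; first by rewrite mulrCA.
  by apply/eqP => e0; move: vn; rewrite zE e0 mulr0 eqxx.
apply: eq_ccv => n; rewrite mulr_sumr; apply: eq_bigr => j _.
have [i2 E2] := gint_scale c0 (sj j).
rewrite (_ : cintegral posR (g j) = (- z) ^+ j / j`!%:R * c%:C ^+ j * (cpow c%:C (- (s + j%:R)) * cGamma (s + j%:R))); last first.
  rewrite -E2 -cintegralZ//; last exact: measurable_posR.
  by apply: eq_cintegral => t; rewrite inE posRE => t0; rewrite gE.
rewrite cGammaDn// opprD (cpowD _ _ cn) (cpowN j%:R cn) cpow_nat//.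
have := expf_neq0 j cn; move: (c%:C ^+ j) => X Xn.
have f0 : (j`!%:R : R[i]) != 0 by rewrite pnatr_eq0 -lt0n fact_gt0.
by move: (j`!%:R : R[i]) f0 => f f0; field; rewrite Xn f0.
Qed.

End cGamma_ge_ratio.

(** * The kernel of the k-Prabhakar integral and its transform *)

Section kernel.
Context {R : realType}.
Local Notation lam := (@lebesgue_measure R).
Local Notation Re := complex.Re.
Local Notation Im := complex.Im.
Variables (k : R) (al nu om b : R[i]).
Hypotheses (k0 : 0 < k) (al0 : 0 < Re al) (nu0 : 0 < Re nu).
Implicit Types (v : R[i]) (t : R) (n : nat).

Let kn : k%:C != 0 :> R[i] := RCneq0 k0.

(** The function for which [kPrabhakar] is the convolution with [kern]. *)
Definition kern t : R[i] := cpow t%:C (nu / k%:C - 1) / k%:C *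
  kMittagLeffler k al nu b (om * cpow t%:C (al / k%:C)).

(** The kernel is [sum_n kern_coef n * t^(kexp n - 1)], and its transform
is [sum_n kcoef n * v^(- kexp n)]. *)
Definition kexp n : R[i] := (al * n%:R + nu) / k%:C.
Definition kcoef n : R[i] := cpow k%:C (- (nu / k%:C)) * (risefac (b / k%:C) n / n`!%:R *
  (om * k%:C * cpow k%:C (- (al / k%:C))) ^+ n).

Lemma Re_div_k (z : R[i]) : Re (z / k%:C) = Re z / k.
Proof. by rewrite -fmorphV cReM cReC cImC mulr0 subr0. Qed.
Lemma Im_div_k (z : R[i]) : Im (z / k%:C) = Im z / k.
Proof. by rewrite -fmorphV cImM cReC cImC mulr0 add0r. Qed.

Lemma Re_kexp n : Re (kexp n) = (Re al * n%:R + Re nu) / k.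
Proof. by rewrite Re_div_k cReD cReM cRe_nat cIm_nat mulr0 subr0. Qed.
Lemma Im_kexp n : Im (kexp n) = (Im al * n%:R + Im nu) / k.
Proof. by rewrite Im_div_k cImD cImM cRe_nat cIm_nat mulr0 add0r. Qed.

Definition kmin : R := Num.min (Re al) (Re nu) / k.
Lemma kmin_gt0 : 0 < kmin. Proof. by rewrite divr_gt0// lt_min al0. Qed.
Lemma kexp_ge n : kmin * n.+1%:R <= Re (kexp n).
Proof.
rewrite Re_kexp /kmin mulrAC ler_pM2r ?invr_gt0// -natr1 mulrDr mulr1 lerD//.
  by rewrite ler_wpM2r// ge_min lexx.
by rewrite ge_min lexx orbT.
Qed.
Lemma kexp_gt0 n : 0 < Re (kexp n).
Proof. by apply: lt_le_trans (kexp_ge n); rewrite mulr_gt0// kmin_gt0. Qed.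
Lemma kexp_le n : Re (kexp n) <= (Re al + Re nu) / k * n.+1%:R.
Proof.
rewrite Re_kexp mulrAC ler_pM2r ?invr_gt0// mulrDl lerD//.
  by rewrite ler_pM2l// ler_nat.
by apply: ler_peMr; [exact: ltW|rewrite ler1n].
Qed.
Lemma kexp0_le n : Re (kexp 0) <= Re (kexp n).
Proof. by rewrite !Re_kexp ler_pM2r ?invr_gt0// lerD2r ler_pM2l// ler_nat. Qed.

Lemma kPochhammerE n : kPochhammer k b n = k%:C ^+ n * risefac (b / k%:C) n.
Proof.
rewrite /kPochhammer /risefac -[X in X ^+ n]/k%:C -[n in k%:C ^+ n]card_ord -prodr_const -big_split/=.
by apply: eq_bigr => i _; rewrite mulrDr [k%:C * (b / _)]mulrC divfK// [k%:C * _]mulrC.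
Qed.

Lemma kern_term t n : 0 < t ->
  cpow t%:C (nu / k%:C - 1) / k%:C * (kPochhammer k b n / kGamma k (al * n%:R + nu)
     * ((om * cpow t%:C (al / k%:C)) ^+ n / n`!%:R)) =
  kcoef n / cGamma (kexp n) * cpow t%:C (kexp n - 1).
Proof.
move=> t0; have tn := RCneq0 t0.
have -> : al * n%:R + nu = k%:C * kexp n by rewrite /kexp [RHS]mulrC divfK.
rewrite kGammaE ?kexp_gt0// kPochhammerE.
have e1 : cpow t%:C (kexp n - 1) = cpow t%:C (nu / k%:C - 1) * cpow t%:C (al / k%:C) ^+ n.
  by rewrite -cpowMn// -cpowD//; congr cpow; rewrite /kexp; field.
have e2 : cpow k%:C (kexp n - 1) = cpow k%:C (nu / k%:C) * cpow k%:C (al / k%:C) ^+ n / k%:C.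
  by rewrite -cpowMn// -[X in _ / X](cpow1 kn) -cpowN// -!cpowD//; congr cpow; rewrite /kexp; field.
rewrite e1 e2 /kcoef !cpowN// !exprMn exprVn.
have g0 := cGamma_neq0 (kexp_gt0 n).
have f0 : (n`!%:R : R[i]) != 0 by rewrite pnatr_eq0 -lt0n fact_gt0.
have p1 := cpow_neq0 (nu / k%:C) kn; have p2 := expf_neq0 n (cpow_neq0 (al / k%:C) kn).
move: g0 f0 p1 p2 kn; clear.
move: (cGamma _) (n`!%:R : R[i]) (cpow k%:C (nu / k%:C)) (cpow k%:C (al / k%:C) ^+ n) (k%:C ^+ n) (risefac _ _) => G f p1 p2 kX r.
move: (k%:C : R[i]) (om ^+ n) (cpow t%:C _) (cpow t%:C _ ^+ n) => K o c1 c2 h1 h2 h3 h4 h5.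
by field; rewrite h1 h2 h3 h4 h5.
Qed.

Lemma kcoef_bound : exists C th, [/\ 0 <= C, 1 <= th & forall n, cmod (kcoef n) <= C * th ^+ n].
Proof.
have h01 : 0 <= (2^-1 : R) < 1 by rewrite invr_ge0 ler0n/=; lra.
have [C [th [C0 /andP[th0 th1] hC]]] := binomial_bound (cmod_ge0 (b / k%:C)) h01.
set w := cmod (om * k%:C * cpow k%:C (- (al / k%:C))).
have w0 : 0 <= w := cmod_ge0 _.
exists (cmod (cpow k%:C (- (nu / k%:C))) * C), (1 + 2 * w); split.
- by rewrite mulr_ge0// cmod_ge0.
- by rewrite lerDl mulr_ge0.
move=> n; rewrite /kcoef cmodM -[leRHS]mulrA; apply: ler_wpM2l; first exact: cmod_ge0.
rewrite cmodM cmodX -/w cmodM cmodV cmod_nat.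
have h1 : cmod (risefac (b / k%:C) n) / n`!%:R <= C * 2 ^+ n.
  apply: le_trans (_ : (\prod_(i < n) (cmod (b / k%:C) + i%:R)) / n`!%:R <= _).
    by apply: ler_wpM2r; [rewrite invr_ge0|exact: cmod_risefac].
  have := hC n; rewrite exprVn ler_pdivrMr ?exprn_gt0// => /le_trans; apply.
  apply: ler_wpM2r; first exact: exprn_ge0.
  by apply: ler_piMr => //; apply: exprn_ile1 => //; exact: ltW.
apply: le_trans (ler_wpM2r (exprn_ge0 n w0) h1) _.
rewrite -mulrA -exprMn; apply: ler_wpM2l => //; apply: lerXn2r.
- by rewrite nnegrE mulr_ge0.
- by rewrite nnegrE addr_ge0// mulr_ge0.
- by rewrite lerDr.
Qed.

(** The imaginary parts of the exponents grow linearly with [n], as the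
real parts do, so the loss in [cGamma_ge_ratio] is only exponential in [n]. *)
Lemma gamma_quot_bound : exists D, 0 <= D /\
  forall n, rGamma (Re (kexp n)) <= 2 * expR (D * n.+1%:R) * cmod (cGamma (kexp n)).
Proof.
set T := (`|Im al| + `|Im nu|) / k.
have T0 : 0 <= T by rewrite divr_ge0 ?addr_ge0// ltW.
have m0 := kmin_gt0; set m := kmin in m0 *.
exists (T ^+ 2 / 2 * (m^-1 + m ^- 2)); split.
  by rewrite mulr_ge0 ?divr_ge0 ?exprn_ge0// addr_ge0// invr_ge0 ?exprn_ge0// ltW.
move=> n; apply: le_trans (cGamma_ge_ratio (kexp_gt0 n)) _.
apply: ler_wpM2r; first exact: cmod_ge0.
rewrite ler_pM2l// ler_expR.
have Tn : `|Im (kexp n)| <= T * n.+1%:R.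
  rewrite Im_kexp normrM normfV (gtr0_norm k0) /T mulrAC ler_pM2r ?invr_gt0//.
  apply: le_trans (ler_normD _ _) _; rewrite mulrDl normrM normr_nat lerD//.
    by rewrite ler_wpM2l// ler_nat.
  by rewrite ler_peMr// ler1n.
have Tn2 : Im (kexp n) ^+ 2 <= T ^+ 2 * n.+1%:R ^+ 2.
  by rewrite -[leLHS]real_normK ?num_real// -exprMn lerXn2r ?nnegrE// mulr_ge0.
have q0 := kexp_gt0 n; have qm := kexp_ge n; rewrite -/m in qm.
move: (Re (kexp n)) (Im (kexp n) ^+ 2) (sqr_ge0 (Im (kexp n))) Tn2 q0 qm => y z z0 Tn2 q0 qm.
have n0 : 0 < n.+1%:R :> R by [].
have n1 : 1 <= n.+1%:R :> R by rewrite ler1n.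
move: (n.+1%:R : R) n0 n1 Tn2 qm => N n0 n1 Tn2 qm.
have mn0 : 0 < m * N by exact: mulr_gt0.
apply: (@le_trans _ _ ((T ^+ 2 * N ^+ 2) / 2 * ((m * N)^-1 + (m * N) ^- 2))).
  apply: ler_pM.
  - by rewrite divr_ge0.
  - by rewrite addr_ge0// invr_ge0 ?exprn_ge0// ltW.
  - by rewrite ler_pM2r ?invr_gt0.
  - by apply: lerD; rewrite lef_pV2 ?posrE ?exprn_gt0// lerXn2r ?nnegrE// ltW.
rewrite (_ : _ * _ = T ^+ 2 / 2 * (N / m + m ^- 2)); last by field; rewrite !gt_eqF.
rewrite -[leRHS]mulrA; apply: ler_wpM2l; first by rewrite divr_ge0// exprn_ge0.
rewrite mulrDl [m^-1 * N]mulrC lerD2l; apply: ler_peMr => //.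
by rewrite invr_ge0 exprn_ge0// ltW.
Qed.

(** A power is controlled by its own Laplace integral: restrict
[rho^(- p - 1) Gamma (p + 1) = int exp (- rho x) x^p dx] to [[t, t + 1]].  The
estimate is uniform in the exponent, with the gamma factor that the
coefficients of the kernel compensate. *)
Lemma pow_le_gamma (p rho t : R) : 0 < p -> 0 < rho -> 0 < t ->
  t `^ (p - 1) <= p / t * rho `^ (- (p + 1)) * expR (rho * (t + 1)) * rGamma p.
Proof.
move=> p0 r0 t0; have p10 : 0 < p + 1 by rewrite addr_gt0.
have h : t `^ p * expR (- (rho * (t + 1))) <= rho `^ (- (p + 1)) * rGamma (p + 1).
  have [i1 E1] := @gint_scale R rho (p + 1)%:C r0 p10.
  have Ep : (p + 1)%:C - 1 = p%:C :> R[i] by rewrite rmorphD/= addrK.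
  rewrite Ep in i1 E1.
  have gE x : 0 < x -> Re (cexp (- (rho * x)%:C) * cpow x%:C p%:C) = expR (- (rho * x)) * x `^ p.
    by move=> x0; rewrite -rmorphN cexpC cpow_real// -rmorphM.
  have sub : `[t, t + 1]%classic `<=` (@posR R).
    by move=> x /=; rewrite in_itv/= posRE => /andP[tx _]; exact: lt_le_trans tx.
  have mI : measurable (`[t, t + 1]%classic : set R) by exact: measurable_itv.
  have iR : lam.-integrable posR (EFin \o (fun x => expR (- (rho * x)) * x `^ p)).
    have [iRe _] := i1; apply: (eq_Rintegrable (@measurable_posR R) _ iRe) => x; rewrite posRE => x0; exact: gE.
  have E2 : Rintegral lam posR (fun x => expR (- (rho * x)) * x `^ p) = rho `^ (- (p + 1)) * rGamma (p + 1).
    transitivity (Re (cintegral posR (fun t => cexp (- (rho * t)%:C) * cpow t%:C p%:C))); last first.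
      by rewrite E1 cGamma_real -rmorphN cpow_real// -rmorphM.
    by rewrite /cintegral [Re (_ +i* _)]/=; apply: eq_Rintegral => x; rewrite inE posRE => x0; rewrite gE.
  rewrite -E2; apply: le_trans (Rintegral_sub mI (@measurable_posR R) sub iR _); last first.
    by move=> x _; rewrite mulr_ge0 ?expR_ge0 ?powR_ge0.
  have -> : t `^ p * expR (- (rho * (t + 1))) = Rintegral lam `[t, t + 1] (fun=> t `^ p * expR (- (rho * (t + 1)))).
    rewrite Rintegral_cst//; apply: (etrans _ (esym (congr1 (fun z => _ * fine z) (@lebesgue_measure_itv R `[t, t + 1])))).
    by rewrite /= lte_fin ltrDl ltr01/= addrAC subrr add0r mulr1.
  apply: (Rintegral_le mI).
  - by have [] := @ccont_seg _ (fun=> (t `^ p * expR (- (rho * (t + 1))))%:C) t (t + 1) (fun x _ => cderiv_cont (cderiv_cst _ x)) t0.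
  - exact: Rintegrable_sub mI (@measurable_posR R) sub iR.
  - move=> x /=; rewrite in_itv/= => /andP[tx xt]; rewrite mulrC; apply: ler_pM; rewrite ?expR_ge0 ?powR_ge0//.
      by rewrite ler_expR lerN2 ler_pM2l.
    by rewrite ge0_ler_powR// ?nnegrE ?ltW// (lt_le_trans t0).
have tE : t `^ p = t * t `^ (p - 1).
  by rewrite -[X in X * _](powRr1 (ltW t0)) -powRD ?(gt_eqF t0) ?implybT//; congr (_ `^ _); ring.
move: h; rewrite rGammaS// tE.
have E0 := expR_gt0 (rho * (t + 1)); rewrite expRN ler_pdivrMr// => h.
rewrite -(ler_pM2l t0); apply: le_trans h _; rewrite le_eqVlt; apply/orP; left; apply/eqP.
move: (rho `^ _) (rGamma p) (expR _) => A B C; field; by rewrite gt_eqF.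
Qed.

Definition kern_coef n := kcoef n / cGamma (kexp n).

Lemma kern_coef_bound : exists A th, [/\ 0 <= A, 1 <= th &
  forall n, cmod (kern_coef n) * rGamma (Re (kexp n)) <= A * th ^+ n].
Proof.
have [C [th [C0 th1 hC]]] := kcoef_bound; have [D [D0 hD]] := gamma_quot_bound.
have eD : 1 <= expR D by rewrite -[leLHS]expR0 ler_expR.
have th0 : 0 <= th by exact: le_trans ler01 th1.
exists (2 * expR D * C), (th * expR D); split.
- by rewrite !mulr_ge0// expR_ge0.
- by rewrite -[leLHS]mulr1 ler_pM.
move=> n; have g0 : 0 < cmod (cGamma (kexp n)) by rewrite cmod_gt0 cGamma_neq0// kexp_gt0.
rewrite /kern_coef cmodM cmodV mulrAC ler_pdivrMr//.
apply: le_trans (ler_pM (cmod_ge0 _) (ltW (rGamma_gt0 (kexp_gt0 n))) (hC n) (hD n)) _.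
have -> : expR (D * n.+1%:R) = expR D * expR D ^+ n.
  by rewrite -natr1 mulrDr mulr1 expRD [D * _]mulrC expRM_natl mulrC.
rewrite exprMn le_eqVlt; apply/orP; left; apply/eqP; ring.
Qed.

(** Termwise, [pow_le_gamma] turns a coefficient bound [th^n] into a
geometric series once [rho] is large.  For [t <= 1] all exponents are compared
with the smallest one, and the bound at [t = 1] is used. *)
Lemma kern_sum_bound : exists rho C, [/\ 1 <= rho, 0 <= C &
  forall N t, 0 < t -> \sum_(n < N) cmod (kern_coef n * cpow t%:C (kexp n - 1)) <=
    C * (t `^ (Re (kexp 0) - 1) + 1) * expR (rho * t)].
Proof.
have [A [th [A0 th1 hA]]] := kern_coef_bound.
have th0 : 0 < th by exact: lt_le_trans ltr01 th1.
have m0 := kmin_gt0; set m := kmin in m0.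
(* Powers of [rho] with exponent [- (Re (kexp n) + 1)] are then at most [(4 th)^(- n - 1)], which beats the growth [th^n] of the coefficients and the factor [n + 1]. *)
pose rho := (4 * th) `^ m^-1.
have q1 : 1 <= 4 * th by rewrite -[leLHS]mulr1 ler_pM// ler1n.
have q0 : 0 <= 4 * th by exact: le_trans ler01 q1.
have rho1 : 1 <= rho.
  by rewrite /rho -[leLHS](powRr0 (4 * th)) ler_powR// invr_ge0 ltW.
have rho0 : 0 < rho by exact: lt_le_trans ltr01 rho1.
pose S := (Re al + Re nu) / k; have S0 : 0 <= S by rewrite divr_ge0 ?addr_ge0 ?ltW.
have termE n t : cmod (kern_coef n * cpow t%:C (kexp n - 1)) = cmod (kern_coef n) * cmod (cpow t%:C (kexp n - 1)).
  exact: cmodM.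
have rhopow n : rho `^ (- (Re (kexp n) + 1)) <= (4 * th) ^- n.+1.
  apply: (@le_trans _ _ (rho `^ (- (m * n.+1%:R)))).
    apply: ler_powR => //; rewrite lerN2; apply: le_trans (kexp_ge n) _; by rewrite lerDl.
  rewrite powRN /rho -powRrM mulrA mulVf ?gt_eqF// mul1r powR_mulrn//.
have base n t : 0 < t -> cmod (kern_coef n * cpow t%:C (kexp n - 1)) <= (A * S / t * expR (rho * (t + 1))) * (2^-1) ^+ n.+1.
  move=> t0; rewrite cmodM cmod_cpowC// cReB cRe1; have s0 := kexp_gt0 n.
  apply: le_trans (ler_wpM2l (cmod_ge0 _) (pow_le_gamma s0 rho0 t0)) _.
  have E0 := expR_gt0 (rho * (t + 1)).
  rewrite [leLHS](_ : _ = (cmod (kern_coef n) * rGamma (Re (kexp n))) * (Re (kexp n) * rho `^ (- (Re (kexp n) + 1))) *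
    (t^-1 * expR (rho * (t + 1)))); last first.
    by move: (rGamma _) (rho `^ _) (expR _) => x y w; ring.
  rewrite [leRHS](_ : _ = A * (S * 2^-1 ^+ n.+1) * (t^-1 * expR (rho * (t + 1)))); last by ring.
  apply: ler_wpM2r; first by rewrite mulr_ge0 ?expR_ge0// invr_ge0 ltW.
  apply: le_trans (ler_pM _ _ (hA n) (ler_pM _ _ (kexp_le n) (rhopow n))) _.
  - by rewrite mulr_ge0 ?cmod_ge0// ltW// rGamma_gt0.
  - by rewrite mulr_ge0 ?powR_ge0// ltW.
  - exact: ltW.
  - exact: powR_ge0.
  rewrite -[leLHS]mulrA; apply: ler_wpM2l => //; rewrite -/S mulrCA -[leLHS]mulrA; apply: ler_wpM2l => //.
  have n2 : n.+1%:R <= 2 ^+ n.+1 :> R by rewrite -natrX ler_nat ltnW// ltn_expl.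
  have X0 : 0 < (4 * th) ^+ n.+1 by rewrite exprn_gt0// mulr_gt0.
  rewrite mulrA ler_pdivrMr// [4 * th in leRHS](_ : _ = 2 * (2 * th)); last by ring.
  rewrite exprMn mulrA exprVn mulVf ?expf_neq0// mul1r exprMn.
  apply: ler_pM (ler0n _ _) (exprn_ge0 n (ltW th0)) n2 _.
  by rewrite exprS ler_peMl//; exact: exprn_ge0 (ltW th0).
have sumb N t : 0 < t -> \sum_(n < N) cmod (kern_coef n * cpow t%:C (kexp n - 1)) <= A * S / t * expR (rho * (t + 1)).
  move=> t0; apply: (@le_trans _ _ (\sum_(n < N) (A * S / t * expR (rho * (t + 1))) * (2^-1) ^+ n.+1)); first by apply: ler_sum => n _; exact: base.
  have AS0 : 0 <= A * S / t by exact: divr_ge0 (mulr_ge0 A0 S0) (ltW t0).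
  rewrite -mulr_sumr; apply: ler_piMr; first exact: mulr_ge0 AS0 (expR_ge0 _).
  under eq_bigr do rewrite exprS; rewrite -mulr_sumr.
  have h : \sum_(j < N) 2^-1 ^+ j <= (1 - 2^-1)^-1 :> R by apply: geo_bound; rewrite invr_ge0 ler0n/=; lra.
  apply: le_trans (ler_wpM2l _ h) _; first by rewrite invr_ge0.
  by rewrite le_eqVlt; apply/orP; left; apply/eqP; field.
have AE0 : 0 <= A * S * expR (2 * rho) by exact: mulr_ge0 (mulr_ge0 A0 S0) (expR_ge0 _).
exists rho, (A * S * expR (2 * rho)); split => //.
move=> N t t0; have [t1|t1] := leP t 1.
  apply: (@le_trans _ _ ((A * S * expR (2 * rho)) * t `^ (Re (kexp 0) - 1))).
    have h1 := sumb N 1 ltr01; rewrite divr1 [rho * _](_ : _ = 2 * rho) in h1; last by ring.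
    apply: le_trans (ler_wpM2r (powR_ge0 _ _) h1); rewrite mulr_suml; apply: ler_sum => n _.
    rewrite (cmodM (kern_coef n) (cpow t%:C _)) (cmodM (kern_coef n) (cpow 1%:C _)) (cmod_cpowC _ t0) (cmod_cpowC _ ltr01) powR1 mulr1.
    apply: (ler_wpM2l (cmod_ge0 _)).
    rewrite !cReB !cRe1; have := kexp0_le n; move: (Re (kexp 0)) (Re (kexp n)) => x y xy.
    by apply: ger_powR; [rewrite t0|rewrite lerB].
  apply: (@le_trans _ _ (A * S * expR (2 * rho) * (t `^ (Re (kexp 0) - 1) + 1))).
    by apply: ler_wpM2l => //; rewrite lerDl.
  apply: ler_peMr; first exact: mulr_ge0 AE0 (addr_ge0 (powR_ge0 _ _) ler01).
  by rewrite -[leLHS]expR0 ler_expR mulr_ge0// ltW.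
apply: le_trans (sumb N t t0) _.
apply: (@le_trans _ _ (A * S * expR (2 * rho) * expR (rho * t))); last first.
  apply: ler_wpM2r; first exact: expR_ge0.
  by apply: ler_peMr => //; rewrite lerDr powR_ge0.
rewrite -[leRHS]mulrA -expRD -[A * S / t * _]mulrA; apply: ler_wpM2l; first exact: mulr_ge0.
rewrite mulrC -[leRHS]mulr1; apply: ler_pM; rewrite ?expR_ge0 ?invr_ge0 ?(ltW t0)//.
  by rewrite ler_expR; have := rho0; rewrite mulrDr mulr1; lra.
by rewrite invf_le1// ltW.
Qed.

Lemma kern_ccv t : 0 < t -> ccv \oo (fun N => \sum_(n < N) kern_coef n * cpow t%:C (kexp n - 1)) (kern t).
Proof.
move=> t0; have [rho [C [_ _ hC]]] := kern_sum_bound.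
have [l [hl _]] := abs_series (a := fun n => kern_coef n * cpow t%:C (kexp n - 1)) (fun N => hC N t t0).
have w0 : cpow t%:C (nu / k%:C - 1) / k%:C != 0 by rewrite mulf_neq0 ?invr_neq0 ?cpow_neq0// RCneq0.
rewrite /kern; set w := _ / k%:C in w0 *.
suff -> : kMittagLeffler k al nu b (om * cpow t%:C (al / k%:C)) = w^-1 * l by rewrite mulVKf.
rewrite /kMittagLeffler; apply: ccv_clim.
apply: (eq_ccv _ (ccvnZ w^-1 hl)) => N; rewrite big_mkord mulr_sumr.
apply: eq_bigr => n _.
by apply: (etrans (congr1 (fun z => w^-1 * z) (esym (kern_term n t0))) _); exact: (mulKf w0).
Qed.

(** The value at 0 is set to 0, which makes the kernel measurable on the closed
half-line without examining the conventions for [0 ^ w]. *)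
Definition kern0 : R -> R[i] := cmask posR kern.

Lemma kern0_conv g x : conv kern g x = conv kern0 g x.
Proof.
rewrite /conv; apply: (@cintegral_eq_off_null _ _ [set x]) => //.
- exact: lebesgue_measure_set1.
move=> t /=; rewrite in_itv/= => /andP[t0 tx] /eqP tnx.
by rewrite /kern0 /cmask mem_set// posRE subr_gt0 lt_neqAle tnx.
Qed.

(** Termwise integration; the dominating function is that of
[kern_sum_bound] times the exponential. *)
Lemma kern_laplace : exists2 rho, 0 < rho & forall v, rho < Re v ->
  lapint kern0 v /\ ccv \oo (fun N => \sum_(n < N) kcoef n * cpow v (- kexp n)) (Lap kern0 v).
Proof.
have [rho [C [rho1 C0 hC]]] := kern_sum_bound.
exists rho; first exact: lt_le_trans rho1.
move=> v rv; have v0 : 0 < Re v by apply: lt_trans rv; exact: lt_le_trans rho1.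
have d0 : 0 < Re (Re v - rho)%:C by rewrite subr_gt0.
have s0 : 0 < Re (Re (kexp 0))%:C by exact: kexp_gt0.
have powint (p : R) : 0 < p -> lam.-integrable posR (EFin \o (fun t => expR (- ((Re v - rho) * t)) * t `^ (p - 1))).
  move=> p0; have [[ip _] _] := @lap_pow R p%:C _ p0 d0.
  apply: (eq_Rintegrable (@measurable_posR R) _ ip) => x; rewrite posRE => x0.
  by rewrite -rmorphM -rmorphN cexpC -rmorphB cpow_real// -rmorphM.
pose B t : R := C * (expR (- ((Re v - rho) * t)) * t `^ (Re (kexp 0) - 1) + expR (- ((Re v - rho) * t)) * t `^ (1 - 1)).
have iB : lam.-integrable posR (EFin \o B).
  by apply: (RintegrableZ _ (@measurable_posR R)); apply: (RintegrableD (@measurable_posR R)); apply: powint.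
pose g_ n t := kern_coef n * (cexp (- (v * t%:C)) * cpow t%:C (kexp n - 1)).
have gi n : cintegrable posR (fun t => cexp (- (v * t%:C)) * cpow t%:C (kexp n - 1)) by have [] := lap_pow (kexp_gt0 n) v0.
have mg n : cmeas posR (g_ n).
  by apply: cintegrable_meas; apply: cintegrableZ (gi n); exact: measurable_posR.
have [] := @cintegral_series R posR g_ (fun t => cexp (- (v * t%:C)) * kern t) B (@measurable_posR R) mg iB.
- move=> n t; rewrite posRE => t0.
  have e0 := expR_gt0 (Re v * t).
  rewrite (eq_bigr (fun i : 'I_n => expR (- (Re v * t)) * cmod (kern_coef i * cpow t%:C (kexp i - 1)))); last first.
    by move=> i _; rewrite -(cmod_expN v) -cmodM; congr cmod; rewrite /g_ mulrCA.
  rewrite -mulr_sumr; apply: le_trans (ler_wpM2l (expR_ge0 _) (hC n t t0)) _.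
  rewrite /B subrr powRr0 -mulrDr mulrBl opprB expRD [rho * t]mulrC [Re v * t]mulrC.
  by rewrite le_eqVlt; apply/orP; left; apply/eqP; move: (expR _) (expR _) (_ `^ _) => x y z; ring.
- move=> t; rewrite posRE => t0; apply: (eq_ccv _ (ccvnZ (cexp (- (v * t%:C))) (kern_ccv t0))) => N.
  by rewrite mulr_sumr; apply: eq_bigr => i _; rewrite /g_ mulrCA.
move=> ik _ lk.
have E : @cmask R _ R `[0, +oo[ (fun t => cexp (- (v * t%:C)) * kern0 t) = cmask posR (fun t => cexp (- (v * t%:C)) * kern t).
  apply/funext => t; rewrite /cmask /kern0 /cmask.
  have [/set_mem|] := boolP (t \in posR).
    by rewrite posRE => t0; rewrite mem_set//= in_itv/= andbT ltW.
  by rewrite mulr0 if_same.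
split.
  rewrite /lapint; apply/(cintegrable_mask _ (measurable_itv _)); rewrite E.
  by apply/(cintegrable_mask _ (@measurable_posR R)).
rewrite /Lap cintegral_mask E -cintegral_mask; apply: eq_ccv lk => N; apply: eq_bigr => n _.
have [_ Ei] := lap_pow (kexp_gt0 n) v0.
rewrite /g_ (cintegralZ _ (@measurable_posR R) (gi n)) Ei /kern_coef mulrA divfK//.
by apply: cGamma_neq0; exact: kexp_gt0.
Qed.

(** Up to the factor [(k v)^(- nu/k)] the series is the binomial series
in [om k (k v)^(- al/k)]. *)
Lemma kern_binomial v : 0 < Re v -> cmod (om * k%:C * cpow (k%:C * v) (- (al / k%:C))) < 1 ->
  ccv \oo (fun N => \sum_(n < N) kcoef n * cpow v (- kexp n))
   (cpow (k%:C * v) (- (nu / k%:C)) * cpow (1 - om * k%:C * cpow (k%:C * v) (- (al / k%:C))) (- (b / k%:C))).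
Proof.
move=> v0 z1; have vn := Re_gt0_neq0 v0.
apply: (eq_ccv _ (ccvnZ _ (binomial_series (b / k%:C) z1))) => N.
rewrite mulr_sumr; apply: eq_bigr => n _; rewrite /kcoef !cpowZ//.
have -> : cpow v (- kexp n) = cpow v (- (nu / k%:C)) * cpow v (- (al / k%:C)) ^+ n.
  by rewrite -cpowMn// -cpowD//; congr cpow; rewrite /kexp; field.
by rewrite !exprMn; ring.
Qed.

Theorem kern0_Lap : exists2 rho, 0 < rho & forall v, rho < Re v ->
  cmod (om * k%:C * cpow (k%:C * v) (- (al / k%:C))) < 1 ->
  lapint kern0 v /\ Lap kern0 v =
    cpow (k%:C * v) (- (nu / k%:C)) * cpow (1 - om * k%:C * cpow (k%:C * v) (- (al / k%:C))) (- (b / k%:C)).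
Proof.
have [rho r0 h] := kern_laplace; exists rho => // v rv z1.
have [i1 l1] := h v rv; split => //; exact: ccv_unique l1 (kern_binomial (lt_trans r0 rv) z1).
Qed.

End kernel.

(** * Absolutely continuous functions: total variation *)

Section AC.
Context {R : realType}.
Implicit Types (a b : R) (F : R -> R).

(** Disjoint intervals may be indexed by any finite type, in
particular by the pairs (interval, piece of a subdivision). *)
Lemma abs_continuous_on_finType a b F : abs_continuous_on a b F ->
  forall e : R, 0 < e -> exists2 d : R, 0 < d & forall (J : finType) (s t : J -> R),
    (forall i, [/\ a <= s i, s i <= t i & t i <= b]) ->
    trivIset [set: J] (fun i => `]s i, t i[%classic) ->
    \sum_i (t i - s i) < d -> \sum_i `|F (t i) - F (s i)| < e.
Proof.
move=> acF e e0; have [d d0 H] := acF e e0; exists d => // J s t st triv sd.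
have E (f : J -> R) : \sum_i f i = \sum_(i < #|J|) f (enum_val i).
  by rewrite -big_enum_val.
rewrite E; apply: H => [i|i j _ _ [x xij]|]; first exact: st.
  by apply: enum_val_inj; apply: (triv _ _ I I); exists x.
by rewrite -(E (fun i => t i - s i)).
Qed.

Lemma itv_partition_nth_homo a b (l : seq R) : itv_partition a b l ->
  {homo nth b (a :: l) : i j / (i <= j)%N >-> i <= j}.
Proof.
move=> [pl /eqP lb].
have minE k : nth b (a :: l) k = nth b (a :: l) (minn k (size l)).
  have [//|kl] := leqP k (size l).
  rewrite nth_default//= -[RHS]/(nth b (a :: l) (size (a :: l)).-1).
  by rewrite nth_last/= lb.
move=> i j ij; rewrite (minE i) (minE j).
apply: (@sorted_leq_nth _ _ le_trans lexx b (a :: l)); rewrite ?inE/= ?ltnS ?geq_minr//.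
  by apply: sub_path pl => x y; exact: ltW.
by rewrite leq_min geq_minr andbT (leq_trans (geq_minl _ _)).
Qed.

(** Repeating the last point brings partitions to a common length. *)
Lemma variation_pad a b F (l : seq R) N : itv_partition a b l ->
  (size l <= N)%N -> variation a b F l =
  \sum_(j < N) `|F (nth b (a :: l) j.+1) - F (nth b (a :: l) j)|.
Proof.
move=> [pl /eqP lb] lN; rewrite /variation -[RHS](big_mkord xpredT
  (fun j => `|F (nth b (a :: l) j.+1) - F (nth b (a :: l) j)|)).
rewrite [RHS](big_cat_nat (n := size l))//= [X in _ + X]big1_seq ?addr0//.
move=> j /=; rewrite mem_index_iota => /andP[lj jN].
rewrite (nth_default _ (_ : size l <= j)%N)//.
suff -> : nth b (a :: l) j = b by rewrite subrr normr0.
move: lj; rewrite leq_eqVlt => /orP[/eqP <-|lj]; last by rewrite nth_default.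
by rewrite -[LHS]/(nth b (a :: l) (size (a :: l)).-1) nth_last/= lb.
Qed.

(** Subdividing each interval of a family keeps the family
disjoint and its total length unchanged. *)
Lemma abs_continuous_on_variation a b F : abs_continuous_on a b F ->
  forall e : R, 0 < e -> exists2 d : R, 0 < d &
    forall (J : finType) (s t : J -> R) (l : J -> seq R),
    (forall i, [/\ a <= s i, s i <= t i & t i <= b]) ->
    trivIset [set: J] (fun i => `]s i, t i[%classic) ->
    \sum_i (t i - s i) < d -> (forall i, itv_partition (s i) (t i) (l i)) ->
    \sum_i variation (s i) (t i) F (l i) < e.
Proof.
move=> /abs_continuous_on_finType acF e e0; have [d d0 H] := acF e e0.
exists d => // J s t l st triv sd lst.
pose N := \max_i size (l i); pose x i j := nth (t i) (s i :: l i) j.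
have lN i : (size (l i) <= N)%N by exact: leq_bigmax.
have xm i : {homo x i : j k / (j <= k)%N >-> j <= k}.
  exact: itv_partition_nth_homo.
have x0 i : x i 0%N = s i by [].
have xN i : x i N.+1 = t i by rewrite /x nth_default//= ltnS.
have xN' i : x i N = t i.
  rewrite /x; have := lN i; rewrite leq_eqVlt => /orP[/eqP <-|lj].
    rewrite -[LHS]/(nth (t i) (s i :: l i) (size (s i :: l i)).-1) nth_last/=.
    by apply/eqP; case: (lst i).
  by rewrite nth_default.
have xs i j : s i <= x i j by rewrite -x0 xm.
have xt i j : x i j <= t i.
  have [/(xm i)|Nj] := leqP j N; first by rewrite xN'.
  by rewrite /x nth_default//= (leq_ltn_trans (lN i)).
under eq_bigr => i _ do rewrite (variation_pad F (lst i) (lN i)).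
rewrite pair_bigA/=.
apply: (H (J * 'I_N)%type (fun p => x p.1 p.2) (fun p => x p.1 p.2.+1)).
- move=> [i j]/=; split; [|exact: xm|].
    by apply: le_trans (xs i j); case: (st i).
  by apply: le_trans (xt _ _) _; case: (st i).
- move=> [i j] [i' j'] _ _ [y /=]; rewrite !in_itv/= => -[] /andP[h1 h2] /andP[h3 h4].
  have ii' : i = i'.
    apply: (triv _ _ I I); exists y; rewrite /= !in_itv/=; split.
      by rewrite (le_lt_trans (xs i j) h1) (lt_le_trans h2 (xt _ _)).
    by rewrite (le_lt_trans (xs i' j') h3) (lt_le_trans h4 (xt _ _)).
  subst i'; congr (_, _); apply/val_inj/eqP; rewrite eqn_leq /=; apply/andP; split.
    rewrite leqNgt; apply/negP => /xm - /(_ i) /(lt_le_trans h4) /lt_trans /(_ h1).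
    by rewrite ltxx.
  rewrite leqNgt; apply/negP => /xm - /(_ i) /(lt_le_trans h2) /lt_trans /(_ h3).
  by rewrite ltxx.
rewrite -(pair_bigA _ (fun i (j : 'I_N) => x i j.+1 - x i j))/=.
apply: le_lt_trans sd; apply: ler_sum => i _.
rewrite -(big_mkord xpredT (fun j => x i j.+1 - x i j)) telescope_sumr//.
by rewrite xN' x0.
Qed.

(** On an interval of length less than [d] the
variation is at most 1, and finitely many such intervals cover. *)
Lemma abs_continuous_on_bounded_variation a b F : a <= b ->
  abs_continuous_on a b F -> bounded_variation a b F.
Proof.
move=> ab /abs_continuous_on_variation /(_ 1 ltr01)[d d0 H].
have BV1 x y : a <= x -> x <= y -> y <= b -> y - x < d -> bounded_variation x y F.
  move=> ax xy yb yxd; exists 1 => _ [l xyl <-]; apply: ltW.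
  have := H 'I_1 (fun=> x) (fun=> y) (fun=> l); rewrite !big_ord1.
  by apply => // i j _ _ _; rewrite !ord1.
suff BVn n x : a <= x -> x <= b -> x - a <= n%:R * (d / 2) ->
    bounded_variation a x F.
  have d20 : 0 < d / 2 by rewrite divr_gt0.
  apply: (BVn (Num.truncn ((b - a) / (d / 2))).+1) => //.
  by rewrite -ler_pdivrMr// ltW// truncnS_gt.
elim: n x => [|n IH] x ax xb.
  rewrite mul0r subr_le0 => xa; have <- : a = x by apply/le_anti; rewrite ax.
  exact: bounded_variationxx.
(* One step of length [d / 2] back towards [a]. *)
move=> xn; pose y := Num.max a (x - d / 2).
have ay : a <= y by rewrite le_max lexx.
have yx : y <= x by rewrite ge_max ax/= gerBl ltW// divr_gt0.
apply/bounded_variationP => //; rewrite (total_variationD F ay yx) fin_numD.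
apply/andP; split; apply/bounded_variationP => //.
  apply: IH => //; first exact: le_trans yx xb.
  rewrite /y maxEle; case: ifP => _.
    move: xn; rewrite -natr1 mulrDl mul1r; lra.
  by rewrite subrr mulr_ge0// ltW// divr_gt0.
apply: BV1 => //.
have : x - d / 2 <= y by rewrite le_max lexx orbT.
lra.
Qed.

Lemma total_variation_itv a b F x y : a <= x -> x <= y -> y <= b ->
  bounded_variation a b F ->
  fine (total_variation a y F) - fine (total_variation a x F)
    = fine (total_variation x y F).
Proof.
move=> ax xy yb bv; rewrite (total_variationD F ax xy).
have bay : bounded_variation a y F by apply: bounded_variationl bv => //; exact: le_trans xy.
rewrite fineD; last 2 first.
- by apply/bounded_variationP => //; exact: bounded_variationl bay.
- by apply/bounded_variationP => //; exact: bounded_variationr bay.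
by rewrite addrC addKr.
Qed.

(** Choose in each interval a partition that nearly
attains the variation, and apply [abs_continuous_on_variation]. *)
Lemma abs_continuous_on_total_variation a b F : a <= b ->
  abs_continuous_on a b F ->
  abs_continuous_on a b (fun x => fine (total_variation a x F)).
Proof.
move=> ab acF e e0; have bv := abs_continuous_on_bounded_variation ab acF.
have [d d0 H] := abs_continuous_on_variation acF (divr_gt0 e0 (ltr0Sn R 1)).
exists d => // n s t st triv sd.
(* The [n] errors of size [c] add up to less than [e / 2]. *)
pose c := e / 2 / n.+1%:R; have c0 : 0 < c by rewrite !divr_gt0.
have bvi i : bounded_variation (s i) (t i) F.
  have [h1 h2 h3] := st i; apply: (@bounded_variationr _ a) => //.
  by apply: bounded_variationl bv => //; exact: le_trans h2.
have fvi i : total_variation (s i) (t i) F \is a fin_num.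
  by apply/bounded_variationP => //; case: (st i).
have /choice[l Hl] : forall i, exists l, itv_partition (s i) (t i) l /\
    fine (total_variation (s i) (t i) F) - c < variation (s i) (t i) F l.
  move=> i; have := @ub_ereal_sup_adherent _ _ _ c0 (fvi i).
  move=> [_ [_ [l il <-] <-]]; rewrite -[X in (X - _)%E](fineK (fvi i)) -EFinB lte_fin.
  by exists l.
have := H _ s t l st triv sd (fun i => (Hl i).1) => {}H.
have -> : e = e / 2 + e / 2 by lra.
have le1 : \sum_i `|fine (total_variation a (t i) F) - fine (total_variation a (s i) F)|
   <= \sum_i (variation (s i) (t i) F (l i) + c).
  apply: ler_sum => i _; have [h1 h2 h3] := st i.
  rewrite (total_variation_itv h1 h2 h3 bv) ger0_norm; last first.
    by rewrite fine_ge0// total_variation_ge0.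
  by rewrite -lerBlDr ltW//; case: (Hl i).
apply: le_lt_trans le1 _; rewrite big_split/= ltr_leD//.
rewrite sumr_const card_ord -[leLHS]mulr_natr.
have -> : c * n%:R = e / 2 * (n%:R / n.+1%:R) by rewrite /c; ring.
by rewrite ger_pMr ?divr_gt0// ler_pdivrMr// mul1r ler_nat.
Qed.

Lemma abs_continuous_onB a b F H : abs_continuous_on a b F ->
  abs_continuous_on a b H -> abs_continuous_on a b (F \- H).
Proof.
move=> acF acH e e0; have e20 : 0 < e / 2 by rewrite divr_gt0.
have [d1 d10 H1] := acF _ e20; have [d2 d20 H2] := acH _ e20.
exists (Num.min d1 d2); first by rewrite lt_min d10.
move=> n s t st triv; rewrite lt_min => /andP[sd1 sd2].
have -> : e = e / 2 + e / 2 by lra.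
apply: le_lt_trans (ltrD (H1 _ _ _ st triv sd1) (H2 _ _ _ st triv sd2)).
rewrite -big_split/=; apply: ler_sum => i _.
rewrite [leLHS](_ : _ = `|(F (t i) - F (s i)) - (H (t i) - H (s i))|).
  exact: ler_normB.
by congr `|_|; rewrite /=; ring.
Qed.

Lemma abs_continuous_on_within a b F : a < b -> abs_continuous_on a b F ->
  {within `[a, b], continuous F}.
Proof.
move=> ab acF; apply/subspace_continuousP => x; rewrite /= in_itv/= => /andP[ax xb].
apply/cvgrPdist_lt => e e0; have [d d0 H] := acF e e0.
near=> y.
have /= yab : y \in `[a, b] by near: y; exact: withinT.
move: yab; rewrite in_itv/= => /andP[ay yb].
have xyd : `|x - y| < d.
  near: y; apply: cvg_within; exact: nbhsx_ballx.
have := H 1%N (fun=> Num.min x y) (fun=> Num.max x y).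
rewrite !big_ord1; case: (leP x y) => xy; rewrite ?(distrC (F x)); apply.
- by move=> _; split.
- by move=> i j _ _ _; rewrite !ord1.
- by move: xyd; rewrite distrC ger0_norm// subr_ge0.
- by move=> _; split => //; exact: ltW.
- by move=> i j _ _ _; rewrite !ord1.
- by move: xyd; rewrite ger0_norm// subr_ge0 ltW.
Unshelve. all: by end_near. Qed.

End AC.

(** * Absolutely continuous functions: densities *)

Section open_interval.
Context {R : realType}.
Local Notation lam := (@lebesgue_measure R).

Lemma open_interval_bounded (I : set R) (d : R) : open I -> is_interval I ->
  (lam I < d%:E)%E -> exists s t : R, s <= t /\ I = `]s, t[%classic.
Proof.
move=> oI iI Id.
have [->|/set0P[x Ix]] := eqVneq I set0.
  by exists 0, 0; split => //; rewrite set_itvoo0.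
have Imeas (y z : R) : I y -> I z -> y <= z -> z - y < d.
  move=> Iy Iz yz; rewrite -lte_fin; apply: le_lt_trans Id.
  have -> : (z - y)%:E = lam `[y, z]%classic.
    rewrite lebesgue_measure_itv/= lte_fin; case: ltP => // zy.
    by have -> : y = z; [apply/le_anti; rewrite yz|rewrite subrr].
  apply: le_measure; rewrite ?inE//; first exact: open_measurable.
  by move=> w /=; rewrite in_itv/= => yzw; exact: (iI y z).
have hu : has_ubound I.
  exists (x + d) => y Iy; have [yx|xy] := leP y x.
    rewrite (le_trans yx)// lerDl; have := Imeas x x Ix Ix (lexx _).
    by rewrite subrr => /ltW.
  by have := Imeas _ _ Ix Iy (ltW xy); rewrite ltrBlDl => /ltW.
have hl : has_lbound I.
  exists (x - d) => y Iy; have [xy|yx] := leP x y.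
    rewrite (le_trans _ xy)// gerBl; have := Imeas x x Ix Ix (lexx _).
    by rewrite subrr => /ltW.
  by have := Imeas _ _ Iy Ix (ltW yx); lra.
exists (inf I), (sup I); split.
  by apply: (@le_trans _ _ x); [exact: ge_inf|exact: ub_le_sup].
move/interior_id : (oI) => {1}<-; rewrite (interval_bounded_interior iI hl hu).
by apply/seteqP; split => y /=; rewrite in_itv.
Qed.

End open_interval.

Section clamp.
Context {R : realType}.
Variables (a b : R) (G : R -> R).
Hypothesis ab : a <= b.
Hypothesis ndG : {in `[a, b] &, nondecreasing_fun G}.
Hypothesis acG : abs_continuous_on a b G.
Local Notation lam := (@lebesgue_measure R).

Definition clamp (x : R) := Num.max a (Num.min x b).

Lemma clamp_itv x : clamp x \in `[a, b].
Proof. by rewrite in_itv/= le_max lexx ge_max ab/= ge_min lexx orbT. Qed.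

Lemma clampE x : x \in `[a, b] -> clamp x = x.
Proof.
rewrite in_itv/= => /andP[ax xb]; rewrite /clamp.
by rewrite (min_idPl xb) (max_idPr ax).
Qed.

Lemma le_clamp : {homo clamp : x y / x <= y}.
Proof.
move=> x y xy; rewrite /clamp ge_max le_max lexx/= le_max.
by rewrite le_min !ge_min xy lexx !orbT.
Qed.

Lemma clampB x y : x <= y -> clamp y - clamp x <= y - x.
Proof.
move=> xy; rewrite /clamp !maxEle !minEle; do ![case: ifPn]; rewrite -?ltNge; lra.
Qed.

Lemma clamp_itvoo x y : `]clamp x, clamp y[%classic `<=` `]x, y[%classic.
Proof.
move=> z; rewrite /= !in_itv/= /clamp gt_max lt_max lt_min => /andP[/andP[az]].
rewrite gt_min => /orP[->|bz] /orP[za|/andP[-> zb]]//.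
- by move: az; rewrite ltNge (ltW za).
- by move: az; rewrite ltNge (ltW za).
- by move: bz; rewrite ltNge (ltW zb).
Qed.

(** [G] frozen outside [[a, b]], so that it defines a finite Stieltjes measure on
the line. *)
Definition cG := G \o clamp.

Lemma cG_nd : nondecreasing cG.
Proof. by move=> x y xy; apply: ndG; [exact: clamp_itv..|exact: le_clamp]. Qed.

Lemma cG_rc : right_continuous cG.
Proof.
apply: right_continuousW => x; apply/cvgrPdist_lt => e e0.
have [d d0 H] := acG e0; near=> y.
have xyd : `|x - y| < d by near: y; apply: cvgr_dist_lt => //; exact: cvg_id.
have H1 (s t : R) : s <= t -> t - s < d -> `|cG t - cG s| < e.
  move=> st std; have := H 1%N (fun=> clamp s) (fun=> clamp t).
  rewrite !big_ord1; apply.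
  - move=> _; have := clamp_itv s; have := clamp_itv t; rewrite !in_itv/=.
    by move=> /andP[_ ->] /andP[-> _]; split => //; exact: le_clamp.
  - by move=> i j _ _ _; rewrite !ord1.
  - by apply: le_lt_trans std; exact: clampB.
have [xy|/ltW yx] := leP x y.
  by rewrite distrC H1// -(ger0_norm (_ : 0 <= y - x)) ?subr_ge0// distrC.
by rewrite H1// -(ger0_norm (_ : 0 <= x - y)) ?subr_ge0.
Unshelve. all: by end_near. Qed.

HB.instance Definition _ := isCumulative.Build R _ R cG cG_nd cG_rc.

Local Notation mu := (lebesgue_stieltjes_measure cG).

Lemma mu_itvoc x y : x <= y -> mu `]x, y]%classic = (cG y - cG x)%:E.
Proof.
move=> xy; rewrite /lebesgue_stieltjes_measure/= /measure_extension/=.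
rewrite measurable_mu_extE//; last exact: is_ocitv.
exact: (wlength_itv_bnd cG _ _ xy).
Qed.

Lemma mu_setT_lty : fin_num_fun mu.
Proof.
apply: lty_fin_num_fun.
have cvgmu : mu (`](- n%:R), n%:R]%classic) @[n --> \oo] --> mu setT.
  have <- : \bigcup_n `](- n%:R), n%:R]%classic = [set: R].
    rewrite -subTset => x _; exists (Num.bound `|x|) => //=.
    have := archi_boundP (normr_ge0 x); rewrite ltr_norml => /andP[h1 /ltW h2].
    by rewrite in_itv/= h1.
  apply: nondecreasing_cvg_mu => //.
    exact: bigcupT_measurable.
  move=> m n mn; apply/subsetPset => x; rewrite /= !in_itv/= => /andP[h1 h2].
  have mnR : m%:R <= n%:R :> R by rewrite ler_nat.
  by rewrite (le_lt_trans _ h1) ?lerN2// (le_trans h2).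
apply: (@le_lt_trans _ _ (G b - G a)%:E); last exact: ltry.
rewrite [leLHS](_ : _ = lim (mu (`](- n%:R), n%:R]%classic) @[n --> \oo])); last by apply/esym/cvg_lim.
apply: lime_le; first by apply/cvg_ex; exists (mu setT).
near=> n; rewrite mu_itvoc ?lee_fin; last by rewrite (le_trans _ (ler0n _ n))// oppr_le0.
by rewrite lerB// /cG/=; apply: ndG; rewrite ?clamp_itv// ?in_itv/= ?lexx ?ab//;
  have := clamp_itv n%:R; have := clamp_itv (- n%:R); rewrite !in_itv/= => /andP[? ?] /andP[? ?].
Unshelve. all: by end_near. Qed.

(** Cover a Borel null set by an open set of small Lebesgue measure; its
components are disjoint intervals of small total length, on which absolute
continuity bounds the increments of [G]. *)
Lemma mu_dominated : mu `<< lam.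
Proof.
move=> A /= nullA B mB BA.
have lamB : lam B = 0 by apply: nullA.
apply/eqP; rewrite eq_le measure_ge0 andbT; apply/lee_addgt0Pr => e e0.
rewrite add0e.
have [d d0 H] := abs_continuous_on_finType acG e0.
have lamBy : (lam B < +oo)%E by rewrite lamB ltry.
have [U [oU BU]] := lebesgue_regularity_outer mB lamBy d0.
have mU : measurable U by exact: open_measurable.
have lamUE : (lam U <= lam (U `\` B))%E.
  have -> : (lam (U `\` B) = lam (U `\` B) + lam B)%E.
    by rewrite (lamB : lam B = 0%E) adde0.
  rewrite -{1}(setDUK BU) setUC; apply: measureU2 => //; exact: measurableD.
move=> /(le_lt_trans lamUE) lamU; pose I := open_disjoint_itv oU.
have mI n : measurable (I n) by apply: open_measurable; exact: open_disjoint_itv_open.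
have tI : trivIset setT I by exact: open_disjoint_itv_trivIset.
have UE : U = \bigcup_n I n by exact: open_disjoint_itv_bigcup.
have IU n : I n `<=` U by move=> x Ix; rewrite UE; exists n.
have /choice[st stE] : forall n, exists st : R * R,
    st.1 <= st.2 /\ I n = `]st.1, st.2[%classic.
  move=> n; have [|||s [t [? ?]]] := @open_interval_bounded R (I n) d.
  - exact: open_disjoint_itv_open.
  - exact: open_disjoint_itv_is_interval.
  - apply: le_lt_trans lamU.
    by apply: le_measure; rewrite ?inE; [exact: mI|exact: mU|exact: IU].
  by exists (s, t).
apply: (@le_trans _ _ (mu U)); first by apply: le_measure; rewrite ?inE.
rewrite UE measure_bigcup//; last by move=> k _; exact: mI.
under eq_eseriesl do rewrite in_setT.
have lamn n : (\sum_(i < n) lam (I i) <= lam U)%E.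
  rewrite UE (measure_bigcup lam setT)//; last by move=> k _; exact: mI.
  rewrite -(big_mkord xpredT (fun i => lam (I i))).
  under eq_eseriesl do rewrite in_setT.
  exact: nneseries_lim_ge.
apply: lime_le; first exact: is_cvg_nneseries.
near=> n; rewrite big_mkord.
apply: (@le_trans _ _ (\sum_(i < n) (cG (st i).2 - cG (st i).1))%:E).
  rewrite -sumEFin; apply: lee_sum => i _; have [h1 ->] := stE i.
  rewrite -mu_itvoc//; apply: le_measure; rewrite ?inE//.
  by move=> y /=; rewrite !in_itv/= => /andP[-> /ltW ->].
rewrite lee_fin.
have -> : \sum_(i < n) (cG (st i).2 - cG (st i).1) =
   \sum_(i < n) `|G (clamp (st i).2) - G (clamp (st i).1)|.
  by apply: eq_bigr => i _; rewrite ger0_norm// subr_ge0 cG_nd//; case: (stE i).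
apply/ltW/H.
- move=> i; have := clamp_itv (st i).1; have := clamp_itv (st i).2.
  rewrite !in_itv/= => /andP[_ ->] /andP[-> _]; split => //.
  by apply: le_clamp; case: (stE i).
- move=> i j _ _ [x [/clamp_itvoo xi /clamp_itvoo xj]]; apply/val_inj.
  by apply: tI => //; exists x; split; rewrite (stE _).2.
- apply: (@le_lt_trans _ _ (\sum_(i < n) ((st i).2 - (st i).1))).
    by apply: ler_sum => i _; apply: clampB; case: (stE i).
  rewrite -lte_fin -sumEFin; apply: le_lt_trans lamU; apply: le_trans (lamn n).
  apply: lee_sum => i _; have [h1 ->] := stE i.
  rewrite lebesgue_measure_itv/= lte_fin; case: ltP => // h2.
  by rewrite lee_fin subr_le0.
Unshelve. all: by end_near. Qed.

(** Radon-Nikodym for the Stieltjes measure of [G]. *)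
Lemma monotone_density : exists g : R -> R,
  lam.-integrable setT (EFin \o g) /\
  forall x, x \in `[a, b] -> G x - G a = Rintegral lam `[a, x] g.
Proof.
pose H1 := Measure_isFinite.Build _ _ _ mu mu_setT_lty.
pose mu' : {finite_measure set (measurableTypeR R) -> \bar R} :=
  HB.pack_for (FiniteMeasure.type (measurableTypeR R) R) (Measure.sort mu) H1.
have [f [f0 ffin fint fE]] := @radon_nikodym_sigma_finite _ _ _ lam mu' mu_dominated.
exists (fine \o f); split.
  by apply: eq_integrable fint => // x _ /=; rewrite fineK.
move=> x xab; have := xab; rewrite in_itv/= => /andP[ax xb].
have aab : a \in `[a, b] by rewrite in_itv/= lexx.
have -> : G x - G a = fine (mu' `]a, x]%classic).
  by rewrite /= mu_itvoc//= /cG/= !clampE.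
rewrite fE// /Rintegral -integral_itv_obnd_cbnd; last first.
  apply: measurable_funTS; apply: eq_measurable_fun (measurable_int _ fint).
  by move=> y _ /=; rewrite fineK.
by congr fine; apply: eq_integral => y _ /=; rewrite fineK.
Qed.

End clamp.

Section AC_FTC.
Context {R : realType}.
Implicit Types (a b : R) (F : R -> R).
Local Notation lam := (@lebesgue_measure R).

(** Jordan decomposition: [F] is the difference of its total
variation function and of another monotone function, both absolutely
continuous. *)
Theorem abs_continuous_on_density a b F : a <= b -> abs_continuous_on a b F ->
  exists g : R -> R, lam.-integrable setT (EFin \o g) /\
  forall x, x \in `[a, b] -> F x - F a = Rintegral lam `[a, x] g.
Proof.
move=> ab acF; pose V x := fine (total_variation a x F).
have bv := abs_continuous_on_bounded_variation ab acF.
have acV : abs_continuous_on a b V by exact: abs_continuous_on_total_variation.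
have VE x y : a <= x -> x <= y -> y <= b -> V y - V x = fine (total_variation x y F).
  by move=> ax xy yb; exact: (total_variation_itv ax xy yb bv).
have ndV : {in `[a, b] &, nondecreasing_fun V}.
  move=> x y; rewrite !in_itv/= => /andP[ax xb] /andP[ay yb] xy.
  by rewrite -subr_ge0 VE// fine_ge0// total_variation_ge0.
have ndW : {in `[a, b] &, nondecreasing_fun (V \- F)}.
  move=> x y; rewrite !in_itv/= => /andP[ax xb] /andP[ay yb] xy /=.
  have : F y - F x <= V y - V x; last by lra.
  rewrite VE// -lee_fin fineK; last first.
    apply/bounded_variationP => //; apply: (@bounded_variationr _ a) => //.
    by apply: bounded_variationl bv.
  by apply: le_trans (total_variation_ge _ xy); rewrite lee_fin ler_norm.
have [g1 [ig1 g1E]] := monotone_density ab ndV acV.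
have [g2 [ig2 g2E]] := monotone_density ab ndW (abs_continuous_onB acV acF).
exists (g1 \- g2); split.
  by rewrite (_ : EFin \o _ = (EFin \o g1) \- (EFin \o g2))%E//; exact: integrableB.
move=> x xab; rewrite RintegralB//; [|exact: integrableS (ig1)|exact: integrableS (ig2)].
by rewrite -g1E// -g2E//=; ring.
Qed.

Lemma abs_continuous_on_ae_derive a b F (g : R -> R) :
  lam.-integrable setT (EFin \o g) ->
  (forall x, x \in `[a, b] -> F x - F a = Rintegral lam `[a, x] g) ->
  {ae lam, forall x, x \in `]a, b[ -> derivable F x 1 /\ derive1 F x = g x}.
Proof.
move=> ig gE.
have lg : locally_integrable setT g.
  by have := integrable_locally measurableT ig; rewrite patch_setT.
have igy y : lam.-integrable [set` Interval (BLeft a) (BRight y)] (EFin \o g).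
  by apply: integrableS ig.
have := FTC1 igy lg; apply: filterS; first exact: (ae_filter_ringOfSetsType lam).
move=> x /= H; rewrite in_itv/= => /andP[ax xb].
have [|dI dIE] := H; first by rewrite lte_fin.
pose I0 y := F a + Rintegral lam `[a, y] g.
have dI0 : is_derive x 1 I0 (g x).
  rewrite -dIE derive1E -[X in is_derive _ _ _ X]add0r; apply: is_deriveD.
  exact: DeriveDef.
have IF : {near x, I0 =1 F}.
  near=> y; rewrite /I0 -gE; first by rewrite addrC subrK.
  rewrite in_itv/=; apply/andP; split; apply: ltW.
    by near: y; exact: lt_nbhsr.
  by near: y; exact: lt_nbhsl.
have [dF dFE] := near_eq_is_derive IF dI0.
by rewrite derive1E.
Unshelve. all: by end_near. Qed.

End AC_FTC.

(** * Taylor expansion of functions with an absolutely continuous derivative *)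

Section taylor.
Context {R : realType}.
Local Notation lam := (@lebesgue_measure R).
Local Notation Re := complex.Re.
Local Notation Im := complex.Im.
Implicit Types (f g : R -> R) (x t X : R) (phi : R -> R[i]).

Lemma has_derivative_within a b f g : has_derivative_on a b f g ->
  {within `[a, b], continuous f}.
Proof.
move=> fg; apply/subspace_continuousP => x; rewrite /= => xab.
have xab' : x \in `[a, b] by rewrite in_itv.
have FF : Filter (within `[a, b]%classic x^') by exact: within_filter.
have h0 : (y - x) @[y --> within `[a, b]%classic x^'] --> (0 : R).
  apply: cvg_within_filter; apply: cvg_within_filter.
  have : y - x @[y --> x] --> (x - x : R) by apply: cvgB; [exact: cvg_id|exact: cvg_cst].
  by rewrite subrr.
have : (f y - f x) / (y - x) * (y - x) @[y --> within `[a, b]%classic x^'] --> g x * 0.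
  by apply: cvgM h0; exact: fg.
rewrite mulr0 => /cvgrPdist_lt h.
apply/cvgrPdist_lt => e e0; have := h e e0; rewrite /dnbhs !near_withinE => {}h.
near=> y => yab; have [->|yx] := eqVneq y x; first by rewrite subrr normr0.
have /(_ yx yab) : y != x -> `[a, b]%classic y -> `|0 - (f y - f x) / (y - x) * (y - x)| < e.
  by move: (yx) (yab) => _ _; clear yx yab; near: y; exact: h.
by rewrite divfK ?subr_eq0// sub0r opprB.
Unshelve. all: by end_near. Qed.

Lemma has_derivative_interior a b f g x : has_derivative_on a b f g -> x \in `]a, b[ ->
  is_derive x 1 f (g x).
Proof.
move=> fg xab; have := xab; rewrite in_itv/= => /andP[ax xb].
have xab' : x \in `[a, b] by rewrite in_itv/= !ltW.
suff h : h^-1 *: (f (h *: 1 + x) - f x) @[h --> 0^'] --> g x.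
  by apply: DeriveDef; [apply/cvg_ex; exists (g x)|exact: cvg_lim h].
have /cvgrPdist_lt H := fg x xab'.
apply/cvgrPdist_lt => e e0; have := H e e0.
rewrite /dnbhs !near_withinE => /nbhs_ballP[d d0 hd].
have m0 : 0 < Num.min d (Num.min (x - a) (b - x)) by rewrite !lt_min d0 !subr_gt0 ax.
apply/nbhs_ballP; exists (Num.min d (Num.min (x - a) (b - x))) => //= h.
rewrite /ball/= sub0r normrN !lt_min => /and3P[hd' ha hb] h0.
have := hd (h *: 1 + x); rewrite /ball/= opprD addrCA subrr addr0 normrN [h *: 1]mulr1.
move=> /(_ hd') H1; have := H1 _; rewrite addrK [_^-1 *: _]mulrC; apply.
  by rewrite -subr_eq0 addrK.
rewrite in_itv/=; move: ha hb; rewrite !ltr_norml; lra.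
Qed.

Lemma within_right a b f : a < b -> {within `[a, b], continuous f} -> f y @[y --> a^'+] --> f a.
Proof. by move=> ab /(continuous_within_itvP _ ab)[]. Qed.

(** The fundamental theorem with one-sided derivatives at the
endpoints, where continuity is enough. *)
Lemma has_derivative_ftc a b f g : a < b -> has_derivative_on a b f g ->
  {within `[a, b], continuous g} -> forall x, x \in `[a, b] -> f x - f a = Rintegral lam `[a, x] g.
Proof.
move=> ab fg cg x; rewrite in_itv/= => /andP[]; rewrite le_eqVlt => /orP[/eqP <- _|ax xb].
  by rewrite subrr set_itv1 Rintegral_set1.
have sub : `[a, x]%classic `<=` (`[a, b]%classic : set R).
  by move=> s /=; rewrite !in_itv/= => /andP[-> /le_trans]; apply.
have cf := continuous_subspaceW sub (has_derivative_within fg).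
have [c1 c2 c3] := (continuous_within_itvP _ ax).1 cf.
rewrite /Rintegral (continuous_FTC2 (F := f) ax (continuous_subspaceW sub cg))//.
  split => // t tax; have [] // := has_derivative_interior (x := t) fg _.
  by move: tax; rewrite !in_itv/= => /andP[-> /lt_le_trans]; apply.
move=> t tax; rewrite derive1E; apply: derive_val.
have tab : t \in `]a, b[ by move: tax; rewrite !in_itv/= => /andP[-> /lt_le_trans]; apply.
exact: has_derivative_interior fg tab.
Qed.

Lemma prim_congr phi psi x : (forall t, 0 <= t <= x -> phi t = psi t) -> prim phi x = prim psi x.
Proof. by move=> h; apply: eq_cintegral => t; rewrite inE/= in_itv/=; exact: h. Qed.

Lemma primD phi psi x : locint phi -> locint psi ->
  prim (fun t => phi t + psi t) x = prim phi x + prim psi x.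
Proof. by move=> h1 h2; apply: cintegralD. Qed.
Lemma primZ c phi x : locint phi -> prim (fun t => c * phi t) x = c * prim phi x.
Proof. by move=> h1; apply: cintegralZ => //; exact: h1. Qed.
Lemma prim_sum (n : nat) (phi_ : nat -> R -> R[i]) x : (forall i, locint (phi_ i)) ->
  prim (fun t => \sum_(i < n) phi_ i t) x = \sum_(i < n) prim (phi_ i) x.
Proof.
by move=> lp; have [] := @cintegrable_sum _ n `[0, x] phi_ (measurable_itv _) (fun i => lp i x).
Qed.
Lemma locint_iter n phi : locint phi -> locint (iter n prim phi).
Proof. by move=> lp; elim: n => //= n; exact: locint_prim. Qed.
Lemma locintZ c phi : locint phi -> locint (fun t => c * phi t).
Proof. by move=> h X; apply: cintegrableZ => //; exact: h. Qed.
Lemma locintD phi psi : locint phi -> locint psi -> locint (fun t => phi t + psi t).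
Proof. by move=> h1 h2 X; apply: cintegrableD. Qed.
Lemma locint_sum (n : nat) (phi_ : nat -> R -> R[i]) : (forall i, locint (phi_ i)) ->
  locint (fun t => \sum_(i < n) phi_ i t).
Proof. by move=> lp X; have [] := @cintegrable_sum _ n `[0, X] phi_ (measurable_itv _) (fun i => lp i X). Qed.

Lemma prim_real g x : prim (fun t => (g t)%:C) x = (Rintegral lam `[0, x] g)%:C.
Proof.
apply: ceqP => /=; first by [].
by rewrite /Rintegral integral0_eq.
Qed.

(** Iterated primitives of 1 stand for [x^n / n!], which makes both the
induction and the Laplace transforms immediate. *)
Lemma taylor_iter (h : nat -> R -> R) (phi : R -> R[i]) (X : R) (m : nat) : locint phi ->
  (forall i, (i < m)%N -> forall x, 0 <= x <= X ->
     (h i x)%:C = (h i 0)%:C + prim (if i.+1 == m then phi else fun t => (h i.+1 t)%:C) x) ->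
  forall x, 0 <= x <= X ->
  (0 < m)%N -> (h 0%N x)%:C = \sum_(n < m) (h n 0)%:C * iter n prim (fun=> 1) x + iter m prim phi x.
Proof.
elim: m h => // m IH h lphi H x xX _.
have [m0|m0] := posnP m.
  by rewrite m0 big_ord1/= mulr1 H ?m0.
rewrite (H 0%N)// eqSS eq_sym gtn_eqF//.
have E t : 0 <= t <= x -> (h 1%N t)%:C = \sum_(n < m) (h n.+1 0)%:C * iter n prim (fun=> 1) t + iter m prim phi t.
  move=> /andP[t0 tx]; apply: (IH (fun n => h n.+1)) => //.
    by move=> i im s sX; have := H i.+1; rewrite eqSS; apply.
  by rewrite t0/=; case/andP: xX => _; exact: le_trans.
rewrite (prim_congr E) big_ord_recl/= mulr1 -addrA; congr (_ + _).
rewrite primD; last 2 first.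
- by apply: (@locint_sum _ (fun n t => (h n.+1 0)%:C * iter n prim (fun=> 1) t)) => i; apply: locintZ; apply: locint_iter; exact: locint_cst.
- exact: locint_iter.
rewrite (@prim_sum _ (fun n t => (h n.+1 0)%:C * iter n prim (fun=> 1) t)); last first.
  by move=> i; apply: locintZ; apply: locint_iter; exact: locint_cst.
congr (_ + _); apply: eq_bigr => i _; rewrite primZ//.
by apply: locint_iter; exact: locint_cst.
Qed.

Lemma derive1_near f g x : (\forall y \near x, f y = g y) -> derive1 f x = derive1 g x.
Proof. by move=> fg; rewrite !derive1E; exact: near_eq_derive. Qed.

(** The iterated two-sided derivatives agree with the one-sided witnesses in
the interior, the last one almost everywhere; the limits at 0 exist by
continuity of the witnesses.  The density depends on [X], but the coefficients
do not. *)
Lemma ac_taylor (m : nat) (X : R) f : (0 < m)%N -> 0 < X -> AC_on m 0 X f ->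
  exists g, [/\ lam.-integrable setT (EFin \o g),
    (exists N, [/\ measurable N, lam N = 0%E & forall t, t \in `]0, X[ -> ~ N t -> derive1n m f t = g t]) &
    forall x, 0 <= x <= X -> (f x)%:C =
      \sum_(n < m) (lim (derive1n n f y @[y --> 0^'+]))%:C * iter n prim (fun=> 1) x +
      iter m prim (fun t => (g t)%:C) x].
Proof.
move=> m0 X0 [h [hf hd hac]].
have [g [ig gE]] := abs_continuous_on_density (ltW X0) hac.
have cw i : (i < m)%N -> {within `[0, X], continuous (h i)}.
  move=> im; have [im1|im1] := ltnP i m.-1; first exact: has_derivative_within (hd i im1).
  have -> : i = m.-1 by lia.
  exact: abs_continuous_on_within X0 hac.
have dn n : (n < m)%N -> forall x, x \in `]0, X[ -> derive1n n f x = h n x.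
  elim: n => [|n IH] nm x xX; first by rewrite hf//; move: xX; rewrite !in_itv/= => /andP[/ltW-> /ltW->].
  rewrite derive1nS (derive1_near (g := h n)); last first.
    near=> y; apply: IH; first exact: ltnW.
    by near: y; exact: near_in_itvoo.
  rewrite derive1E; apply: derive_val.
  by apply: has_derivative_interior (hd n _) xX; lia.
have limE n : (n < m)%N -> lim (derive1n n f y @[y --> 0^'+]) = h n 0.
  move=> nm; apply: cvg_lim => //; apply: cvg_trans (within_right X0 (cw n nm)).
  apply: near_eq_cvg; near=> y; rewrite dn// in_itv/=; apply/andP; split; near: y.
    exact: nbhs_right_gt.
  exact: nbhs_right_lt.
exists g; split => //.
  have /negligibleP := abs_continuous_on_ae_derive ig gE.
  have [N [mN N0 sN]] := abs_continuous_on_ae_derive ig gE.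
  exists N; split => // t tX tN.
  have [_ <-] : derivable (h m.-1) t 1 /\ derive1 (h m.-1) t = g t.
    by apply: contrapT => nd; apply: tN; apply: sN => /= /(_ tX).
  rewrite -[in LHS](prednK m0) derive1nS; apply: derive1_near.
  near=> y; apply: dn; first by rewrite prednK.
  by near: y; exact: near_in_itvoo.
have lg : locint (fun t => (g t)%:C).
  move=> Y; split.
    by apply: integrableS ig => //; exact: measurable_itv.
  by apply: integrable0.
move=> x xX; rewrite -hf ?in_itv//.
rewrite (taylor_iter (h := h) lg _ xX m0).
  by congr (_ + _); apply: eq_bigr => n _; rewrite limE.
move=> i im t tX; case: ifPn => [/eqP Em|im1].
  rewrite prim_real -rmorphD -gE ?in_itv//.
  by rewrite (_ : m.-1 = i); [rewrite addrC subrK|lia].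
have im2 : (i < m.-1)%N by lia.
rewrite prim_real -rmorphD -(has_derivative_ftc X0 (hd i im2)) ?in_itv//; last by apply: cw; lia.
by rewrite addrC subrK.
Unshelve. all: by end_near. Qed.

End taylor.

(** * The Volterra equation for the regularized derivative *)

Section volterra.
Context {R : realType}.
Local Notation lam := (@lebesgue_measure R).
Local Notation Re := complex.Re.
Local Notation Im := complex.Im.
Implicit Types (x t X : R) (phi psi a b : R -> R[i]) (v : R[i]).

Lemma Rintegrable_reflect (c : R) (A : R -> R) : lam.-integrable setT (EFin \o A) ->
  lam.-integrable setT (EFin \o (fun x => A (c - x))).
Proof.
move=> iA; have mA := Rintegrable_meas iA.
have /integrableP[_ Aoo] := iA; apply/integrableP; split.
  apply/measurable_EFinP; apply: (measurableT_comp mA); exact: measurable_funB.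
rewrite (@integral_reflect _ c (fun x : R => `|(EFin \o A) x|%E))//.
by apply: measurableT_comp => //; apply/measurable_EFinP.
Qed.

Lemma cintegrable_reflect (c : R) a : cintegrable setT a -> cintegrable setT (fun x => a (c - x)).
Proof. by move=> [i1 i2]; split; [exact: (Rintegrable_reflect c i1)|exact: (Rintegrable_reflect c i2)]. Qed.

(** An integrable factor times a bounded one.  This makes the
convolution with a primitive well defined at every point. *)
Lemma conv_integrand a b x (M : R) : cintegrable `[0, x] a -> @cmeas R _ R `[0, x] b ->
  (forall t, 0 <= t <= x -> cmod (b t) <= M) -> cintegrable `[0, x] (fun t => a (x - t) * b t).
Proof.
move=> ia mb bM; have mI : measurable (`[0, x]%classic : set R) by exact: measurable_itv.
have ia' := cintegrable_reflect x ((cintegrable_mask _ mI).1 ia).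
have mb' := cmeas_mask mI mb.
have M0 t : cmod (cmask `[0, x] b t) <= `|M|.
  rewrite /cmask; case: ifPn => [/set_mem/=|_]; last by rewrite cmod0.
  by rewrite in_itv => /bM /le_trans; apply; exact: ler_norm.
have h := cintegrable_bndM measurableT mb' (fun t _ => M0 t) ia'.
apply/(cintegrable_mask _ mI); apply: eq_cintegrable h => // t _.
rewrite /cmask; case: ifPn => [/set_mem/=|_]; last by rewrite mul0r.
rewrite in_itv/= => /andP[t0 tx]; rewrite mem_set 1?mulrC//= in_itv/= subr_ge0 tx/=.
by rewrite lerBlDr lerDl.
Qed.

Lemma prim_bounded phi x : locint phi -> exists M, forall t, 0 <= t <= x -> cmod (prim phi t) <= M.
Proof.
move=> lp; exists (Rintegral lam `[0, x] (fun t => cmod (phi t))) => t /andP[t0 tx].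
apply: le_trans (cmod_cintegral (measurable_itv _) (lp t)) _.
apply: (Rintegral_cmod_subset _ _ _ (lp x)) => //.
by move=> s /=; rewrite !in_itv/= => /andP[-> /le_trans]; apply.
Qed.

Lemma iter_prim_congr n phi psi x : (forall t, 0 <= t <= x -> phi t = psi t) ->
  forall t, 0 <= t <= x -> iter n prim phi t = iter n prim psi t.
Proof.
move=> E; elim: n => //= n IH t /andP[t0 tx]; apply: prim_congr => s /andP[s0 st].
by apply: IH; rewrite s0 (le_trans st).
Qed.

Lemma iter_primZ n c phi x : locint phi -> iter n prim (fun t => c * phi t) x = c * iter n prim phi x.
Proof.
move=> lp; elim: n x => //= n IH x; rewrite -primZ; last exact: locint_iter.
by apply: prim_congr => t _.
Qed.

Lemma iter_prim_conv n a b x : locint a -> locint b ->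
  iter n prim (conv a b) x = conv a (iter n prim b) x.
Proof.
move=> la lb; elim: n x => //= n IH x; rewrite -prim_conv_r//.
- by apply: prim_congr => t _.
- exact: locint_iter.
- exact: (locint_prim (locint_iter n lb) x).
Qed.

Lemma locint_conv a b : locint a -> locint b -> locint (conv a b).
Proof. by move=> la lb X; exact: conv_cintegrable. Qed.

Lemma lap_iter n phi v : 0 < Re v -> lapint phi v ->
  lapint (iter n prim phi) v /\ Lap (iter n prim phi) v = Lap phi v / v ^+ n.
Proof.
move=> v0 ip; elim: n => [|n [IH1 IH2]]; first by rewrite expr0 divr1.
by have [h1 h2] := lap_prim v0 IH1; split=> //=; rewrite h2 IH2 exprSr invfM mulrA.
Qed.

Lemma lap_sum n (phi_ : nat -> R -> R[i]) v : (forall i, lapint (phi_ i) v) ->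
  lapint (fun t => \sum_(i < n) phi_ i t) v /\
  Lap (fun t => \sum_(i < n) phi_ i t) v = \sum_(i < n) Lap (phi_ i) v.
Proof.
move=> ip; elim: n => [|n [IH1 IH2]].
  have z : (fun t => \sum_(i < 0) phi_ i t) = (fun t => 0 * phi_ 0%N t).
    by apply/funext => t; rewrite big_ord0 mul0r.
  by have [h1 h2] := lapintZ 0 (ip 0%N); rewrite z h2 mul0r big_ord0.
under eq_fun do rewrite big_ord_recr/=.
by have [h1 h2] := lapintD IH1 (ip n); rewrite big_ord_recr/= h2 IH2.
Qed.

Lemma iter_prim1_lap n v : 0 < Re v -> lapint (iter n prim (fun=> 1)) v /\
  Lap (iter n prim (fun=> 1)) v = v ^- n.+1.
Proof.
move=> v0; have [i1 E1] := Lap1 v0; have [h1 h2] := lap_iter n v0 i1; split=> //.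
by rewrite h2 E1 exprSr invfM mulrC.
Qed.

End volterra.

Lemma mul_shift (F : fieldType) n (L v : F) : v != 0 -> v * L = v ^+ n.+1 * (L / v ^+ n).
Proof. by move=> v0; rewrite exprS; field; rewrite expf_neq0. Qed.

Section equation.
Context {R : realType}.
Local Notation lam := (@lebesgue_measure R).
Local Notation Re := complex.Re.
Local Notation Im := complex.Im.
Variables (k : R) (al nu om b : R[i]) (m : nat) (f : R -> R).
Hypotheses (k0 : 0 < k) (al0 : 0 < Re al) (nu0 : 0 < Re nu) (m0 : (0 < m)%N).
Hypothesis fac : forall X : R, 0 < X -> AC_on m 0 X f.
Let fC (t : R) : R[i] := (f t)%:C.
Hypothesis lf : locint fC.
Implicit Types (x t X : R) (v : R[i]).
Let K := kern0 k al nu om b.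

Definition initial_value n : R := lim (derive1n n f y @[y --> 0^'+]).
(** The [m]-fold primitive of the density of [f^(m)], written through
[f] itself so that it does not refer to a bounded interval. *)
Definition taylor_remainder t : R[i] := fC t + -1 * \sum_(n < m) (initial_value n)%:C * iter n prim (fun=> 1) t.
(** The regularized derivative, with [nu] and [b] for [m k - mu] and
[- gamma]. *)
Definition kderiv t : R[i] := k%:C ^+ m * conv (kern k al nu om b) (fun s => (derive1n m f s)%:C) t.

Lemma locint_initial n : locint (fun t => (initial_value n)%:C * iter n prim (fun=> 1) t).
Proof. by apply: locintZ; apply: locint_iter; exact: locint_cst. Qed.

Lemma locint_remainder : locint taylor_remainder.
Proof.
apply: locintD => //; apply: locintZ.
exact: (@locint_sum _ m (fun n t => (initial_value n)%:C * iter n prim (fun=> 1) t) locint_initial).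
Qed.

Lemma locint_K : locint K.
Proof.
have [rho r0 h] := kern_laplace om b k0 al0 nu0.
by have [] := h (rho + 1)%:C _; rewrite ?ltrDl// => /lapint_locint.
Qed.

Lemma prim_remainder t : prim taylor_remainder t = prim fC t + -1 * \sum_(n < m) (initial_value n)%:C * iter n.+1 prim (fun=> 1) t.
Proof.
have lS := @locint_sum _ m (fun n t => (initial_value n)%:C * iter n prim (fun=> 1) t) locint_initial.
rewrite primD//; last exact: locintZ.
rewrite primZ// (@prim_sum _ _ (fun n t => (initial_value n)%:C * iter n prim (fun=> 1) t))//; last exact: locint_initial.
congr (_ + _ * _); apply: eq_bigr => n _; rewrite primZ//.
by apply: locint_iter; exact: locint_cst.
Qed.

(** On [[0, x]] the almost everywhere derivative may be replaced by the
density, a primitive of a convolution falls on one factor, and the [m]-fold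
primitive of the density is the Taylor remainder of [f]. *)
Lemma kderiv_volterra x : 0 <= x -> iter m.+1 prim kderiv x = k%:C ^+ m * conv K (prim taylor_remainder) x.
Proof.
(* A horizon strictly beyond [x], so that every point of [[0, x]] except 0 is interior. *)
move=> x0; have X0 : 0 < x + 1 by rewrite ltr_wpDl.
have [g [ig [N [mN N0 gN]] fE]] := ac_taylor m0 X0 (fac X0).
pose gC (t : R) : R[i] := (g t)%:C.
have lg : locint gC.
  move=> Y; split.
    by apply: integrableS ig => //; exact: measurable_itv.
  by apply: integrable0.
have dE t : 0 <= t <= x -> kderiv t = k%:C ^+ m * conv K gC t.
  move=> /andP[t0 tx]; rewrite /kderiv kern0_conv; congr (_ * _).
  apply: (@cintegral_eq_off_null _ _ (N `|` [set 0])) => //.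
  - exact: measurableU.
  - by apply: (etrans (measureU0 mN _ _)) => //; exact: lebesgue_measure_set1.
  move=> s /=; rewrite in_itv/= => /andP[s0 st] /not_orP[sN /eqP sn0].
  rewrite gN// in_itv/= lt_neqAle eq_sym sn0 s0/=.
  by apply: le_lt_trans st _; apply: le_lt_trans tx _; rewrite ltrDl.
have xx : 0 <= x <= x by rewrite x0 lexx.
rewrite (iter_prim_congr _ dE xx) iter_primZ; last by apply: locint_conv => //; exact: locint_K.
congr (_ * _); apply: (etrans (iter_prim_conv m.+1 x locint_K lg)).
apply: eq_cintegral => t; rewrite inE/= in_itv/= => /andP[t0 tx].
congr (_ * _); apply: prim_congr => s /andP[s0 st].
rewrite /taylor_remainder /fC fE; last by rewrite s0 (le_trans st)// (le_trans tx)// lerDl.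
by rewrite mulN1r addrAC subrr add0r.
Qed.

Lemma kderiv_lap v : 0 < Re v -> lapint K v -> lapint (prim fC) v -> lapint (prim kderiv) v ->
  v * Lap (prim kderiv) v = k%:C ^+ m * Lap K v *
    (v ^+ m * (v * Lap (prim fC) v) - \sum_(n < m) (initial_value n)%:C * v ^+ (m - n.+1)).
Proof.
move=> v0 iK ip id; have vn := Re_gt0_neq0 v0.
have [h1 E1] := lap_iter m v0 id.
have i1 n : lapint (fun t => (initial_value n)%:C * iter n.+1 prim (fun=> 1) t) v.
  by have [h _] := iter_prim1_lap n.+1 v0; have [] := lapintZ (initial_value n)%:C h.
have [i2 E2] := @lap_sum _ m (fun n t => (initial_value n)%:C * iter n.+1 prim (fun=> 1) t) v i1.
have [i3 E3] := lapintZ (-1) i2; have [i4 E4] := lapintD ip i3.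
have Er : prim taylor_remainder = fun t => prim fC t + -1 * \sum_(n < m) (initial_value n)%:C * iter n.+1 prim (fun=> 1) t.
  by apply/funext => t; exact: prim_remainder.
rewrite -Er in i4 E4.
have ci x : 0 <= x -> cintegrable `[0, x] (fun t => K (x - t) * prim taylor_remainder t).
  move=> x0; have [M hM] := prim_bounded x locint_remainder.
  apply: conv_integrand hM; first exact: locint_K.
  exact: cintegrable_meas (locint_prim locint_remainder x).
have [i5 E5] := lap_conv ci iK i4; have [i6 E6] := lapintZ (k%:C ^+ m) i5.
have : Lap (iter m.+1 prim kderiv) v = k%:C ^+ m * (Lap K v * Lap (prim taylor_remainder) v).
  by rewrite -E5 -E6; apply: Lap_eq => t t0; exact: kderiv_volterra.
rewrite iterSr E1 E4 E3 E2 => E.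
apply: (etrans (mul_shift m (Lap (prim kderiv) v) vn)).
rewrite E [LHS]mulrCA -[RHS]mulrA; congr (_ * _); rewrite [LHS]mulrCA; congr (_ * _).
rewrite [LHS]mulrDr; congr (_ + _).
  exact: (etrans (congr1 (fun w => w * _) (exprSr v m)) (esym (mulrA _ _ _))).
rewrite mulN1r mulrN; congr (- _); rewrite mulr_sumr; apply: eq_bigr => n _.
have [hn ->] := lapintZ (initial_value n)%:C (iter_prim1_lap n.+1 v0).1.
rewrite (iter_prim1_lap n.+1 v0).2 mulrCA; congr (_ * _).
have nm := ltn_ord n; rewrite -[in v ^+ m.+1](subnK nm) -addSn addnC -addSnnS addnC.
by rewrite exprD mulfK ?expf_neq0.
Qed.

End equation.

(** * Continuation along a ray and the transform formula *)

Lemma analytic_shift (R : realType) (F : R -> R[i]) (c d : R) :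
  analytic F (c - d) -> analytic (fun r => F (r - d)) c.
Proof.
move=> [rho [N [r0 tN]]]; exists rho, N; split; first exact: r0.
by apply: tay_ext tN => x _; rewrite addrAC.
Qed.

Section ray.
Context {R : realType}.
Local Notation Re := complex.Re.
Local Notation Im := complex.Im.
Variables (k : R) (al nu om b : R[i]) (m : nat) (f : R -> R) (u : R[i]).
Hypotheses (k0 : 0 < k) (al0 : 0 < Re al) (nu0 : 0 < Re nu) (m0 : (0 < m)%N) (u0 : 0 < Re u).
Hypothesis fac : forall X : R, 0 < X -> AC_on m 0 X f.
Let fC (t : R) : R[i] := (f t)%:C.
Let h := kderiv k al nu om b m f.
Hypotheses (fex : laplace_exists fC u) (hex : laplace_exists h u).
Let z := om * k%:C * cpow (k%:C * u) (- (al / k%:C)).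
Hypothesis z1 : cmod z < 1.

(** The transform of the kernel at [r u], with the powers of [r] separated
so that analyticity in [r] is visible. *)
Definition kernel_ray (r : R) : R[i] := cpow (k%:C * u) (- (nu / k%:C)) *
  (cpow r%:C (- (nu / k%:C)) * cpow (1 - z * cpow r%:C (- (al / k%:C))) (- (b / k%:C))).

Lemma Re_al_k : Re (- (al / k%:C)) = - (Re al / k).
Proof. by rewrite cReN Re_div_k. Qed.

Lemma z_ray r : 1 <= r -> cmod z * r `^ Re (- (al / k%:C)) < 1.
Proof.
move=> r1; apply: le_lt_trans z1; apply: ler_piMr; first exact: cmod_ge0.
rewrite Re_al_k -[leRHS](powRr0 r); apply: ler_powR => //.
by rewrite oppr_le0 divr_ge0 ?ltW.
Qed.

Lemma kernel_ray_analytic r : 1 <= r -> analytic kernel_ray r.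
Proof.
move=> r1; apply: analyticM; first exact: analytic_cst.
by apply: kernel_analytic; [exact: lt_le_trans r1|exact: z_ray].
Qed.

(** Valid for large [r] only; for [r] near 1 the Laplace integral of the
kernel may diverge although [kernel_ray] is defined. *)
Lemma kernel_ray_Lap : exists r0 : R, forall r, r0 < r -> 1 < r ->
  lapint (kern0 k al nu om b) (r%:C * u) /\ Lap (kern0 k al nu om b) (r%:C * u) = kernel_ray r.
Proof.
have [rho rho0 H] := kern0_Lap om b k0 al0 nu0.
exists (rho / Re u) => r rr r1; have r0 : 0 < r by exact: lt_trans r1.
have un := Re_gt0_neq0 u0; have kn := RCneq0 k0.
have E w : cpow (k%:C * (r%:C * u)) w = cpow (k%:C * u) w * cpow r%:C w.
  rewrite mulrCA; apply: (etrans (cpowZ _ r0 _)); [exact: mulf_neq0|exact: mulrC].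
have [||i1 ->] := H (r%:C * u).
- by rewrite cReM cReC cImC mul0r subr0 -ltr_pdivrMr.
- rewrite E mulrA cmodM (cmod_cpowC _ r0); apply: z_ray; exact: ltW.
have Ez : om * k%:C * cpow (k%:C * (r%:C * u)) (- (al / k%:C)) = z * cpow r%:C (- (al / k%:C)).
  by rewrite E mulrA.
by split => //; rewrite Ez E /kernel_ray -[LHS]mulrA.
Qed.

Let A phi (r : R) : R[i] := (r%:C * u) * Lap (prim phi) (r%:C * u).

Lemma Re_ray r : 1 < r -> Re u < Re (r%:C * u).
Proof. by move=> r1; rewrite cReM cReC cImC mul0r subr0 ltr_pMl. Qed.

Lemma ray_analytic phi c : laplace_exists phi u -> 1 < c -> analytic (A phi) c.
Proof.
move=> pex c1; have [_ hv _ [mP [M PM]]] := laplace_continuation u0 pex.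
set P := laplace_partial phi u in hv mP PM.
have d0 : 0 < (c - 1) / 2 by rewrite divr_gt0// subr_gt0.
have an : analytic (fun r => Lap P (r%:C * u)) (c - 1).
  apply: (@lap_analytic _ P u M 0) => //.
    by move=> t t0; rewrite mul0r expR0 mulr1; exact: PM.
  by rewrite mulr_gt0// subr_gt0.
have an2 : analytic (fun r => Lap P ((r - 1)%:C * u)) c.
  exact: (@analytic_shift _ (fun r => Lap P (r%:C * u)) c 1 an).
have an3 : analytic (fun r => (r%:C + - 1) * u) c.
  by apply: analyticM; [apply: analyticD; [exact: analytic_id|exact: analytic_cst]|exact: analytic_cst].
apply: (analytic_ext d0 _ (analyticM an3 an2)) => x xc.
have r1 : 1 < c + x by move: xc; rewrite ler_norml => /andP[h1 _]; lra.
have [_ E] := hv _ (Re_ray r1); rewrite /A E.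
have -> : (c + x)%:C * u - u = (c + x - 1)%:C * u by rewrite rmorphB mulrBl mul1r.
by rewrite rmorphB.
Qed.

Lemma ray_limit phi : laplace_exists phi u ->
  ccv (0 : R)^'+ (fun d => A phi (1 + d)) (laplace phi u).
Proof.
move=> pex; have [_ _ hc _] := laplace_continuation u0 pex.
have FF : Filter (0 : R)^'+ by exact: at_right_proper_filter.
apply: eq_ccv hc => d.
have E : (1 + d)%:C * u = u + d%:C * u by rewrite rmorphD rmorph1 mulrDl mul1r.
by rewrite -E.
Qed.

Let S r : R[i] := \sum_(n < m) (initial_value f n)%:C * (r%:C * u) ^+ (m - n.+1).

Lemma analytic_ru c : analytic (fun r => r%:C * u) c.
Proof. by apply: analyticM; [exact: analytic_id|exact: analytic_cst]. Qed.

Lemma analytic_S c : analytic S c.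
Proof.
apply: (@analytic_sum _ m (fun n r => (initial_value f n)%:C * (r%:C * u) ^+ (m - n.+1))) => n _.
by apply: analyticM; [exact: analytic_cst|apply: analyticX; exact: analytic_ru].
Qed.

(** For large [r] this is the transformed Volterra equation; both sides
are analytic for [r > 1]. *)
Lemma ray_identity r : 1 < r ->
  A h r = k%:C ^+ m * kernel_ray r * ((r%:C * u) ^+ m * A fC r - S r).
Proof.
have [lf hf _ _] := laplace_continuation u0 fex; have [lh hh _ _] := laplace_continuation u0 hex.
have [r0 hK] := kernel_ray_Lap.
pose G r := A h r + - 1 * (k%:C ^+ m * kernel_ray r * ((r%:C * u) ^+ m * A fC r + - 1 * S r)).
suff G0 : forall r, 1 < r -> G r = 0.
  by move=> /G0; rewrite /G !mulN1r => /eqP; rewrite subr_eq0 => /eqP.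
apply: (@analytic_eq0 _ _ (Num.max r0 1)).
  move=> c c1; apply: analyticD; first exact: ray_analytic.
  apply: analyticM; first exact: analytic_cst.
  apply: analyticM.
    by apply: analyticM; [exact: analytic_cst|apply: kernel_ray_analytic; exact: ltW].
  apply: analyticD.
    apply: analyticM; first by apply: analyticX; exact: analytic_ru.
    exact: ray_analytic.
  by apply: analyticM; [exact: analytic_cst|exact: analytic_S].
move=> s; rewrite gt_max => /andP[s0 s1].
have [iK EK] := hK s s0 s1; have us := Re_ray s1; have v0 := lt_trans u0 us.
have D : A h s = k%:C ^+ m * kernel_ray s * ((s%:C * u) ^+ m * A fC s - S s).
  by rewrite -EK; exact: (kderiv_lap k0 al0 nu0 m0 fac lf v0 iK (hf _ us).1 (hh _ us).1).
by rewrite /G D !mulN1r subrr.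
Qed.

(** The limit of [ray_identity] as [r] decreases to 1. *)
Lemma laplace_kderiv : laplace h u =
  k%:C ^+ m * kernel_ray 1 * (u ^+ m * laplace fC u - \sum_(n < m) (initial_value f n)%:C * u ^+ (m - n.+1)).
Proof.
have FF : Filter (0 : R)^'+ by exact: at_right_proper_filter.
have hl := ray_limit hex.
have : ccv (0 : R)^'+ (fun d => k%:C ^+ m * kernel_ray (1 + d) *
    (((1 + d)%:C * u) ^+ m * A fC (1 + d) - S (1 + d)))
   (k%:C ^+ m * kernel_ray 1 * ((1%:C * u) ^+ m * laplace fC u - S 1)).
  apply: ccvM.
    by apply: ccvM; [exact: ccv_cst|apply: analytic_right; exact: kernel_ray_analytic].
  apply: ccvB; last by apply: analytic_right; exact: analytic_S.
  apply: ccvM; last exact: ray_limit.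
  by apply: (@analytic_right _ (fun r => (r%:C * u) ^+ m)); apply: analyticX; exact: analytic_ru.
rewrite /S mul1r => hr; apply: ccv_unique hl _.
apply: near_ccv hr; near=> d; rewrite ray_identity//.
by rewrite ltrDl; near: d; exact: nbhs_right_gt.
Unshelve. all: by end_near. Qed.

End ray.

Theorem lemma3p2 (R : realType) (k : R) (alpha mu omega gamma : R[i])
    (m : nat) (f : R -> R) :
  0 < k ->
  0 < complex.Re alpha ->
  0 < complex.Re mu ->
  m = kPrabhakar_order k mu ->
  (forall b : R, 0 < b -> AC_on m 0 b f) ->
  forall u : R[i],
  0 < complex.Re u ->
  laplace_exists (fun t => (f t)%:C) u ->
  laplace_exists (kPrabhakar_deriv k alpha mu omega gamma f) u ->
  `|omega * k%:C * cpow (k%:C * u) (- (alpha / k%:C))| < 1 ->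
  laplace (kPrabhakar_deriv k alpha mu omega gamma f) u =
    cpow (k%:C * u) (mu / k%:C)
    * cpow (1 - omega * k%:C * cpow (k%:C * u) (- (alpha / k%:C)))
        (gamma / k%:C)
    * laplace (fun t => (f t)%:C) u
    - \sum_(0 <= n < m)
        k%:C ^+ n.+1
        * cpow (k%:C * u) ((- (n.+1%:R * k%:C) + mu) / k%:C)
        * cpow (1 - omega * k%:C * cpow (k%:C * u) (- (alpha / k%:C)))
            (gamma / k%:C)
        * (lim (derive1n n f x @[x --> 0^'+]))%:C.
Proof.
move=> k0 al0 mu0 mE fac u u0 fex hex; rewrite normcE (ltcR _ 1) => z1.
have m0 : (0 < m)%N by rewrite mE.
have nu0 : 0 < complex.Re (m%:R * k%:C - mu).
  rewrite cReB cReM cRe_nat cReC cIm_nat mul0r subr0 subr_gt0 -ltr_pdivrMr//.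
  by rewrite mE; apply: truncnS_gt.
have hE : kPrabhakar_deriv k alpha mu omega gamma f =
    kderiv k alpha (m%:R * k%:C - mu) omega (- gamma) m f.
  by apply/funext => t; rewrite /kPrabhakar_deriv /kderiv mE.
rewrite hE in hex *.
have kn := RCneq0 k0; have un := Re_gt0_neq0 u0.
have kun : k%:C * u != 0 by rewrite mulf_neq0.
rewrite (laplace_kderiv k0 al0 nu0 m0 u0 fac fex hex z1) /kernel_ray.
have -> : cpow 1%:C (- ((m%:R * k%:C - mu) / k%:C)) = 1.
  by rewrite cpowC// ln1 mulr0 cexp0.
have -> : cpow 1%:C (- (alpha / k%:C)) = 1 :> R[i] by rewrite cpowC// ln1 mulr0 cexp0.
rewrite mul1r mulr1 mulNr opprK.
have -> : cpow (k%:C * u) (- ((m%:R * k%:C - mu) / k%:C)) = cpow (k%:C * u) (mu / k%:C) / (k%:C * u) ^+ m.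
  by rewrite -cpow_nat// -cpowN// -cpowD//; congr cpow; field.
set W := cpow (1 - _) _; set V := cpow _ (mu / _).
rewrite mulrBr; congr (_ - _).
  by rewrite exprMn; field; rewrite !expf_neq0.
rewrite big_mkord mulr_sumr; apply: eq_bigr => n _.
have -> : cpow (k%:C * u) ((- (n.+1%:R * k%:C) + mu) / k%:C) = V / (k%:C * u) ^+ n.+1.
  by rewrite -cpow_nat// -cpowN// -cpowD//; congr cpow; field.
have nm := ltn_ord n; rewrite -/(initial_value f n) !exprMn.
have -> : u ^+ m = u ^+ (m - n.+1) * u ^+ n.+1 by rewrite -exprD subnK.
move: (expf_neq0 m kn) (expf_neq0 (m - n.+1) un) (expf_neq0 n.+1 un) (expf_neq0 n.+1 kn).
move: (k%:C ^+ m) (u ^+ (m - n.+1)) (u ^+ n.+1) (k%:C ^+ n.+1) => a b c d ha hb hc hd.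
by field; rewrite ha hb hc hd.
Qed.
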